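(* Let $\Omega\subseteq\mathbb{R}^d$ be open, $p\in[1,\infty)$, $m\in\mathbb{N}$, $v\in\mathcal{C}^{m,*}(\Omega)$, $s:\pi_m\to[0,\infty)$ an admissible map, and $n\ge1$. Assume that for every $\alpha\in\pi_m^0$ there is $C>0$ with $|\partial^\alpha v(x)|\le C$ for all $x\in M_n\setminus M_{2n}$. Then for every $f\in W^{m,p}_{s,v}(\Omega)$ we have $\chi_nf\in W^{m,p}(\Omega)$, with $$D^\alpha(\chi_nf)=\sum_{0\le\beta\le\alpha}\binom{\alpha}{\beta}D^\beta_vf\,\partial^{\alpha-\beta}\chi_n\quad\text{for all }\alpha\in\pi_m^0,$$ and the map $W^{m,p}_{s,v}(\Omega)\to W^{m,p}(\Omega)$, $f\mapsto\chi_nf$, is continuous.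
   Context: Throughout, $\Omega\subseteq\mathbb{R}^d$ is open, $\mathbb{N}=\{0,1,2,\dots\}$, $p\in[1,\infty)$, $K\Subset\Omega$ means $K$ compact in $\Omega$, $\pi_m=\{\alpha\in\mathbb{N}^d:|\alpha|\le m\}$, $\pi_m^0=\pi_m\setminus\{0\}$, $\beta\le\alpha$ componentwise. A weight is a locally integrable function positive a.e.; $E_p(\Omega)$ is the set of measurable $w$ with $|w|^p$ a weight. For measurable $u$, $L^p_u(\Omega)=\{f:fu\in L^p(\Omega)\}$ with norm $\|fu\|_{L^p}$; $L^p_{u,\mathrm{loc}}$: $fu\in L^p(K)$ for all $K\Subset\Omega$. $\mathcal{C}^{k,*}(\Omega)$: $v\in\mathcal{C}^k(\Omega)$ with $v\ne0$ a.e. Condition (H): for every $K\Subset\Omega$ there is $C>0$ with $|v|\le C|w|$ a.e. in $K$. Weak derivative $D^\alpha_v$ ($|\alpha|\ge1$, $w\in E_p(\Omega)$, $v\in\mathcal{C}^{|\alpha|,*}(\Omega)$ with (H) w.r.t. $w$): for $f\in L^1_{w,\mathrm{loc}}(\Omega)$, $D^\alpha_vf$ is the unique $g\in L^1_{v^{|\alpha|+1},\mathrm{loc}}(\Omega)$, if it exists, with $\int_\Omega f\,\partial^\alpha(v^{|\alpha|+1}\phi)\,dx=(-1)^{|\alpha|}\int_\Omega v^{|\alpha|+1}\phi\,g\,dx$ for all $\phi\in C_c^\infty(\Omega)$; $D^0_vf:=f$. $W^{m,p}_{V,v}(\Omega)$ for $V=\{w_\alpha\}_{\alpha\in\pi_m}\subset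 E_p(\Omega)$, $v\in\mathcal{C}^{m,*}(\Omega)$ with (H) w.r.t. $w_0$: all $f\in L^p_{w_0}(\Omega)$ with $D^\alpha_vf\in L^p_{w_\alpha}(\Omega)$ for $\alpha\in\pi_m^0$, norm $(\sum_{\alpha\in\pi_m}\|w_\alpha D^\alpha_vf\|_{L^p}^p)^{1/p}$. Admissible map: $s:\pi_m\to[0,\infty)$ with $s(\alpha)\le|\alpha|$ and $s(\alpha-\beta)+s(\beta)\le s(\alpha)$ for $\alpha\in\pi_m,\beta\le\alpha$. $W^{m,p}_{s,v}(\Omega):=W^{m,p}_{V,v}(\Omega)$ with $w_\alpha=|v|^{s(\alpha)+1}$. Cut-offs: fix $\eta\in\mathcal{C}^\infty(\mathbb{R})$ with $0\le\eta\le1$, $\eta\equiv1$ on $\mathbb{R}\setminus[-1,1]$, $\eta\equiv0$ on $[-\tfrac12,\tfrac12]$. For $n\ge1$ set $\chi_n:=\eta(n\,v(\cdot))$ and $M_n:=\{x\in\Omega:|v(x)|\le1/n\}$. Thus $\chi_n\equiv1$ on $\Omega\setminus M_n$ and $\chi_n\equiv0$ on $M_{2n}$. *)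

(* Defs.v *)
From HB Require Import structures.
From mathcomp Require Import all_boot all_order all_algebra.
From mathcomp Require Import all_classical all_reals all_analysis.
From Stdlib Require Import ClassicalEpsilon.
Set Implicit Arguments. Unset Strict Implicit. Unset Printing Implicit Defensive.
Import Order.TTheory GRing.Theory Num.Theory.
Import numFieldNormedType.Exports.
Local Open Scope classical_set_scope.
Local Open Scope ring_scope.

Definition rV_measure_display : measure_display.
Proof. exact. Qed.

Section rV_measurable.
Context {R : realType} (d : nat).
Let coors : 'I_d -> 'rV[R]_d -> R := fun i x => x ord0 i.
Let rV_set0 : g_sigma_preimage coors set0.
Proof. exact: sigma_algebra0. Qed.
Let rV_setC A : g_sigma_preimage coors A -> g_sigma_preimage coors (~` A).
Proof. exact: sigma_algebraC. Qed.
Let rV_bigcup (F : _^nat) : (forall i, g_sigma_preimage coors (F i)) ->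
  g_sigma_preimage coors (\bigcup_i (F i)).
Proof. exact: sigma_algebra_bigcup. Qed.
HB.instance Definition _ := @isMeasurable.Build rV_measure_display
  'rV[R]_d (g_sigma_preimage coors) rV_set0 rV_setC rV_bigcup.
End rV_measurable.

Section Lebesgue.
Context {R : realType} {d : nat}.
Local Open Scope ereal_scope.

Definition rbox (a b : 'rV[R]_d) : set 'rV[R]_d :=
  [set x | forall i, (a ord0 i <= x ord0 i <= b ord0 i)%R].

Definition rvol (a b : 'rV[R]_d) : R :=
  (\prod_(i < d) Num.max (b ord0 i - a ord0 i) 0)%R.

(** Lebesgue outer measure on R^d; on (Borel) measurable sets this is the
    Lebesgue measure. *)
Definition leb (A : set 'rV[R]_d) : \bar R :=
  ereal_inf [set r | exists a b : nat -> 'rV[R]_d,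
    A `<=` \bigcup_k rbox (a k) (b k) /\
    r = \sum_(0 <= k <oo) (rvol (a k) (b k))%:E].
End Lebesgue.

Definition mindex (d : nat) := 'I_d -> nat.
Definition mabs d (a : mindex d) : nat := (\sum_(i < d) a i)%N.
Definition mle d (b a : mindex d) : Prop := forall i, (b i <= a i)%N.
Definition msub d (a b : mindex d) : mindex d := fun i => (a i - b i)%N.
Definition mzero d : mindex d := fun _ => 0%N.
Definition mbinom d (a b : mindex d) : nat := (\prod_(i < d) 'C(a i, b i))%N.

Section Partial.
Context {R : realType} {d : nat}.

Definition dpartial (i : 'I_d) (g : 'rV[R]_d -> R) : 'rV[R]_d -> R :=
  fun x => derive g x (delta_mx 0 i).

Definition dpartialn (a : mindex d) (g : 'rV[R]_d -> R) : 'rV[R]_d -> R :=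
  foldr (fun i h => iter (a i) (dpartial i) h) g (enum 'I_d).

Definition Ck (O : set 'rV[R]_d) (k : nat) (g : 'rV[R]_d -> R) : Prop :=
  (forall a : mindex d, (mabs a < k)%N -> forall i x, O x ->
      derivable (dpartialn a g) x (delta_mx 0 i)) /\
  (forall a : mindex d, (mabs a <= k)%N -> forall x, O x ->
      {for x, continuous (dpartialn a g)}).

Definition smooth (g : 'rV[R]_d -> R) : Prop :=
  forall k, Ck setT k g.

Definition test_fun (O : set 'rV[R]_d) (phi : 'rV[R]_d -> R) : Prop :=
  smooth phi /\ compact (closure [set x | phi x != 0]) /\
  closure [set x | phi x != 0] `<=` O.

Definition Ckstar (O : set 'rV[R]_d) (k : nat) (v : 'rV[R]_d -> R) : Prop :=
  Ck O k v /\ leb (O `&` [set x | v x = 0]) = 0%E.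
End Partial.

Section Weighted.
Context {R : realType} {d : nat}.
Local Open Scope ereal_scope.

Definition inLp (O : set 'rV[R]_d) (p : R) (u f : 'rV[R]_d -> R) : Prop :=
  measurable_fun O (fun x => f x * u x)%R /\
  \int[leb]_(x in O) ((`|f x * u x| `^ p)%R)%:E < +oo.

Definition inL1loc (O : set 'rV[R]_d) (u f : 'rV[R]_d -> R) : Prop :=
  forall K, compact K -> K `<=` O ->
    measurable_fun K (fun x => f x * u x)%R /\
    \int[leb]_(x in K) (`|f x * u x|%R)%:E < +oo.

Definition is_weak_vderiv (O : set 'rV[R]_d) (v : 'rV[R]_d -> R)
    (a : mindex d) (f g : 'rV[R]_d -> R) : Prop :=
  inL1loc O (fun x => v x ^+ (mabs a).+1)%R g /\
  forall phi, test_fun O phi ->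
    \int[leb]_(x in O)
       (f x * dpartialn a (fun y => v y ^+ (mabs a).+1 * phi y) x)%:E
    = ((-1) ^+ mabs a)%:E *
      \int[leb]_(x in O) (v x ^+ (mabs a).+1 * phi x * g x)%:E.

(** D^alpha_v f : the (a.e. unique) weak derivative, D^0_v f = f *)
Definition Dv (O : set 'rV[R]_d) (v : 'rV[R]_d -> R) (a : mindex d)
    (f : 'rV[R]_d -> R) : 'rV[R]_d -> R :=
  if mabs a == 0%N then f
  else epsilon (inhabits (fun _ => 0%R)) (is_weak_vderiv O v a f).

Definition inW (O : set 'rV[R]_d) (m : nat) (p : R)
    (w : mindex d -> 'rV[R]_d -> R) (v : 'rV[R]_d -> R) (f : 'rV[R]_d -> R)
    : Prop :=
  inLp O p (w (@mzero d)) f /\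
  forall a : mindex d, (0 < mabs a <= m)%N ->
    exists g, is_weak_vderiv O v a f g /\ inLp O p (w a) g.

Definition Wnorm (O : set 'rV[R]_d) (m : nat) (p : R)
    (w : mindex d -> 'rV[R]_d -> R) (v : 'rV[R]_d -> R) (f : 'rV[R]_d -> R)
    : \bar R :=
  (\sum_(a : {ffun 'I_d -> 'I_m.+1} | (mabs (fun i : 'I_d => nat_of_ord (a i)) <= m)%N)
     \int[leb]_(x in O)
       ((`|w (fun i : 'I_d => nat_of_ord (a i)) x * Dv O v (fun i : 'I_d => nat_of_ord (a i)) f x|
           `^ p)%R)%:E) `^ (p^-1)%R.

Definition sweights (s : mindex d -> R) (v : 'rV[R]_d -> R) :
    mindex d -> 'rV[R]_d -> R :=
  fun a x => (`|v x| `^ (s a + 1))%R.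

(** unweighted case: W^{m,p}(Omega) = W^{m,p}_{V,1} with all w_alpha = 1 *)
Definition rv_one_weights : mindex d -> 'rV[R]_d -> R := fun _ _ => 1%R.
Definition rv_one : 'rV[R]_d -> R := fun _ => 1%R.

Definition admissible (m : nat) (s : mindex d -> R) : Prop :=
  forall a : mindex d, (mabs a <= m)%N ->
    (0 <= s a)%R /\ (s a <= (mabs a)%:R)%R /\
    forall b : mindex d, mle b a -> (s (msub a b) + s b <= s a)%R.
End Weighted.

Definition cutoff_eta {R : realType} (eta : R -> R) : Prop :=
  (forall k x, derivable (derive1n k eta) x 1) /\
  (forall x, 0 <= eta x <= 1)%R /\
  (forall x, (1 < `|x|)%R -> eta x = 1) /\
  (forall x, (`|x| <= 2^-1)%R -> eta x = 0).

Definition chi {R : realType} {d : nat} (eta : R -> R) (v : 'rV[R]_d -> R)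
  (n : nat) : 'rV[R]_d -> R := fun x => eta (n%:R * v x)%R.

Definition Mset {R : realType} {d : nat} (O : set 'rV[R]_d)
  (v : 'rV[R]_d -> R) (n : nat) : set 'rV[R]_d :=
  [set x | O x /\ (`|v x| <= n%:R^-1)%R].

Definition msum_le {R : realType} {d : nat} (a : mindex d) (F : mindex d -> R)
  : R :=
  (\sum_(b : {ffun 'I_d -> 'I_(mabs a).+1} | [forall i, (val (b i) <= a i)%N])
     F (fun i : 'I_d => nat_of_ord (b i)))%R.

(* Main.v *)
Require Import Defs.
From HB Require Import structures.
From mathcomp Require Import all_boot all_order all_algebra.
From mathcomp Require Import all_classical all_reals all_analysis.
From mathcomp Require Import measurable_realfun ring lra.
From Stdlib Require Import ClassicalEpsilon.
Import Order.TTheory GRing.Theory Num.Theory.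
Import numFieldNormedType.Exports.
Local Open Scope classical_set_scope.
Local Open Scope ring_scope.
Set Implicit Arguments. Unset Strict Implicit. Unset Printing Implicit Defensive.

(* For a test function phi, the reversed Leibniz rule
     chi D^a phi = sum_(b <= a) (-1)^|a - b| C(a, b) D^b (phi D^(a - b) chi)
   suggests to test the weighted derivative D_v^b f with
   psi := v^-(|b| + 1) phi D^(a - b) chi, so that v^(|b| + 1) psi is the function
   on the right. As chi vanishes where v is small, psi is as regular as
   D^(a - b) chi, but this is only C^|b|: the defining identity of D_v^b f has to
   be extended to C^|b| test functions with compact support. This is done by
   mollification, one coordinate at a time, with a kernel made from eta', and
   by dominated convergence; domination is possible because each D^c (v^(|b| + 1))
   with |c| <= |b| has a factor v, and f v is locally integrable.
   Continuity and membership follow from |D^(a - b) chi| <= C |v|^(s(b) + 1), as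
   D^(a - b) chi is bounded and vanishes where |v| < 1 / (2 n). Since D_v^b f is
   selected by epsilon, the norm of chi f is only computed up to a.e. uniqueness
   of weak derivatives (du Bois-Reymond). *)

(** * Partial derivatives *)

(** Three obstacles shape the development. [Ck] controls partial derivatives in one fixed order,
    whereas the Leibniz formulas peel off derivatives in any order; so symmetry of mixed derivatives
    is settled early and [Ck] is replaced by [ckb]. [leb] is given as an infimum over covers by
    boxes and must first be shown to be a measure on the Borel sets, in positive dimension. The
    derivatives of [v] are bounded only on the layer [Mset O v n] minus [Mset O v (2 * n)]; this
    still bounds the derivatives of [chi] on all of [O], because the derivatives of [eta] of
    positive order vanish at [n * v] off this layer. Mollifying one coordinate at a time reduces
    smoothing to integrals over an interval that depend on a parameter. The weighted derivatives are
    carried along as an arbitrary family [G]: membership in the target space uses representatives of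
    finite weighted norm, the norm estimate those selected by epsilon. This estimate asks only that
    weighted derivatives exist, so it applies directly to a difference of two functions, the form in
    which continuity is stated. *)

Section Directional.
Context {R : realType} {V : normedModType R}.
Implicit Types (f g : V -> R) (x y v : V).

Lemma is_derive_line f x v (t : R) (df : R) :
  is_derive (x + t *: v) v f df -> is_derive t 1 (fun s => f (x + s *: v)) df.
Proof.
have E : (fun h : R => h^-1 *: ((f \o shift (x + t *: v)) (h *: v) - f (x + t *: v)))
  = (fun h : R => h^-1 *: (((fun s => f (x + s *: v)) \o shift t) (h *: 1)
       - f (x + t *: v))).
  apply/funext => h /=; congr (_ *: (f _ - _)).
  rewrite addrCA -scalerDl; congr (_ + (_ + _) *: _).
  by rewrite -[RHS]/(h * 1) mulr1.
case=> d1 d2; apply: DeriveDef.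
  by move: d1; rewrite /derivable E.
by rewrite -d2 /derive E.
Qed.

Lemma derivable_translate f z y v :
  derivable f (y + z) v -> derivable (fun x => f (x + z)) y v.
Proof.
rewrite /derivable; set F := (X in cvg (X @ _)); set G := (X in _ -> cvg (X @ _)).
suff -> : F = G by [].
by apply/funext => h; rewrite /F /G /= !addrA.
Qed.

Lemma derive_translate f z y v :
  'D_v (fun x => f (x + z)) y = 'D_v f (y + z).
Proof.
rewrite /derive; set F := (X in lim (X @ _) = _).
set G := (X in _ = lim (X @ _)); suff -> : F = G by [].
by apply/funext => h; rewrite /F /G /= !addrA.
Qed.

(** Difference quotients use increments of both signs; locating the intermediate point by
    [|t| <= |s|] avoids a case distinction at every use. *)
Lemma MVT_signed (u : R -> R) (s : R) :
  (forall t, `|t| <= `|s| -> derivable u t 1) ->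
  exists2 t, `|t| <= `|s| & u s - u 0 = s * 'D_1 u t.
Proof.
move=> du.
have [s0|s0|->] := ltgtP s 0; last first.
- by exists 0 => //; rewrite subrr mul0r.
- have [||c] := @MVT_segment _ u (fun t => 'D_1 u t) 0 s (ltW s0).
  + move=> x; rewrite in_itv /= => /andP[x0 xs]; apply: DeriveDef => //.
    by apply: du; rewrite !gtr0_norm // ltW.
  + apply: derivable_within_continuous => x; rewrite in_itv /= => /andP[x0 xs].
    by apply: du; rewrite ger0_norm // gtr0_norm.
  + rewrite in_itv /= => /andP[c0 cs] ->; exists c.
      by rewrite ger0_norm // gtr0_norm.
    by rewrite subr0 mulrC.
- have [||c] := @MVT_segment _ u (fun t => 'D_1 u t) s 0 (ltW s0).
  + move=> x; rewrite in_itv /= => /andP[x0 xs]; apply: DeriveDef => //.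
    by apply: du; rewrite !ltr0_norm // lerN2 ltW.
  + apply: derivable_within_continuous => x; rewrite in_itv /= => /andP[x0 xs].
    by apply: du; rewrite ler0_norm // ltr0_norm // lerN2.
  + rewrite in_itv /= => /andP[c0 cs] E; exists c.
      by rewrite ler0_norm // ltr0_norm // lerN2.
    by rewrite -opprB E sub0r mulrN opprK mulrC.
Qed.

Lemma MVT_dir f y v (s : R) :
  (forall t : R, `|t| <= `|s| -> derivable f (y + t *: v) v) ->
  exists2 t : R, `|t| <= `|s| & f (y + s *: v) - f y = s * 'D_v f (y + t *: v).
Proof.
move=> df.
have D (t : R) : `|t| <= `|s| -> is_derive t (1 : R) (fun r : R => f (y + r *: v)) ('D_v f (y + t *: v)).
  by move=> ts; apply: is_derive_line; apply: DeriveDef => //; exact: df.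
have [t ts|t ts] := @MVT_signed (fun r : R => f (y + r *: v)) s.
  exact: (@ex_derive _ _ _ _ _ _ _ (D _ ts)).
rewrite scale0r addr0 => ->; exists t => //.
by have [_ ->] := D _ ts.
Qed.

Lemma is_derive_epsP f x v (l : R) :
  (forall e : R, 0 < e -> \forall h \near 0^', `|h^-1 * (f (x + h *: v) - f x) - l| <= e) ->
  is_derive x v f l.
Proof.
move=> H.
have C : h^-1 *: ((f \o shift x) (h *: v) - f x) @[h --> 0^'] --> l.
  apply/cvgrPdist_le => e e0; near=> h; rewrite distrC /=.
  rewrite [_ *: _ + x]addrC; near: h; exact: H.
by apply: DeriveDef; [apply/cvg_ex; exists l|apply: cvg_lim].
Unshelve. all: by end_near. Qed.

Lemma is_derive_eps f x v (l : R) (e : R) : is_derive x v f l -> 0 < e ->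
  \forall h \near 0^', `|h^-1 * (f (x + h *: v) - f x) - l| <= e.
Proof.
move=> [d1 <-] e0; have /cvgrPdist_le/(_ _ e0) := d1.
apply: filterS => h; rewrite distrC /= [_ *: _ + x]addrC; exact.
Qed.

(** Serves a difference quotient in [s] of a derivative that is itself approximated by quotients in
    [t]. Dividing by [s] magnifies the errors, so each is allowed only [e * |s| / 2]; [r] will be a
    mixed derivative at an intermediate point. *)
Lemma second_difference (s t a b c d p q r e : R) : s != 0 -> t != 0 ->
  (a - b) - (c - d) = s * (t * r) ->
  `|t^-1 * (a - b) - p| <= e * `|s| / 2 -> `|t^-1 * (c - d) - q| <= e * `|s| / 2 ->
  `|s^-1 * (p - q) - r| <= e.
Proof.
move=> s0 t0 E T1 T2.
have -> : s^-1 * (p - q) - r =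
    - (s^-1 * ((t^-1 * (a - b) - p) - (t^-1 * (c - d) - q))).
  have -> : r = s^-1 * (t^-1 * (s * (t * r))) by field; rewrite s0 t0.
  by rewrite -E; ring.
rewrite normrN normrM normfV ler_pdivrMl ?normr_gt0 //.
apply: (le_trans (ler_normB _ _)); rewrite [X in _ <= X]mulrC.
by have := lerD T1 T2; rewrite -splitr.
Qed.

(* Only the continuity of one of the mixed derivatives is needed (Peano): by
   two applications of the mean value theorem, the second difference quotient
   is a value of this mixed derivative at a nearby point. *)
Lemma mixed_derive f (O : set V) x v w : open O -> O x ->
  (forall y, O y -> derivable f y v) -> (forall y, O y -> derivable f y w) ->
  (forall y, O y -> derivable (fun z => 'D_v f z) y w) ->
  {for x, continuous (fun z => 'D_w (fun y => 'D_v f y) z)} ->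
  is_derive x v (fun z => 'D_w f z) ('D_w (fun y => 'D_v f y) x).
Proof.
move=> oO Ox dv dw dvw ctn; set D := 'D_w _ x.
apply: is_derive_epsP => e e0.
have [r /= r0 rP] : exists2 r : R, 0 < r &
    forall y, `|y - x| < r -> O y /\ `|'D_w (fun y => 'D_v f y) y - D| <= e.
  have H : \forall y \near x, O y /\ `|'D_w (fun y => 'D_v f y) y - D| <= e.
    near=> y; split; first by near: y; apply: open_nbhs_nbhs.
    by rewrite distrC; near: y; move/cvgrPdist_le : ctn; apply.
  have [r /= r0 rP] := (iffLR (nbhs_ballP _ _)) H; exists r => // y yr.
  by apply: rP; rewrite -ball_normE /= distrC.
pose N := 1 + `|v| + `|w|.
have N0 : 0 < N by rewrite /N -addrA ltr_pwDl // addr_ge0.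
have q0 : 0 < r / N by rewrite divr_gt0.
have close (s t : R) : `|s| < r / N -> `|t| < r / N -> `|(x + s *: v + t *: w) - x| < r.
  move=> sq tq; rewrite addrAC [x + _]addrC addrK.
  apply: (le_lt_trans (ler_normD _ _)); rewrite !normrZ.
  have : r / N * N = r by rewrite divfK // gt_eqF.
  have := mulr_ge0 (normr_ge0 t) (normr_ge0 w).
  have := ler_wpM2r (normr_ge0 v) (ltW sq).
  have := ler_wpM2r (normr_ge0 w) (ltW tq).
  rewrite /N in q0 *; set a := r / _ in q0 *.
  by move=> H1 H2 H3 H4; nra.
have z0 : `|0 : R| < r / N by rewrite normr0.
near=> s.
have sq : `|s| < r / N.
  near: s; exact: dnbhs0_lt.
have s0 : s != 0 by near: s; apply: nbhs_dnbhs_neq.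
pose Q := 'D_w f (x + s *: v) - 'D_w f x.
rewrite -/Q.
(* The slack [e'] pays for replacing derivatives in direction [w] by difference quotients; [t] is
   chosen after [s] and [e']. *)
apply/ler_addgt0Pr => e' e'0.
have Oq (s' t' : R) : `|s'| < r / N -> `|t'| < r / N -> O (x + s' *: v + t' *: w).
  by move=> a b; have [] := rP _ (close _ _ a b).
have es : 0 < e' * `|s| / 2 by rewrite !mulr_gt0 // ?normr_gt0 // invr_gt0.
have d1 : is_derive (x + s *: v) w f ('D_w f (x + s *: v)).
  have := Oq s 0 sq z0; rewrite scale0r addr0 => Os.
  exact: DeriveDef (dw _ Os) erefl.
have d2 : is_derive x w f ('D_w f x) by exact: DeriveDef (dw _ Ox) erefl.
have [t [tq t0 T1 T2]] : exists t, [/\ `|t| < r / N, t != 0,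
   `|t^-1 * (f (x + s *: v + t *: w) - f (x + s *: v)) - 'D_w f (x + s *: v)| <= e' * `|s| / 2 &
   `|t^-1 * (f (x + t *: w) - f x) - 'D_w f x| <= e' * `|s| / 2].
  near (0 : R)^' => t; exists t; split.
  - near: t; exact: dnbhs0_lt.
  - by near: t; apply: nbhs_dnbhs_neq.
  - by near: t; apply: is_derive_eps.
  - by near: t; apply: is_derive_eps.
have [|s1 s1s E1] := @MVT_dir (fun y => f (y + t *: w) - f y) x v s.
  move=> s' s's; have s'q := le_lt_trans s's sq.
  apply: (@derivableB _ _ _ (fun y => f (y + t *: w)) f).
    exact: (@derivable_translate f (t *: w) _ v (dv _ (Oq s' t s'q tq))).
  by rewrite -[_ + _]addr0 -[X in _ + X](scale0r w); apply: dv; exact: Oq.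
have s1q := le_lt_trans s1s sq.
have [|t1 t1t E2] := @MVT_dir (fun y => 'D_v f y) (x + s1 *: v) w t.
  move=> t' t't; have t'q := le_lt_trans t't tq.
  by apply: dvw; exact: Oq.
have [_ W] := rP _ (close _ _ s1q (le_lt_trans t1t tq)).
have E3 : 'D_v (fun y => f (y + t *: w) - f y) (x + s1 *: v) =
   'D_v f (x + s1 *: v + t *: w) - 'D_v f (x + s1 *: v).
  rewrite -(derive_translate f (t *: w)).
  have D1 := @derivable_translate f (t *: w) _ v (dv _ (Oq s1 t s1q tq)).
  have D2 : derivable f (x + s1 *: v) v.
    have := Oq s1 0 s1q z0; rewrite scale0r addr0; exact: dv.
  exact: (deriveB D1 D2).
have K := second_difference s0 t0 (etrans E1 (congr1 (fun z => s * z) (etrans E3 E2))) T1 T2.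
apply: (le_trans (ler_distD ('D_w (fun y => 'D_v f y) (x + s1 *: v + t1 *: w)) _ _)).
by rewrite [X in X <= _]addrC (lerD W K).
Unshelve. all: by end_near. Qed.

End Directional.

(** * Multi-indices *)

Section MultiIndex.
Context {d : nat}.
Implicit Types a b : mindex d.

Definition madd1 a (i : 'I_d) : mindex d := fun j => (a j + (j == i))%N.

Lemma madd1C a i j : madd1 (madd1 a i) j = madd1 (madd1 a j) i.
Proof. by apply/funext => k; rewrite /madd1 addnAC. Qed.

Lemma mabs_madd1 a i : mabs (madd1 a i) = (mabs a).+1.
Proof.
rewrite /mabs /madd1 big_split /= [X in (_ + X)%N](bigD1 i) //= eqxx.
by rewrite [X in (_ + (_ + X))%N]big1 ?addn0 ?addn1 // => j /negbTE ->.
Qed.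

Lemma mabs_eq0 a : mabs a = 0%N -> a = @Defs.mzero d.
Proof.
move=> /eqP; rewrite /mabs sum_nat_eq0 => /forallP a0.
by apply/funext => i; apply/eqP; exact: (implyP (a0 i)).
Qed.

(** [dpartialn] applies the coordinate of smallest index last. Splitting off the first nonzero
    coordinate therefore exposes the outermost derivative without commuting anything. *)
Lemma mindex_first a : (0 < mabs a)%N ->
  exists a' j, a = madd1 a' j /\ forall i : 'I_d, (i < j)%N -> a' i = 0%N.
Proof.
move=> a0; have [i0 i0P] : exists i0, (0 < a i0)%N.
  apply/existsP; rewrite -[X in is_true X]negbK negb_exists; apply/negP => /forallP H.
  by move: a0; rewrite /mabs big1 // => i _; move: (H i); rewrite -eqn0Ngt => /eqP.
have [j j0 jmin] := @arg_minnP _ i0 (fun i => (0 < a i)%N) (fun i : 'I_d => val i) i0P.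
exists (fun i => (a i - (i == j))%N), j; split.
  apply/funext => i; rewrite /madd1; have [->|_] := eqVneq i j; last by rewrite subn0 addn0.
  by rewrite subnK.
move=> i ij; rewrite (_ : i == j = false) ?subn0; last first.
  by apply: contraTF ij => /eqP ->; rewrite ltnn.
by apply/eqP; rewrite -leqn0 leqNgt; apply: contraTN ij => /jmin; rewrite -leqNgt.
Qed.

Lemma mindex_ind (P : mindex d -> Prop) : P (@Defs.mzero d) ->
  (forall a i, P a -> P (madd1 a i)) -> forall a, P a.
Proof.
move=> P0 PS a; have [n] := ubnP (mabs a); elim: n a => // n IH a; rewrite ltnS => an.
have [/mabs_eq0 -> //|/mindex_first [a' [j [aE _]]]] := posnP (mabs a).
by move: an; rewrite aE mabs_madd1 => ?; apply: PS; apply: IH.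
Qed.

End MultiIndex.

(** * Partial derivatives in any order, with bounds *)

Section Ckb.
Context {R : realType} {d : nat}.
Implicit Types (O A : set 'rV[R]_d) (g h : 'rV[R]_d -> R) (a b : mindex d)
  (i : 'I_d) (l : seq 'I_d).

Lemma eq_dpartial O g h i : open O -> (forall x, O x -> g x = h x) ->
  forall x, O x -> dpartial i g x = dpartial i h x.
Proof.
move=> oO gh x Ox; apply: near_eq_derive; near=> y; apply: gh; near: y.
exact: open_nbhs_nbhs.
Unshelve. all: by end_near. Qed.

Lemma eq_derivable O g h v : open O -> (forall x, O x -> g x = h x) ->
  forall x, O x -> derivable g x v -> derivable h x v.
Proof.
move=> oO gh x Ox; apply: near_eq_derivable; near=> y; apply: gh; near: y.
exact: open_nbhs_nbhs.
Unshelve. all: by end_near. Qed.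

Lemma eq_continuous_at O g h : open O -> (forall x, O x -> g x = h x) ->
  forall x, O x -> {for x, continuous g} -> {for x, continuous h}.
Proof.
move=> oO gh x Ox gx.
have H : \forall y \near x, g y = h y.
  by apply: filterS gh _; exact: open_nbhs_nbhs.
rewrite /prop_for /continuous_at -(gh x Ox).
exact: cvg_trans (near_eq_cvg H) gx.
Qed.

Lemma eq_iter_dpartial O g h i n : open O -> (forall x, O x -> g x = h x) ->
  forall x, O x -> iter n (dpartial i) g x = iter n (dpartial i) h x.
Proof. by move=> oO gh; elim: n => //= n IH; exact: eq_dpartial. Qed.

Definition dpartials (l : seq 'I_d) a g :=
  foldr (fun i h => iter (a i) (dpartial i) h) g l.

Lemma eq_dpartials O l a g h : open O -> (forall x, O x -> g x = h x) ->
  forall x, O x -> dpartials l a g x = dpartials l a h x.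
Proof. by move=> oO gh; elim: l => //= i l IH; exact: eq_iter_dpartial. Qed.

Lemma eq_dpartialn O a g h : open O -> (forall x, O x -> g x = h x) ->
  forall x, O x -> dpartialn a g x = dpartialn a h x.
Proof. exact: eq_dpartials. Qed.

Lemma dpartialn0 g : dpartialn (@Defs.mzero d) g = g.
Proof. by rewrite /dpartialn; elim: (enum _) => //= i l ->. Qed.

Lemma eq_in_dpartials (l : seq 'I_d) a b g : {in l, a =1 b} -> dpartials l a g = dpartials l b g.
Proof.
elim: l => //= i l IH ab; rewrite ab ?mem_head // IH // => j jl.
by apply: ab; rewrite inE jl orbT.
Qed.

Lemma madd1_notin (l : seq 'I_d) a i : i \notin l -> {in l, madd1 a i =1 a}.
Proof.
move=> il j jl; rewrite /madd1 (_ : j == i = false) ?addn0 //.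
by apply: contraNF il => /eqP <-.
Qed.

Lemma dpartialn_first a (j : 'I_d) g : (forall i : 'I_d, (i < j)%N -> a i = 0%N) ->
  dpartialn (madd1 a j) g = dpartial j (dpartialn a g).
Proof.
move=> a0; rewrite /dpartialn -!/(dpartials _ _ _).
have : sorted (fun x y : 'I_d => (x < y)%N) (enum 'I_d).
  by have := iota_ltn_sorted 0 d; rewrite -val_enum_ord sorted_map.
have : j \in enum 'I_d by rewrite mem_enum.
elim: (enum 'I_d) (enum_uniq 'I_d) => //= i l IH /andP[il ul].
rewrite inE => jl sl.
have sil : {in l, forall k : 'I_d, (i < k)%N}.
  by apply/allP; apply: order_path_min sl => x y z; exact: ltn_trans.
have [<-|ij] := eqVneq i j.
  rewrite {1}/madd1 eqxx addn1 /=; congr (dpartial _ (iter _ _ _)).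
  by apply: eq_in_dpartials; exact: madd1_notin.
have {}jl : j \in l by move: jl; rewrite eq_sym (negbTE ij).
have ai : a i = 0%N by apply: a0; exact: sil.
by rewrite {1}/madd1 (negbTE ij) ai /=; apply: IH => //; exact: path_sorted sl.
Qed.

Lemma dpartialn_madd10 i g : dpartialn (madd1 (@Defs.mzero d) i) g = dpartial i g.
Proof. by rewrite dpartialn_first // dpartialn0. Qed.

(** Induction on the order, with [j] the first coordinate of [a]. If [j <= i], then [j] stays
    outermost on both sides. If [i < j], the derivatives in [i] and [j] must be exchanged; [Ck]
    provides only the mixed derivative with [i] outermost, which is exactly the one that
    [mixed_derive] asks for. *)
Lemma Ck_dpartial O k g a i : open O -> Ck O k g -> (mabs a < k)%N ->
  forall x, O x -> dpartialn a (dpartial i g) x = dpartialn (madd1 a i) g x.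
Proof.
move=> oO [gD gC]; have [n] := ubnP (mabs a); elim: n a => // n IH a; rewrite ltnS => an ak.
have [/mabs_eq0 -> x Ox|/mindex_first [a' [j [aE a'0]]]] := posnP (mabs a).
  by rewrite dpartialn0 dpartialn_madd10.
move: an ak; rewrite aE mabs_madd1 => a'n a'k x Ox.
rewrite dpartialn_first //.
rewrite (@eq_dpartial O _ (dpartialn (madd1 a' i) g)) //; last first.
  by apply: IH => //; exact: ltnW.
have [ji|ij] := leqP j i.
  rewrite -dpartialn_first ?(madd1C a' i j) // => l lj.
  rewrite /madd1 a'0 // (_ : l == i = false) //.
  by apply: contraTF (leq_trans lj ji) => /eqP ->; rewrite ltnn.
have E1 : dpartialn (madd1 a' i) g = dpartial i (dpartialn a' g).
  by apply: dpartialn_first => l li; apply: a'0; exact: ltn_trans ij.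
have E2 : dpartialn (madd1 a' j) g = dpartial j (dpartialn a' g).
  exact: dpartialn_first.
have E3 : dpartialn (madd1 (madd1 a' j) i) g = dpartial i (dpartialn (madd1 a' j) g).
  apply: dpartialn_first => l li; rewrite /madd1 a'0 ?(ltn_trans li) //.
  rewrite (_ : l == j = false) //.
  by apply: contraTF (ltn_trans li ij) => /eqP ->; rewrite ltnn.
rewrite E1 E3 E2.
have D1 i' y : O y -> derivable (dpartialn a' g) y (delta_mx 0 i').
  by move=> Oy; exact: gD (ltnW a'k) _ _ Oy.
have D2 y : O y -> derivable (dpartial j (dpartialn a' g)) y (delta_mx 0 i).
  have a'jk : (mabs (madd1 a' j) < k)%N by rewrite mabs_madd1.
  by rewrite -E2 => Oy; exact: gD a'jk _ _ Oy.
have C : {for x, continuous (dpartial i (dpartial j (dpartialn a' g)))}.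
  have a''k : (mabs (madd1 (madd1 a' j) i) <= k)%N by rewrite !mabs_madd1.
  by rewrite -E2 -E3; exact: gC a''k _ Ox.
exact: (@derive_val _ _ _ _ _ _ _ (mixed_derive oO Ox (D1 j) (D1 i) D2 C)).
Qed.

(* [ckb O A k g]: on [O], [g] has continuous partial derivatives up to order
   [k], in any order, and all of them are bounded on [A]. *)
Fixpoint ckb O A k g : Prop :=
  [/\ forall x, O x -> {for x, continuous g},
      exists C : R, forall x, A x -> `|g x| <= C &
      if k is k'.+1 then forall i,
        (forall x, O x -> derivable g x (delta_mx 0 i)) /\ ckb O A k' (dpartial i g)
      else True].
Arguments ckb : simpl never.

Lemma ckb_continuous O A k g : ckb O A k g -> forall x, O x -> {for x, continuous g}.
Proof. by case: k => [|k] []. Qed.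

Lemma ckb_bounded O A k g : ckb O A k g -> exists C : R, forall x, A x -> `|g x| <= C.
Proof. by case: k => [|k] []. Qed.

Lemma ckb_derivable O A k g i : ckb O A k.+1 g ->
  forall x, O x -> derivable g x (delta_mx 0 i).
Proof. by move=> [_ _ /(_ i)[]]. Qed.

Lemma ckb_dpartial O A k g i : ckb O A k.+1 g -> ckb O A k (dpartial i g).
Proof. by move=> [_ _ /(_ i)[]]. Qed.

Lemma ckb_le O A (j k : nat) g : (j <= k)%N -> ckb O A k g -> ckb O A j g.
Proof.
elim: k j g => [|k IH] [|j] g //; first by move=> _ [].
by rewrite ltnS => jk [gc gb gd]; split => // i; have [? ?] := gd i; split => //; apply: IH.
Qed.

Lemma ckb_sub O A O' A' k g : O' `<=` O -> A' `<=` A -> ckb O A k g -> ckb O' A' k g.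
Proof.
move=> OO AA; elim: k g => [|k IH] g [gc [C gC] gd]; split.
- by move=> x /OO; exact: gc.
- by exists C => x /AA; exact: gC.
- by [].
- by move=> x /OO; exact: gc.
- by exists C => x /AA; exact: gC.
- by move=> i; have [dg cg] := gd i; split; [by move=> x Ox; exact (dg x (OO x Ox))|exact: IH].
Qed.

Lemma eq_ckb O A k g h : open O -> A `<=` O -> (forall x, O x -> g x = h x) ->
  ckb O A k g -> ckb O A k h.
Proof.
move=> oO AO; elim: k g h => [|k IH] g h gh [gc [C gC] gd]; split => //.
- by move=> x Ox; apply: (eq_continuous_at oO gh Ox); exact: gc.
- by exists C => x Ax; rewrite -gh; [exact: gC|exact: AO].
- by move=> x Ox; apply: (eq_continuous_at oO gh Ox); exact: gc.
- by exists C => x Ax; rewrite -gh; [exact: gC|exact: AO].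
- move=> i; have [dg cg] := gd i; split.
    by move=> x Ox; exact: (eq_derivable oO gh Ox (dg x Ox)).
  by apply: IH cg; exact: eq_dpartial.
Qed.

Lemma ckb_cst O A k (c : R) : open O -> A `<=` O -> ckb O A k (fun=> c).
Proof.
move=> oO AO; elim: k c => [|k IH] c; (split; first by move=> x _; exact: cst_continuous).
- by exists `|c|.
- by [].
- by exists `|c|.
- move=> i; split; first by move=> x _; exact: derivable_cst.
  by apply: eq_ckb (IH 0) => // x _; rewrite /dpartial derive_cst.
Qed.

Lemma ckbD O A k g h : open O -> A `<=` O -> ckb O A k g -> ckb O A k h ->
  ckb O A k (fun x => g x + h x).
Proof.
move=> oO AO; elim: k g h => [|k IH] g h [gc [C gC] gd] [hc [D hD] hd];
  (split; first by move=> x Ox; exact: (continuousD (gc x Ox) (hc x Ox))).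
- exists (C + D) => x Ax; apply: le_trans (ler_normD _ _) _.
  by apply: lerD; [exact: gC|exact: hD].
- by [].
- exists (C + D) => x Ax; apply: le_trans (ler_normD _ _) _.
  by apply: lerD; [exact: gC|exact: hD].
- move=> i; have [dg cg] := gd i; have [dh ch] := hd i; split.
    by move=> x Ox; exact: derivableD (dg _ Ox) (dh _ Ox).
  apply: eq_ckb (IH _ _ cg ch) => // x Ox.
  exact/esym/(deriveD (dg _ Ox) (dh _ Ox)).
Qed.

Lemma dpartialM g h i x : derivable g x (delta_mx 0 i) -> derivable h x (delta_mx 0 i) ->
  dpartial i (fun x => g x * h x) x = dpartial i g x * h x + g x * dpartial i h x.
Proof.
move=> dg dh; rewrite addrC [_ * h x]mulrC; exact: deriveM dg dh.
Qed.

Lemma ckbM O A k g h : open O -> A `<=` O -> ckb O A k g -> ckb O A k h ->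
  ckb O A k (fun x => g x * h x).
Proof.
move=> oO AO; elim: k g h => [|k IH] g h cg ch.
  move: cg ch => [gc [C gC] gd] [hc [D hD] hd].
  split; first by move=> x Ox; exact: (continuousM (gc x Ox) (hc x Ox)).
    exists (C * D) => x Ax; rewrite normrM.
    by apply: ler_pM; rewrite ?normr_ge0 //; [exact: gC|exact: hD].
  by [].
have cg' := ckb_le (leqnSn _) cg; have ch' := ckb_le (leqnSn _) ch.
have [gc [C gC] gd] := cg; have [hc [D hD] hd] := ch.
split; first by move=> x Ox; exact: (continuousM (gc x Ox) (hc x Ox)).
  exists (C * D) => x Ax; rewrite normrM.
  by apply: ler_pM; rewrite ?normr_ge0 //; [exact: gC|exact: hD].
move=> i; have [dg cdg] := gd i; have [dh cdh] := hd i; split.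
  by move=> x Ox; exact: derivableM (dg _ Ox) (dh _ Ox).
apply: eq_ckb (ckbD oO AO (IH _ _ cdg ch') (IH _ _ cg' cdh)) => // x Ox.
by rewrite dpartialM //; [exact: dg|exact: dh].
Qed.

Lemma ckb_iter O A k g i n : ckb O A (n + k) g -> ckb O A k (iter n (dpartial i) g).
Proof.
elim: n k => //= n IH k; move=> cg; apply: ckb_dpartial; apply: IH; by rewrite addnS.
Qed.

Lemma ckb_dpartials O A k l a g : ckb O A (\sum_(i <- l) a i + k) g ->
  ckb O A k (dpartials l a g).
Proof.
elim: l k => [|i l IH] k; first by rewrite big_nil.
by rewrite big_cons addnAC addnC addnA => cg; apply: ckb_iter; apply: IH; rewrite addnA.
Qed.

Lemma ckb_dpartialn O A k a g : ckb O A (mabs a + k) g -> ckb O A k (dpartialn a g).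
Proof.
by move=> cg; apply: ckb_dpartials; rewrite big_enum.
Qed.

Lemma ckb_Ck O A k g : ckb O A k g -> Ck O k g.
Proof.
move=> cg; split=> a ak.
  move=> i; apply: (@ckb_derivable O A 0); apply: ckb_dpartialn.
  by apply: ckb_le cg; rewrite addn1.
by apply: (@ckb_continuous O A 0); apply: ckb_dpartialn; rewrite addn0; exact: ckb_le cg.
Qed.

(** The entry point for the hypotheses on [v], which concern derivatives in the fixed order;
    [Ck_dpartial] transfers them to [dpartial i g]. *)
Lemma Ck_ckb O A k g : open O -> A `<=` O -> Ck O k g ->
  (forall a, (mabs a <= k)%N -> exists C : R, forall x, A x -> `|dpartialn a g x| <= C) ->
  ckb O A k g.
Proof.
move=> oO AO; elim: k g => [|k IH] g [gD gC] gb; split => //.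
- by have := gC (@Defs.mzero d); rewrite dpartialn0; apply; rewrite /mabs big1.
- by have := gb (@Defs.mzero d); rewrite dpartialn0; apply; rewrite /mabs big1.
- by have := gC (@Defs.mzero d); rewrite dpartialn0; apply; rewrite /mabs big1.
- by have := gb (@Defs.mzero d); rewrite dpartialn0; apply; rewrite /mabs big1.
- move=> i; split.
    by have := gD (@Defs.mzero d); rewrite dpartialn0; apply; rewrite /mabs big1.
  have E a : (mabs a <= k)%N ->
      forall x, O x -> dpartialn (madd1 a i) g x = dpartialn a (dpartial i g) x.
    by move=> ak x Ox; apply/esym; exact: (@Ck_dpartial O k.+1).
  apply: IH.
    split=> a ak.
      move=> j x Ox; apply: (eq_derivable oO (E a (ltnW ak)) Ox).
      by apply: gD => //; rewrite mabs_madd1.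
    move=> x Ox; apply: (eq_continuous_at oO (E a ak) Ox).
    by apply: gC => //; rewrite mabs_madd1.
  move=> a ak; have [|C CP] := gb (madd1 a i); first by rewrite mabs_madd1.
  by exists C => x Ax; rewrite -E //; [exact: CP|exact: AO].
Qed.

(** With [A] empty the bounds are void: [ckb O set0 k] is plain regularity of order [k], and is used
    below in this sense. *)
Lemma Ck_ckb0 O k g : open O -> Ck O k g -> ckb O set0 k g.
Proof. by move=> oO cg; apply: Ck_ckb => // a _; exists 0. Qed.

Lemma dpartialC O A g i (j : 'I_d) : open O -> ckb O A 2 g ->
  forall x, O x -> dpartial i (dpartial j g) x = dpartial j (dpartial i g) x.
Proof.
move=> oO cg x Ox.
have D1 i' : forall y, O y -> derivable g y (delta_mx 0 i') by exact: ckb_derivable cg.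
have D2 := ckb_derivable (ckb_dpartial i cg) (i := j).
have C := ckb_continuous (ckb_dpartial j (ckb_dpartial i cg)) Ox.
exact: (@derive_val _ _ _ _ _ _ _ (mixed_derive oO Ox (D1 i) (D1 j) D2 C)).
Qed.

Lemma iter_dpartialC O A g i (j : 'I_d) n : open O -> ckb O A n.+1 g ->
  forall x, O x -> dpartial i (iter n (dpartial j) g) x = iter n (dpartial j) (dpartial i g) x.
Proof.
move=> oO; elim: n => // n IH cg x Ox /=.
rewrite (@dpartialC O A) //.
  by apply: eq_dpartial Ox => //; apply: IH; exact: ckb_le cg.
by apply: ckb_iter; rewrite addn2.
Qed.

Lemma dpartialsC O A g i l a : open O -> ckb O A (\sum_(j <- l) a j).+1 g ->
  forall x, O x -> dpartial i (dpartials l a g) x = dpartials l a (dpartial i g) x.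
Proof.
move=> oO; elim: l => // j l IH; rewrite big_cons => cg x Ox /=.
rewrite (@iter_dpartialC O A) //; last first.
  by apply: ckb_dpartials; rewrite addnS addnC.
apply: eq_iter_dpartial Ox => //; apply: IH.
by apply: ckb_le cg; rewrite ltnS leq_addl.
Qed.

Lemma dpartials_madd1 O A g i l a : open O -> uniq l -> i \in l ->
  ckb O A (\sum_(j <- l) a j).+1 g ->
  forall x, O x -> dpartials l (madd1 a i) g x = dpartials l a (dpartial i g) x.
Proof.
move=> oO; elim: l => //= j l IH /andP[jl ul]; rewrite inE big_cons => il cg x Ox.
have cg' : ckb O A (\sum_(k <- l) a k).+1 g.
  by apply: (ckb_le _ cg); rewrite ltnS leq_addl.
have [ji|ji] := eqVneq j i.
  rewrite ji in jl *; rewrite (eq_in_dpartials _ (madd1_notin a jl)).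
  rewrite {1}/madd1 eqxx addn1 iterSr; apply: eq_iter_dpartial Ox => //.
  move=> y Oy; exact: (dpartialsC i oO cg' Oy).
rewrite {1}/madd1 (negbTE ji) addn0; apply: eq_iter_dpartial Ox => //.
by apply: IH => //; move: il; rewrite eq_sym (negbTE ji).
Qed.

Lemma dpartialn_madd1r O A g i a : open O -> ckb O A (mabs a).+1 g ->
  forall x, O x -> dpartialn (madd1 a i) g x = dpartialn a (dpartial i g) x.
Proof.
move=> oO cg; apply: (@dpartials_madd1 O A); rewrite ?enum_uniq ?mem_enum //.
by rewrite big_enum.
Qed.

Lemma dpartialn_madd1l O A g i a : open O -> ckb O A (mabs a).+1 g ->
  forall x, O x -> dpartialn (madd1 a i) g x = dpartial i (dpartialn a g) x.
Proof.
move=> oO cg x Ox; rewrite (@dpartialn_madd1r O A) //; apply/esym.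
by apply: (@dpartialsC O A) Ox => //; rewrite big_enum.
Qed.

End Ckb.
Arguments ckb : simpl never.

(** * Chain rule and composition with a function of one variable *)

Section ChainRule.
Context {R : realType} {V : normedModType R}.

Lemma is_derive_line0 (f : V -> R) x v (df : R) :
  is_derive (0 : R) (1 : R) (fun s : R => f (x + s *: v)) df -> is_derive x v f df.
Proof.
have E : (fun h : R => h^-1 *: ((f \o shift x) (h *: v) - f x))
  = (fun h : R => h^-1 *: (((fun s : R => f (x + s *: v)) \o shift 0) (h *: (1 : R))
       - f (x + (0 : R) *: v))).
  apply/funext => h /=; rewrite scale0r [h *: _ + 0]addr0 [x + 0]addr0.
  congr (_ *: (f _ - _)); rewrite addrC; congr (_ + _ *: _).
  by rewrite -[RHS]/(h * 1) mulr1.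
case=> d1 d2; apply: DeriveDef.
  by move: d1; rewrite /derivable -E.
by rewrite -d2 /derive -E.
Qed.

Lemma is_derive_comp (t : R -> R) (f : V -> R) x v (dt df : R) :
  is_derive (f x) (1 : R) t dt -> is_derive x v f df ->
  is_derive x v (fun y => t (f y)) (dt * df).
Proof.
move=> Ht Hf; apply: is_derive_line0.
have Hf' : is_derive (0 : R) (1 : R) (fun s : R => f (x + s *: v)) df.
  by apply: is_derive_line; rewrite scale0r addr0.
by apply: (@is_derive1_comp _ t _ _ dt df) => //; rewrite scale0r addr0.
Qed.

End ChainRule.

Section CkbMore.
Context {R : realType} {d : nat}.
Implicit Types (O A : set 'rV[R]_d) (g h u : 'rV[R]_d -> R) (a b : mindex d)
  (i : 'I_d).

(** Glues regularity proved by different formulas on two open sets, as for quotients by powers of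
    [v]. *)
Lemma ckbU O O' k g : ckb O set0 k g -> ckb O' set0 k g -> ckb (O `|` O') set0 k g.
Proof.
elim: k g => [|k IH] g [gc gb gd] [gc' _ gd']; split => //.
- by move=> x [|]; [exact: gc|exact: gc'].
- by move=> x [|]; [exact: gc|exact: gc'].
- move=> i; have [dg cg] := gd i; have [dg' cg'] := gd' i; split.
    move=> x [Ox|Ox]; [exact (dg x Ox)|exact (dg' x Ox)].
  exact: IH.
Qed.

Lemma ckbV O k g : open O -> (forall x, O x -> g x != 0) ->
  ckb O set0 k g -> ckb O set0 k (fun x => (g x)^-1).
Proof.
move=> oO g0; elim: k => [|k IH] cg.
  split=> //; last by exists 0.
  by move=> x Ox; apply: continuousV; [exact: g0|exact: (ckb_continuous cg)].
have cg' := ckb_le (leqnSn _) cg; have [gc _ gd] := cg.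
split; last 2 first.
- by exists 0.
- move=> i; have [dg cdg] := gd i; split.
    move=> x Ox; exact (@derivableV _ _ g x _ (g0 x Ox) (dg x Ox)).
  have := ckbM oO (sub0set _) (ckb_cst k (-1) oO (sub0set _))
     (ckbM oO (sub0set _) (ckbM oO (sub0set _) (IH cg') (IH cg')) cdg).
  apply: eq_ckb => // x Ox.
  rewrite [RHS](@deriveV _ _ g x _ (g0 x Ox) (dg x Ox)).
  by rewrite mulN1r scaleNr -exprVn expr2.
by move=> x Ox; apply: continuousV; [exact: g0|exact: gc].
Qed.

Lemma ckbX O A k g n : open O -> A `<=` O -> ckb O A k g ->
  ckb O A k (fun x => g x ^+ n).
Proof.
move=> oO AO cg; elim: n => [|n IH].
  by apply: eq_ckb (ckb_cst k 1 oO AO) => // x _; rewrite expr0.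
by apply: eq_ckb (ckbM oO AO cg IH) => // x _; rewrite exprS.
Qed.

Lemma dpartialn_cst O a (c : R) : open O -> (0 < mabs a)%N ->
  forall x, O x -> dpartialn a (fun=> c) x = 0.
Proof.
move=> oO; have E i y : dpartial i (fun=> c) y = 0 by rewrite /dpartial derive_cst.
elim/(@mindex_ind d): a c E => [|a i IH] c E; first by rewrite /mabs big1.
move=> _ x Ox; rewrite (@dpartialn_madd1r _ _ O set0) //; last exact: ckb_cst.
have [/mabs_eq0 ->|a0] := posnP (mabs a); first by rewrite dpartialn0.
have E0 i' y : dpartial i' (fun=> 0) y = 0 :> R by rewrite /dpartial derive_cst.
by rewrite (@eq_dpartialn _ _ O _ _ (fun=> 0)) //; exact: IH.
Qed.

Lemma dpartialnD O a g h : open O -> ckb O set0 (mabs a) g -> ckb O set0 (mabs a) h ->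
  forall x, O x -> dpartialn a (fun y => g y + h y) x = dpartialn a g x + dpartialn a h x.
Proof.
move=> oO; elim/(@mindex_ind d): a g h => [|a i IH] g h.
  by move=> _ _ x _; rewrite !dpartialn0.
rewrite mabs_madd1 => cg ch x Ox.
rewrite !(@dpartialn_madd1r _ _ O set0) //; last exact: ckbD.
rewrite -IH //; [|exact: ckb_dpartial|exact: ckb_dpartial].
apply: eq_dpartialn Ox => // y Oy.
exact: deriveD (ckb_derivable cg Oy) (ckb_derivable ch Oy).
Qed.

Section Compose.
Variable th : nat -> R -> R.
Hypothesis thD : forall j t, is_derive t (1 : R) (th j) (th j.+1 t).

Lemma th_continuous j t : {for t, continuous (th j)}.
Proof.
apply: differentiable_continuous; apply/derivable1_diffP.
exact: (@ex_derive _ _ _ _ _ _ _ (thD j t)).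
Qed.

Let is_derive_th O A k j u i x : ckb O A k.+1 u -> O x ->
  is_derive x (delta_mx 0 i) (fun y => th j (u y)) (th j.+1 (u x) * dpartial i u x).
Proof.
move=> cu Ox; apply: is_derive_comp.
exact: DeriveDef (ckb_derivable cu Ox) erefl.
Qed.

Let continuous_th O A k j u x : ckb O A k u -> O x ->
  {for x, continuous (fun y => th j (u y))}.
Proof.
move=> cu Ox; apply: (@continuous_comp _ _ _ u (th j) x).
  exact: ckb_continuous cu _ Ox.
exact: th_continuous.
Qed.

(** The factor [th j.+1 (u x)] vanishes off [A], so bounds on [A] become bounds on [O]. The index
    starts at 1 because the function [th 0] itself need not vanish off [A]. *)
Lemma ckb_localized O A k j u h : open O -> A `<=` O ->
  (forall l, exists C : R, forall x, A x -> `|th l (u x)| <= C) ->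
  (forall l x, O x -> ~ A x -> th l.+1 (u x) = 0) ->
  ckb O A k u -> ckb O A k h -> ckb O O k (fun x => th j.+1 (u x) * h x).
Proof.
move=> oO AO thb th0; elim: k j h => [|k IH] j h cu ch.
  split => //.
    move=> x Ox; have c1 := @continuous_th O A 0 j.+1 u x cu Ox; have c2 := ckb_continuous ch Ox; exact: (continuousM c1 c2).
  have [C CP] := thb j.+1; have [D DP] := ckb_bounded ch.
  exists (Num.max 0 (C * D)) => x Ox; have [Ax|nAx] := pselect (A x).
    rewrite le_max normrM; apply/orP; right.
    by apply: ler_pM; rewrite ?normr_ge0 //; [exact: CP|exact: DP].
  by rewrite th0 // mul0r normr0 le_max lexx.
have cu' := ckb_le (leqnSn _) cu; have ch' := ckb_le (leqnSn _) ch.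
have [c0 b0 _] := ckb_le (leq0n k) (IH j h cu' ch').
split => //.
  move=> i; split.
  move=> x Ox; apply: (@derivableM _ _ (fun y => th j.+1 (u y))).
    exact (@ex_derive _ _ _ _ _ _ _ (is_derive_th j.+1 i cu Ox)).
  exact (ckb_derivable ch Ox).
(* The derivative is the sum of [th j.+2 (u) * (dpartial i u * h)] and [th j.+1 (u) * dpartial i h],
   two products of the same shape. *)
have := ckbD oO (@subset_refl _ O)
  (IH j.+1 _ cu' (ckbM oO AO (ckb_dpartial i cu) ch')) (IH j _ cu' (ckb_dpartial i ch)).
apply: eq_ckb => // x Ox.
rewrite dpartialM.
- by rewrite /dpartial (@derive_val _ _ _ _ _ _ _ (is_derive_th j.+1 i cu Ox)) mulrA.
- exact (@ex_derive _ _ _ _ _ _ _ (is_derive_th j.+1 i cu Ox)).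
- exact (ckb_derivable ch Ox).
Qed.

(** Order 0 is bounded by hypothesis; every first derivative is [th 1 (u) * dpartial i u], to which
    [ckb_localized] applies. *)
Lemma ckb_comp_bounded O A k u : open O -> A `<=` O ->
  (forall l, exists C : R, forall x, A x -> `|th l (u x)| <= C) ->
  (forall l x, O x -> ~ A x -> th l.+1 (u x) = 0) ->
  (exists C : R, forall x, O x -> `|th 0 (u x)| <= C) ->
  ckb O A k u -> ckb O O k (fun x => th 0 (u x)).
Proof.
move=> oO AO thb th0 thB; case: k => [|k] cu; split=> //.
- by move=> x Ox; exact: continuous_th cu Ox.
- by move=> x Ox; exact: continuous_th cu Ox.
- move=> i; split.
    by move=> x Ox; exact (@ex_derive _ _ _ _ _ _ _ (is_derive_th 0 i cu Ox)).
  have := ckb_localized 0 oO AO thb th0 (ckb_le (leqnSn _) cu) (ckb_dpartial i cu).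
  apply: eq_ckb => // x Ox.
  exact: esym (@derive_val _ _ _ _ _ _ _ (is_derive_th 0 i cu Ox)).
Qed.

End Compose.
End CkbMore.

(** * Sums weighted by multi-index binomials *)

Section BinomialSum.
Context {R : realType} {d : nat}.
Implicit Types (a b : mindex d) (i : 'I_d) (F G : mindex d -> R).

(** The binomial vanishes unless [b] is below [a], so the range may be a fixed cube of side [N]
    instead of depending on [a]; this lets induction on [a] keep the index type. *)
Definition lsum (N : nat) a F : R :=
  \sum_(b : {ffun 'I_d -> 'I_N.+1}) (mbinom a (fun i => val (b i)))%:R * F (fun i => val (b i)).

Lemma mbinom_eq0 a b : ~ mle b a -> mbinom a b = 0%N.
Proof.
move=> /existsNP [i /negP]; rewrite -ltnNge => ab.
by rewrite /mbinom (bigD1 i) //= bin_small.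
Qed.

Lemma eq_lsum N a F G : (forall b, mle b a -> F b = G b) -> lsum N a F = lsum N a G.
Proof.
move=> FG; apply: eq_bigr => b _; set b' := (fun i => _).
have [/FG -> //|/mbinom_eq0 ->] := pselect (mle b' a).
by rewrite !mul0r.
Qed.

Lemma lsum0 N F : lsum N (@Defs.mzero d) F = F (@Defs.mzero d).
Proof.
rewrite /lsum (bigD1 [ffun=> ord0]) //= big1 ?addr0.
  have -> : (fun i => val ([ffun=> ord0] i : 'I_N.+1)) = @Defs.mzero d.
    by apply/funext => i; rewrite ffunE.
  by rewrite /mbinom big1 ?mul1r // => i _; rewrite bin0.
move=> b b0; rewrite mbinom_eq0 ?mul0r // => H.
move: b0; apply/negP; rewrite negbK; apply/eqP/ffunP => i; rewrite ffunE.
by apply/val_inj/eqP => /=; rewrite -leqn0; exact: H.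
Qed.

Lemma lsumD N a F G : lsum N a (fun b => F b + G b) = lsum N a F + lsum N a G.
Proof. by rewrite /lsum -big_split; apply: eq_bigr => b _; rewrite mulrDr. Qed.

Lemma mbinom_madd1 a b i :
  mbinom (madd1 a i) b = (mbinom a b +
    (if b i is 0 then 0 else mbinom a (fun j => b j - (j == i))))%N.
Proof.
rewrite /mbinom (bigD1 i) //= [X in (_ * X)%N](eq_bigr (fun j => 'C(a j, b j))); last first.
  by move=> j /negbTE ji; rewrite /madd1 ji addn0.
rewrite [X in (X + _)%N](bigD1 i) //= /madd1 eqxx addn1.
case bi: (b i) => [|k]; first by rewrite !bin0 addn0.
rewrite binS mulnDl; congr (_ + _)%N.
rewrite [RHS](bigD1 i) //= bi eqxx subn1 /=; congr (_ * _)%N.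
by apply: eq_bigr => j /negbTE ->; rewrite subn0.
Qed.

(** Pascal's rule in coordinate [i], followed by a shift of the second half of the sum. The strict
    bound leaves room for the shift inside the cube. *)
Lemma lsum_madd1 N a i F : (a i < N)%N ->
  lsum N (madd1 a i) F = lsum N a (fun b => F b + F (madd1 b i)).
Proof.
move=> aN; rewrite lsumD /lsum.
under eq_bigr => b _ do rewrite mbinom_madd1 natrD mulrDl.
rewrite big_split /=; congr (_ + _).
rewrite (bigID (fun b : {ffun 'I_d -> 'I_N.+1} => val (b i) == 0%N)) /=.
rewrite big1 ?add0r => [|b /eqP ->]; last by rewrite mul0r.
rewrite [RHS](bigID (fun b : {ffun 'I_d -> 'I_N.+1} => val (b i) == N)) /=.
rewrite [X in _ = X + _]big1 ?add0r => [|b /eqP bN]; last first.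
  rewrite mbinom_eq0 ?mul0r // => /(_ i); rewrite bN.
  by rewrite leqNgt aN.
(* [up] and [dn] are mutually inverse between the [b] with [b i != N] and those with [b i != 0]; the
   excluded terms have just been shown to vanish. *)
pose up (b : {ffun 'I_d -> 'I_N.+1}) : {ffun 'I_d -> 'I_N.+1} :=
  [ffun j => inord (val (b j) + (j == i))].
pose dn (b : {ffun 'I_d -> 'I_N.+1}) : {ffun 'I_d -> 'I_N.+1} :=
  [ffun j => inord (val (b j) - (j == i))].
have upE (b : {ffun 'I_d -> 'I_N.+1}) (j : 'I_d) : val (b i) != N -> val (up b j) = (val (b j) + (j == i))%N.
  move=> bN; rewrite ffunE /= inordK //; have [->|_] := eqVneq j i.
    by rewrite addn1 ltnS ltn_neqAle bN -ltnS ltn_ord.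
  by rewrite addn0.
have dnE (b : {ffun 'I_d -> 'I_N.+1}) (j : 'I_d) : val (dn b j) = (val (b j) - (j == i))%N.
  by rewrite ffunE /= inordK // (leq_ltn_trans (leq_subr _ _)).
rewrite (reindex_onto up dn); last first.
  move=> b b0; apply/ffunP => j; apply: val_inj; rewrite upE ?dnE.
    by rewrite subnK //; have [->|//] := eqVneq j i; rewrite lt0n.
  rewrite eqxx subn1 neq_ltn; apply/orP; left.
  by have := ltn_ord (b i); rewrite ltnS; apply: leq_trans; rewrite prednK // lt0n.
have nN (b : {ffun 'I_d -> 'I_N.+1}) : dn (up b) = b -> val (b i) != N.
  move=> bE; apply/eqP => bN; have H : (val (up b i) - 1)%N = N.
    by have := dnE (up b) i; rewrite bE eqxx => <-.
  have := ltn_ord (up b i); move: H; rewrite /= subn1.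
  case: (nat_of_ord (up b i)) => [N0|k /= ->]; last by rewrite ltnS ltnn.
  by rewrite -N0 in aN.
apply: eq_big => b.
  apply/andP/idP => [[b0 /eqP bE]|bN]; first exact: nN.
  split; first by rewrite upE // eqxx addn1.
  by apply/eqP/ffunP => j; apply: val_inj; rewrite dnE upE // addnK.
case/andP => b0 /eqP bE; have bN := nN b bE.
have -> : (fun j => val (up b j)) = madd1 (fun j => val (b j)) i.
  by apply/funext => j; rewrite upE.
rewrite upE // eqxx addn1; congr (_%:R * _).
congr mbinom; apply/funext => j; have /= -> := upE b j bN.
by rewrite addnK.
Qed.

Lemma leq_mabs a i : (a i <= mabs a)%N.
Proof. by rewrite /mabs (bigD1 i) //= leq_addr. Qed.

Lemma msum_leE a F : msum_le a (fun b => (mbinom a b)%:R * F b) = lsum (mabs a) a F.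
Proof.
rewrite /msum_le /lsum [RHS](bigID (fun b : {ffun 'I_d -> 'I_(mabs a).+1} => [forall i, (val (b i) <= a i)%N])) /=.
rewrite [X in _ = _ + X]big1 ?addr0 // => b /forallP H.
by rewrite mbinom_eq0 ?mul0r.
Qed.

Lemma msub_madd1 b a i : mle b a -> msub (madd1 a i) b = madd1 (msub a b) i.
Proof. by move=> ba; apply/funext => j; rewrite /msub /madd1 addnBAC. Qed.

Lemma msub_madd2 b a i : msub (madd1 a i) (madd1 b i) = msub a b.
Proof. by apply/funext => j; rewrite /msub /madd1 subnDr. Qed.

Lemma mabs_msub b a : mle b a -> (mabs (msub a b) + mabs b)%N = mabs a.
Proof.
move=> ba; rewrite /mabs -big_split; apply: eq_bigr => i _.
by rewrite /= /msub subnK.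
Qed.

Lemma mle_mabs b a : mle b a -> (mabs b <= mabs a)%N.
Proof. by move=> /mabs_msub <-; rewrite leq_addl. Qed.

Lemma mle_msub b a : mle b a -> (mabs (msub a b) <= mabs a)%N.
Proof. by move=> /mabs_msub <-; rewrite leq_addr. Qed.

End BinomialSum.

(** * The Leibniz rule and its reversed form *)

Section Leibniz.
Context {R : realType} {d : nat}.
Implicit Types (O A : set 'rV[R]_d) (g h : 'rV[R]_d -> R) (a b : mindex d)
  (i : 'I_d).

Lemma dpartialnM O N a g h : open O -> (mabs a <= N)%N ->
  ckb O set0 (mabs a) g -> ckb O set0 (mabs a) h ->
  forall x, O x -> dpartialn a (fun y => g y * h y) x =
    lsum N a (fun b => dpartialn b g x * dpartialn (msub a b) h x).
Proof.
move=> oO; elim/(@mindex_ind d): a g h => [|a i IH] g h.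
  by move=> _ _ _ x _; rewrite lsum0 !dpartialn0.
rewrite mabs_madd1 => aN cg ch x Ox.
have s0 := @sub0set _ O.
have cg' := ckb_le (leqnSn _) cg; have ch' := ckb_le (leqnSn _) ch.
have dg := ckb_dpartial i cg; have dh := ckb_dpartial i ch.
rewrite (@dpartialn_madd1r _ _ O set0) //; last exact: ckbM.
rewrite (@eq_dpartialn _ _ O _ _ (fun y => dpartial i g y * h y + g y * dpartial i h y)) //; last first.
  by move=> y Oy; apply: dpartialM; [exact (ckb_derivable cg Oy)|exact (ckb_derivable ch Oy)].
rewrite (dpartialnD oO (ckbM oO s0 dg ch') (ckbM oO s0 cg' dh)) //.
rewrite !IH ?(ltnW aN) // lsum_madd1; last exact: leq_ltn_trans (leq_mabs _ _) aN.
rewrite -lsumD; apply: eq_lsum => b ba.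
rewrite [RHS]addrC msub_madd2 msub_madd1 //.
rewrite (@dpartialn_madd1r _ _ O set0 g) //; last first.
  by apply: ckb_le cg; rewrite ltnS; exact: mle_mabs.
rewrite (@dpartialn_madd1r _ _ O set0 h) //.
by apply: ckb_le ch; rewrite ltnS; exact: mle_msub.
Qed.

(** The induction hypothesis is applied to [dpartial i g]. In each term, with [k] the derivative of
    [h] of index [msub a b], the product rule gives [dpartial i g * k = dpartial i (g * k) - g *
    dpartial i k]; the two parts belong to [madd1 b i] and to [b], and [lsum_madd1] collects
    them. *)
Lemma mul_dpartialn O N a g h : open O -> (mabs a <= N)%N ->
  ckb O set0 (mabs a) g -> ckb O set0 (mabs a) h ->
  forall x, O x -> h x * dpartialn a g x =
    lsum N a (fun b => (-1) ^+ mabs (msub a b) *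
      dpartialn b (fun y => g y * dpartialn (msub a b) h y) x).
Proof.
move=> oO; elim/(@mindex_ind d): a g => [|a i IH] g.
  move=> _ _ _ x _; rewrite lsum0 !dpartialn0.
  rewrite (_ : msub _ _ = @Defs.mzero d) // ?dpartialn0.
  by rewrite /mabs big1 // mul1r mulrC.
rewrite mabs_madd1 => aN cg ch x Ox.
have s0 := @sub0set _ O.
have cg' := ckb_le (leqnSn _) cg; have ch' := ckb_le (leqnSn _) ch.
have dg := ckb_dpartial i cg; have dh := ckb_dpartial i ch.
rewrite (@dpartialn_madd1r _ _ O set0) // IH ?(ltnW aN) //.
rewrite lsum_madd1; last exact: leq_ltn_trans (leq_mabs _ _) aN.
apply: eq_lsum => b ba; rewrite msub_madd2 msub_madd1 // mabs_madd1 exprS mulN1r mulNr.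
rewrite addrC -mulrBr; congr (_ * _).
have E := mabs_msub ba.
have c1 : ckb O set0 (mabs b).+1 (dpartialn (msub a b) h).
  by apply: ckb_dpartialn; rewrite addnS E.
have c2 : ckb O set0 (mabs b).+1 g.
  by apply: ckb_le cg; rewrite ltnS; exact: mle_mabs.
have c3 : ckb O set0 (mabs b) (dpartial i g) by exact: ckb_dpartial.
have c4 : ckb O set0 (mabs b) (dpartialn (madd1 (msub a b) i) h).
  by apply: ckb_dpartialn; rewrite mabs_madd1 addSn E.
rewrite (@dpartialn_madd1r _ _ O set0 _ i b) //; last exact: ckbM.
have c1' := ckb_le (leqnSn _) c1; have c2' := ckb_le (leqnSn _) c2.
apply: (addIr (dpartialn b (fun y => g y * dpartialn (madd1 (msub a b) i) h y) x)).
rewrite subrK -(@dpartialnD _ _ O) //; [|exact: ckbM|exact: ckbM].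
apply: eq_dpartialn Ox => // y Oy.
rewrite dpartialM; [|exact (ckb_derivable c2 Oy)|exact (ckb_derivable c1 Oy)].
rewrite (@dpartialn_madd1l _ _ O set0 h) //.
by apply: ckb_le ch; rewrite ltnS; exact: mle_msub.
Qed.

End Leibniz.

(** * Lebesgue measure *)

Section LebesgueOuter.
Context {R : realType} {d : nat}.
Notation T := 'rV[R]_d.+1.
Local Open Scope ereal_scope.

Lemma rvol_ge0 (a b : T) : (0 <= rvol a b)%R.
Proof. by rewrite /rvol; apply: prodr_ge0 => i _; rewrite le_max lexx orbT. Qed.

(** Positive dimension enters here. Finite covers can thus be padded to sequences by boxes of volume
    0. *)
Lemma rvol_degenerate (a : T) : rvol a a = 0%R.
Proof. by rewrite /rvol big_ord_recl subrr maxxx mul0r. Qed.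

Lemma rboxes_ge0 (a b : nat -> T) : 0 <= \sum_(0 <= k <oo) (rvol (a k) (b k))%:E.
Proof. by apply: nneseries_ge0 => n _ _; rewrite lee_fin rvol_ge0. Qed.

Lemma leb_le (A : set T) (a b : nat -> T) : A `<=` \bigcup_k rbox (a k) (b k) ->
  leb A <= \sum_(0 <= k <oo) (rvol (a k) (b k))%:E.
Proof. by move=> AB; apply: ereal_inf_lbound; exists a, b. Qed.

Lemma leb_ge0 (A : set T) : 0 <= leb A.
Proof.
by apply: le_ereal_inf_tmp => r [a [b [_ ->]]]; exact: rboxes_ge0.
Qed.

Lemma leb0 : leb (set0 : set T) = 0.
Proof.
apply/eqP; rewrite eq_le leb_ge0 andbT.
apply: le_trans (@leb_le _ (fun=> 0%R) (fun=> 0%R) (sub0set _)) _.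
by rewrite eseries0 // => n _ _; rewrite rvol_degenerate.
Qed.

Lemma leb_mono : {homo (@leb R d.+1) : A B / A `<=` B >-> A <= B}.
Proof.
move=> A B AB; apply: ereal_inf_le_tmp => r [a [b [Bab ->]]].
by exists a, b; split => //; exact: subset_trans Bab.
Qed.

Lemma leb_sigma_subadditive : sigma_subadditive (@leb R d.+1).
Proof.
move=> A; have [[i ioo]|] := pselect (exists i, leb (A i) = +oo).
  rewrite (eseries_pinfty _ _ ioo) ?leey// => n _.
  by rewrite -ltNye (lt_le_trans _ (leb_ge0 _)).
rewrite -forallNE => Aoo.
apply/lee_addgt0Pr => e e0.
rewrite (le_trans _ (epsilon_trick _ _ (ltW e0)))//; last by move=> n; exact: leb_ge0.
pose P n (G : (nat -> T) * (nat -> T)) := A n `<=` \bigcup_k rbox (G.1 k) (G.2 k) /\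
  \sum_(0 <= k <oo) (rvol (G.1 k) (G.2 k))%:E <= leb (A n) + (e / (2 ^ n.+1)%:R)%:E.
have [G PG] : {G : nat -> (nat -> T) * (nat -> T) & forall n, P n (G n)}.
  apply: (@boolp.choice _ _ P) => n; rewrite /P.
  have en0 : (0 < e / (2 ^ n.+1)%:R)%R by rewrite divr_gt0 // ltr0n expn_gt0.
  have fn : leb (A n) \is a fin_num by rewrite ge0_fin_numE ?leb_ge0 // ltey; exact/eqP/Aoo.
  have [r [a [b [Aab ->]]] rlt] := lb_ereal_inf_adherent en0 fn.
  by exists (a, b); split => //; exact: ltW.
pose V (ij : nat * nat) : \bar R := (rvol ((G ij.1).1 ij.2) ((G ij.1).2 ij.2))%:E.
have V_ge0 x : 0 <= V x by rewrite lee_fin rvol_ge0.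
(* The covers of all [A n] form one family indexed by pairs. A bijection with [nat] makes it a
   single cover, and nonnegativity turns the sum over pairs into the iterated sum. *)
apply: (@le_trans _ _ (\esum_(i in [set: nat * nat]) V i)).
  have /card_esym/ppcard_eqP[f] := card_nat2.
  have -> : \esum_(i in setT) V i = \sum_(k <oo) V (f k).
    rewrite -(esum_pred_image V f xpredT)//; last first.
      by move=> x y _ _ /(congr1 f^-1%FUN); rewrite !funK ?inE.
    congr (esum _ _); apply/seteqP; split => // x _.
    by exists (f^-1%FUN x) => //; rewrite invK ?inE.
  apply: (@leb_le _ (fun k => (G (f k).1).1 (f k).2) (fun k => (G (f k).1).2 (f k).2)).
  move=> t [i _ /(proj1 (PG i))[j _ Bijt]].
  by exists (f^-1%FUN (i, j)) => //=; rewrite invK ?inE.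
rewrite (_ : esum _ _ = \sum_(i <oo) \sum_(j <oo ) V (i, j)); last first.
  pose J : nat -> set (nat * nat) := fun i => [set (i, j) | j in setT].
  rewrite (_ : setT = \bigcup_k J k); last first.
    by rewrite predeqE => -[a b]; split => // _; exists a => //; exists b.
  rewrite esum_bigcupT /=; last 2 first.
    - apply/trivIsetP => i j _ _ ij.
      rewrite predeqE => -[n m] /=; split => //= -[] [_] _ [<-{n} _].
      by move=> [m' _] [] /esym/eqP; rewrite (negbTE ij).
    - by [].
  rewrite -(image_id [set: nat]) -fun_true esum_pred_image//; last first.
    by move=> n _; exact: esum_ge0.
  apply: eq_eseriesr => /= j _.
  rewrite -(esum_pred_image V (pair j) predT)//=; last first.
    by move=> ? ? _ _; exact: (@can_inj _ _ _ snd).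
  by congr esum; rewrite predeqE => -[a b]; split; move=> [i _ <-]; exists i.
apply: lee_nneseries => [n _ _|n _].
  by apply: nneseries_ge0 => k _ _; exact: V_ge0.
by have [_] := PG n.
Qed.

HB.instance Definition _ := isOuterMeasure.Build R T (@leb R d.+1)
  leb0 leb_ge0 leb_mono leb_sigma_subadditive.

Definition set_coord (x : T) (i : 'I_d.+1) (u : R) : T :=
  (\row_j if j == i then u else x ord0 j)%R.

(** A hyperplane cuts the box in two. The identity also covers empty boxes and hyperplanes that miss
    the box, as side lengths are truncated at 0. *)
Lemma rvol_split (a b : T) i (c : R) :
  (rvol (set_coord a i (Num.max (a ord0 i) c)) b +
   rvol a (set_coord b i (Num.min (b ord0 i) c)) = rvol a b)%R.
Proof.
rewrite /rvol [X in (X + _)%R](bigD1 i) //= [X in (_ + X)%R](bigD1 i) //= [RHS](bigD1 i) //=.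
rewrite !mxE eqxx.
rewrite (eq_bigr (fun j => Num.max (b ord0 j - a ord0 j) 0)%R); last first.
  by move=> j /negbTE ji; rewrite !mxE ji.
rewrite [X in (_ + _ * X)%R](eq_bigr (fun j => Num.max (b ord0 j - a ord0 j) 0)%R); last first.
  by move=> j /negbTE ji; rewrite !mxE ji.
rewrite -mulrDl; congr (_ * _)%R.
move: (a ord0 i) (b ord0 i) => p q.
rewrite /Num.min /Num.max.
repeat (case: ifPn); rewrite -?leNgt; move=> *; lra.
Qed.

(** Cutting every box of a cover of [X] along the hyperplane yields covers of both parts of [X] with
    the same total volume. *)
Lemma halfspace_caratheodory i (c : R) :
  (@leb R d.+1).-caratheodory [set x : T | (c < x ord0 i)%R].
Proof.
apply: le_caratheodory_measurable => X; set H := [set x | _].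
change (leb (X `&` H) + leb (X `&` ~` H) <= leb X).
rewrite {3}/leb; apply: le_ereal_inf_tmp => r [a [b [Xab ->]]].
pose a' k := set_coord (a k) i (Num.max (a k ord0 i) c).
pose b' k := set_coord (b k) i (Num.min (b k ord0 i) c).
have -> : \sum_(0 <= k <oo) (rvol (a k) (b k))%:E =
  \sum_(0 <= k <oo) (rvol (a' k) (b k))%:E + \sum_(0 <= k <oo) (rvol (a k) (b' k))%:E.
  rewrite -nneseriesD; [|by move=> n _ _; rewrite lee_fin rvol_ge0..].
  by apply: eq_eseriesr => k _; rewrite -EFinD rvol_split.
apply: leeD; apply: leb_le.
- move=> x [/Xab [k _ xk]]; rewrite /H /= => cx; exists k => // j.
  rewrite mxE; case: eqP => [->|_]; last exact: xk.
  by have /andP[h ->] := xk i; rewrite ge_max h ltW.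
- move=> x [/Xab [k _ xk]]; rewrite /H /= => /negP; rewrite -leNgt => cx; exists k => // j.
  rewrite mxE; case: eqP => [->|_]; last exact: xk.
  by have /andP[-> h] := xk i; rewrite le_min h cx.
Qed.

Lemma measurable_gen_coord (A : set T) :
  measurable A -> g_sigma_preimage (fun i (x : T) => x ord0 i) A.
Proof. by []. Qed.

(** The Caratheodory sets form a sigma-algebra, and the measurable sets are generated by coordinate
    half-spaces. *)
Lemma measurable_caratheodory (A : set T) :
  measurable A -> (@leb R d.+1).-caratheodory A.
Proof.
move=> /measurable_gen_coord; rewrite /g_sigma_preimage.
suff : <<s \big[setU/set0]_(i < d.+1)
    preimage_set_system setT (fun x : T => x ord0 i) measurable >> `<=`
    (@leb R d.+1).-caratheodory by exact.
apply: smallest_sub.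
  split; first exact: caratheodory_measurable_set0.
    by move=> B mB; rewrite setTD; exact: caratheodory_measurable_setC.
  by move=> F mF; exact: caratheodory_measurable_bigcup.
rewrite -bigcup_mkord_ord => B [i _ [C mC <-]].
have mf : measurable_fun (setT : set (caratheodory_type (@leb R d.+1)))
    (fun x : T => x ord0 (inord i)).
  apply: (measurability _ (RGenOInfty.measurableE R)) => _ [_ [c ->]] <-.
  rewrite setTI (_ : _ @^-1` _ = [set x : T | (c < x ord0 (inord i))%R]); last first.
    by apply/seteqP; split => x /=; rewrite in_itv /= andbT.
  exact: halfspace_caratheodory.
exact: mf.
Qed.

Lemma leb_semi_sigma_additive : semi_sigma_additive (@leb R d.+1).
Proof.
move=> F mF tF mUF.
apply: (@caratheodory_measure_sigma_additive _ _ (@leb R d.+1)) => //.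
  by move=> i; exact: measurable_caratheodory.
exact: measurable_caratheodory.
Qed.

HB.instance Definition _ := isMeasure.Build _ _ R (@leb R d.+1)
  leb0 leb_ge0 leb_semi_sigma_additive.

Lemma leb_rbox_fin (a b : T) : leb (rbox a b) < +oo.
Proof.
apply: (@le_lt_trans _ _ (\sum_(0 <= k <oo) (rvol a (if k == 0%N then b else a))%:E)).
  by apply: (@leb_le _ (fun=> a) (fun k => if k == 0%N then b else a)) => x xab; exists 0%N.
rewrite (@eseries_mkcond _ _ _) (nneseries_split 0 1) //; last first.
  by move=> k _; rewrite lee_fin rvol_ge0.
rewrite big_nat1 eseries0 ?adde0 ?ltry // => -[//|k] _ _ /=.
by rewrite rvol_degenerate.
Qed.

End LebesgueOuter.

(** * Boxes, compact sets and Borel measurability *)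

Section Borel.
Context {R : realType} {d : nat}.
Notation T := 'rV[R]_d.+1.

Lemma rV_norm_lt (x : T) (e : R) : 0 < e -> (forall i, `|x ord0 i| < e) -> `|x| < e.
Proof.
move=> e0 xe; rewrite [X in X < _]/Num.norm /= mx_normrE; apply/bigmax_ltP; split => //.
by move=> [i j] _ /=; rewrite ord1; exact: xe.
Qed.

Lemma rV_coord_le (x : T) i : `|x ord0 i| <= `|x|.
Proof.
rewrite [X in _ <= X]/Num.norm /= mx_normrE; apply/bigmax_geP; right => /=.
by exists (ord0, i).
Qed.

Lemma rV_norm_le (x : T) (e : R) : 0 <= e -> (forall i, `|x ord0 i| <= e) -> `|x| <= e.
Proof.
move=> e0 xe; apply/ler_addgt0Pr => r r0; apply/ltW/rV_norm_lt; first exact: ltr_wpDl.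
by move=> i; apply: le_lt_trans (xe i) _; rewrite ltrDl.
Qed.

Definition obox (a b : T) : set T :=
  [set x | forall i, a ord0 i < x ord0 i < b ord0 i].

Lemma obox_rbox (a b : T) : obox a b `<=` rbox a b.
Proof. by move=> x xab i; have /andP[h1 h2] := xab i; rewrite !ltW. Qed.

(** Cubes with rational centre and radius [1 / (n + 1)] are countable, and those whose closed cube
    lies in [O] have open cubes covering [O]. The closed cubes are compact subsets of [O], which
    makes local statements on [O] countable. *)
Lemma open_oboxes (O : set T) : open O -> exists a b : nat -> T,
  O = \bigcup_k obox (a k) (b k) /\ forall k, rbox (a k) (b k) `<=` O.
Proof.
move=> oO.
pose lo (c : 'rV[rat]_d.+1 * nat) : T := \row_i (ratr (c.1 ord0 i) - c.2.+1%:R^-1).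
pose hi (c : 'rV[rat]_d.+1 * nat) : T := \row_i (ratr (c.1 ord0 i) + c.2.+1%:R^-1).
pose cube c := rbox (lo c) (hi c).
pose good k c := (unpickle k = Some c) /\ cube c `<=` O.
(* Numbers that do not encode a good cube get an empty box, whose lower corner exceeds the upper
   one. *)
pose ab k : T * T := if pselect (exists c, good k c) is left P then
  (lo (projT1 (cid P)), hi (projT1 (cid P))) else (const_mx 1, const_mx 0).
have abO k : rbox (ab k).1 (ab k).2 `<=` O.
  rewrite /ab; case: pselect => [P|nP] /=.
    by have [_ cO] := projT2 (cid P); exact: cO.
  by move=> x /(_ ord0); rewrite !mxE => /andP[h1 h2]; have := le_trans h1 h2; rewrite ler10.
exists (fun k => (ab k).1), (fun k => (ab k).2); split => //.
apply/seteqP; split; last by move=> x [k _] /obox_rbox; exact: abO.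
move=> x Ox.
have [e /= e0 eO] := (iffLR (nbhs_ballP _ _)) (open_nbhs_nbhs (conj oO Ox)).
have [n ne] : exists n : nat, n.+1%:R^-1 < e / 2.
  have e20 : 0 < e / 2 by rewrite divr_gt0.
  exists (Num.truncn (e / 2)^-1).
  rewrite invf_plt ?posrE // ?ltr0n //.
  exact: truncnS_gt.
(* The centre exceeds [x] by less than [r] in each coordinate, so the cube contains [x] and stays
   within [2 * r < e] of it. *)
pose r : R := n.+1%:R^-1.
have r0 : 0 < r by rewrite invr_gt0 ltr0n.
have Q i : exists q : rat, ratr q \in `]x ord0 i, (x ord0 i + r)[.
  by apply: rat_in_itvoo; rewrite ltrDl.
have [q qP] := @boolp.choice _ _ _ Q.
pose c : 'rV[rat]_d.+1 * nat := (\row_i q i, n).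
have gc : good (pickle c) c.
  split; first exact: pickleK.
  move=> y yc; apply: eO; rewrite -ball_normE /=.
  apply: rV_norm_lt => // i; rewrite !mxE.
  have := yc i; rewrite !mxE -/r /= => /andP[h1 h2].
  have := qP i; rewrite in_itv /= => /andP[h3 h4].
  by rewrite ltr_norml; apply/andP; split; rewrite -/r in ne; lra.
exists (pickle c) => //; rewrite /ab; case: pselect => [P|nP] /=; last first.
  by case: nP; exists c.
have [] := projT2 (cid P); rewrite pickleK => -[<-] _ i.
rewrite !mxE -/r; have := qP i; rewrite in_itv /= => /andP[h3 h4].
by apply/andP; split; lra.
Qed.

Lemma open_rboxes (O : set T) : open O -> exists a b : nat -> T,
  O = \bigcup_k rbox (a k) (b k) /\ forall k, rbox (a k) (b k) `<=` O.
Proof.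
move=> /open_oboxes [a [b [OE abO]]]; exists a, b; split => //.
apply/seteqP; split; last by move=> x [k _]; exact: abO.
by rewrite [X in X `<=` _]OE => x [k _ xk]; exists k => //; exact: obox_rbox.
Qed.

Lemma measurable_coord i : measurable_fun setT (fun x : T => x ord0 i).
Proof.
move=> _ B mB; rewrite setTI.
suff : g_sigma_preimage (fun i (x : T) => x ord0 i) ((fun x : T => x ord0 i) @^-1` B) by [].
apply: sub_sigma_algebra; rewrite -bigcup_mkord_ord; exists i => //=.
by exists B => //; rewrite setTI inord_val.
Qed.

Lemma rbox_itv (a b : T) :
  rbox a b = \bigcap_(i in [set: 'I_d.+1]) ((fun x : T => x ord0 i) @^-1` `[a ord0 i, b ord0 i]).
Proof.
apply/seteqP; split => [x xab i _|x xab i]; first by rewrite /= in_itv; exact: xab.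
by have := xab i Logic.I; rewrite /= in_itv.
Qed.

Lemma measurable_rbox (a b : T) : measurable (rbox a b).
Proof.
rewrite rbox_itv; apply: fin_bigcap_measurable => // i _.
by rewrite -[X in measurable X]setTI; exact (measurable_coord i measurableT (measurable_itv _)).
Qed.

Lemma measurable_openrV (O : set T) : open O -> measurable O.
Proof.
move=> /open_rboxes [a [b [-> _]]]; apply: bigcupT_measurable => k.
exact: measurable_rbox.
Qed.

Lemma measurable_closedrV (C : set T) : closed C -> measurable C.
Proof.
by move=> cC; rewrite -[C]setCK; apply: measurableC; apply: measurable_openrV; exact: closed_openC.
Qed.

Lemma compact_closedrV (K : set T) : compact K -> closed K.
Proof. by apply: compact_closed; exact: norm_hausdorff. Qed.

Lemma measurable_compactrV (K : set T) : compact K -> measurable K.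
Proof. by move=> cK; exact: measurable_closedrV (compact_closedrV cK). Qed.

Lemma compact_rbox (a b : T) : compact (rbox a b).
Proof.
rewrite (_ : rbox a b = [set v : T | forall i, v ord0 i \in `[a ord0 i, b ord0 i]]).
  apply: (@rV_compact _ _ (fun i => `[a ord0 i, b ord0 i]%classic)).
  by move=> i; exact: segment_compact.
by apply/seteqP; split => x xab i; have := xab i; rewrite in_itv.
Qed.

Lemma compact_sub_rbox (K : set T) : compact K -> exists M : R, 0 < M /\
  forall x, K x -> forall i, `|x ord0 i| < M.
Proof.
move=> /compact_bounded [M [_ MK]].
have M1 : M < `|M| + 1 by rewrite ltr_pwDr // ler_norm.
exists (`|M| + 1 + 1); split; first by rewrite !ltr_wpDl // addr_ge0.
move=> x Kx i; apply: le_lt_trans (rV_coord_le x i) _.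
by apply: le_lt_trans (MK _ M1 _ Kx) _; rewrite ltrDl.
Qed.

Lemma leb_compact_fin (K : set T) : compact K -> (leb K < +oo)%E.
Proof.
move=> /compact_sub_rbox [M [M0 KM]].
apply: (@le_lt_trans _ _ (leb (rbox (const_mx (- M)) (const_mx M) : set T))); last first.
  exact: leb_rbox_fin.
apply: leb_mono => x Kx i; rewrite !mxE; have := KM x Kx i.
by rewrite ltr_norml => /andP[h1 h2]; rewrite !ltW.
Qed.

Lemma continuous_measurable (O : set T) (g : T -> R) : open O ->
  (forall x, O x -> {for x, continuous g}) -> measurable_fun O g.
Proof.
move=> oO gc; apply: (measurability _ (RGenOInfty.measurableE R)) => _ [_ [c ->]] <-.
apply: measurable_openrV; rewrite openE => x [Ox]; rewrite /= in_itv /= andbT => cx.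
apply: filterI; first exact: open_nbhs_nbhs.
have : \forall y \near g x, c < y by exact: lt_nbhsr.
move=> cg; have H : nbhs x (g @^-1` [set y | c < y]) by exact: (gc x Ox _ cg).
by apply: filterS H => y /=; rewrite in_itv /= andbT.
Qed.

Lemma continuous_bounded (K : set T) (g : T -> R) : compact K ->
  (forall x, K x -> {for x, continuous g}) ->
  exists C : R, 0 <= C /\ forall x, K x -> `|g x| <= C.
Proof.
move=> cK gc; have : compact (g @` K).
  apply: continuous_compact => //; apply: continuous_in_subspaceT => x.
  by rewrite inE; exact: gc.
move=> /compact_bounded [M [_ MK]].
have M1 : M < `|M| + 1 by rewrite ltr_pwDr // ler_norm.
exists (`|M| + 1); split; first by rewrite addr_ge0.
by move=> x Kx; apply: MK => //; exists x.
Qed.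

Lemma measurable_fun_local (O : set T) (g : T -> R) : open O ->
  (forall K, compact K -> K `<=` O -> measurable_fun K g) -> measurable_fun O g.
Proof.
move=> /open_rboxes [a [b [OE abO]]] gK; rewrite OE.
apply/measurable_fun_bigcup => [k|k]; first exact: measurable_rbox.
by apply: gK; [exact: compact_rbox|exact: abO].
Qed.

Lemma measurable_sg (D : set T) (g : T -> R) : measurable_fun D g ->
  measurable_fun D (fun x => Num.sg (g x)).
Proof.
move=> mg; rewrite (_ : (fun x => _) = (fun x => g x * `|g x| `^ (-1))); last first.
  apply/funext => x; have [->|g0] := eqVneq (g x) 0; first by rewrite sgr0 mul0r.
  apply: (@mulIf _ `|g x|); first by rewrite normr_eq0.
  by rewrite powR_inv1 // divfK ?normr_eq0 // -numEsg.
apply: measurable_funM => //.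
apply: (measurableT_comp (measurable_powR _)).
exact: measurableT_comp.
Qed.

(** Makes room for mollification, which enlarges supports. [K'] is the sum of [K] and a closed ball,
    the image of a compact set under addition. *)
Lemma compact_thicken (O K : set T) : open O -> compact K -> K `<=` O ->
  exists2 r : R, 0 < r & exists K', [/\ compact K', K' `<=` O &
    forall x y, K x -> `|y - x| <= r -> K' y].
Proof.
move=> oO cK KO.
have H : \forall r \near 0^'+, K `<=` [set x | forall y, `|y - x| <= r -> O y].
  apply: (iffLR (compact_near_coveringP K) cK R (0^'+) (fun r x => forall y, `|y - x| <= r -> O y)).
  move=> x Kx.
  have [e /= e0 eO] := (iffLR (nbhs_ballP _ _)) (open_nbhs_nbhs (conj oO (KO x Kx))).
  exists (ball x (e / 2), [set r : R | r < e / 2]) => /=; first split.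
  - by apply: nbhsx_ballx; rewrite divr_gt0.
  - by apply: nbhs_right_lt; rewrite divr_gt0.
  - move=> [x' r] /= [xx' re] y yx'; apply: eO; rewrite -ball_normE /=.
    rewrite distrC; apply: le_lt_trans (ler_distD x' _ _) _.
    rewrite -ball_normE /= distrC in xx'.
    by have := ltr_leD xx' (le_trans yx' (ltW re)); rewrite -splitr addrC.
have [r [r0 rK]] : exists r : R, 0 < r /\ (K `<=` [set x | forall y, `|y - x| <= r -> O y]).
  near (0 : R)^'+ => r; exists r; split => //.
  by near: r; exact: H.
exists r => //.
exists ((fun z : T * T => z.1 + z.2) @` (K `*` [set z : T | `|z| <= r])); split.
- apply: continuous_compact.
    apply: continuous_subspaceT => z; by apply: (@cvgD _ _ (T * T)%type); [exact: cvg_fst|exact: cvg_snd].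
  apply: compact_setX => //; apply: bounded_closed_compact.
    by exists r; split => [|s rs z /= zr]; [exact: gtr0_real|exact: le_trans zr (ltW rs)].
  rewrite (_ : [set z | _] = Num.norm @^-1` [set s : R | s <= r]) //.
  by apply: closed_comp => [z _|]; [exact: norm_continuous|exact: closed_le].
- move=> _ [[x z] [/= Kx zr] <-]; apply: (rK x Kx).
  by rewrite addrAC subrr add0r.
- move=> x y Kx yx; exists (x, y - x) => //=; by rewrite addrC subrK.
Unshelve. all: by end_near. Qed.

End Borel.

(** * Mollification *)

Section CutoffDerivatives.
Context {R : realType} (eta : R -> R).
Hypothesis etaP : cutoff_eta eta.

Lemma is_derive_eta j (t : R) :
  is_derive t (1 : R) (derive1n j eta) (derive1n j.+1 eta t).
Proof.
have [De _] := etaP.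
by apply: DeriveDef; [exact (De j t)|rewrite [RHS]derive1E].
Qed.

Lemma eta_continuous j : continuous (derive1n j eta).
Proof.
move=> t; apply: differentiable_continuous; apply/derivable1_diffP.
exact: (@ex_derive _ _ _ _ _ _ _ (is_derive_eta j t)).
Qed.

Lemma derive1n_locally_cst (A : set R) (c : R) : open A -> (forall t, A t -> eta t = c) ->
  forall j t, A t -> derive1n j.+1 eta t = 0.
Proof.
move=> oA etac j; have [b bP] : exists b : R, forall t, A t -> derive1n j eta t = b.
  elim: j => [|j [b bP]]; first by exists c.
  exists 0 => t At; rewrite [LHS]derive1E.
  rewrite (@near_eq_derive _ _ _ _ (fun=> b)) ?derive_cst //.
  by apply: filterS bP _; exact: open_nbhs_nbhs.
move=> t At; rewrite [LHS]derive1E.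
rewrite (@near_eq_derive _ _ _ _ (fun=> b)) ?derive_cst //.
by apply: filterS bP _; exact: open_nbhs_nbhs.
Qed.

Lemma eta_outer j (t : R) : 1 < `|t| -> derive1n j.+1 eta t = 0.
Proof.
move=> t1; have [_ [_ [e1 _]]] := etaP.
apply: (@derive1n_locally_cst [set s | 1 < `|s|] 1) => //.
apply: (@open_comp _ _ (Num.norm : R -> R) [set s | 1 < s]); last exact: open_gt.
by move=> s _; exact: norm_continuous.
Qed.

Lemma eta_lt_half j (t : R) : `|t| < 2^-1 -> derive1n j eta t = 0.
Proof.
move=> t2; have [_ [_ [_ e2]]] := etaP.
case: j => [|j]; first exact/e2/ltW.
apply: (@derive1n_locally_cst [set s | `|s| < 2^-1] 0) => //.
  apply: (@open_comp _ _ (Num.norm : R -> R) [set s | s < 2^-1]); last exact: open_lt.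
  by move=> s _; exact: norm_continuous.
by move=> s /ltW; exact: e2.
Qed.

(** The endpoint [|t| = 1/2] follows by continuity, approaching it by [t * (1 - q)]. It is needed
    because [Mset O v (2 * n)] contains the points where [|v| = 1 / (2 n)]. *)
Lemma eta_inner j (t : R) : `|t| <= 2^-1 -> derive1n j eta t = 0.
Proof.
rewrite le_eqVlt => /orP[/eqP t2|]; last exact: eta_lt_half.
apply/eqP; rewrite -normr_le0; apply/ler_addgt0Pr => e e0; rewrite add0r.
have /cvgrPdist_le/(_ _ e0) H := @eta_continuous j t.
have [r /= r0 rP] := (iffLR (nbhs_ballP _ _)) H.
have t0 : 0 < `|t| by rewrite t2 invr_gt0.
pose q : R := Num.min (r / 2) 2^-1.
have q0 : 0 < q by rewrite lt_min divr_gt0 //= invr_gt0.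
have q1 : q <= 2^-1 by rewrite ge_min lexx orbT.
have qr : q <= r / 2 by rewrite ge_min lexx.
have B : ball t r (t * (1 - q)).
  rewrite -ball_normE /= mulrBr mulr1 opprB addrC subrK normrM t2 gtr0_norm //.
  by lra.
have z : derive1n j eta (t * (1 - q)) = 0.
  by apply: eta_lt_half; rewrite normrM t2 ger0_norm; lra.
by have := rP _ B; rewrite /= z subr0.
Qed.

Lemma eta_bounded j : exists C : R, 0 <= C /\ forall t, `|t| <= 1 -> `|derive1n j eta t| <= C.
Proof.
have : compact (derive1n j eta @` `[-1, 1]%classic).
  apply: continuous_compact; last exact: segment_compact.
  by apply: continuous_subspaceT => t; exact: eta_continuous.
move=> /compact_bounded [M [_ MK]].
have M1 : M < `|M| + 1 by rewrite ltr_pwDr // ler_norm.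
exists (`|M| + 1); split; first by rewrite addr_ge0.
by move=> t t1; apply: (MK _ M1); exists t => //; rewrite /= in_itv /= -ler_norml.
Qed.

Lemma eta_derivative_bounded j : exists C : R, 0 <= C /\ forall t, `|derive1n j.+1 eta t| <= C.
Proof.
have [C [C0 CP]] := eta_bounded j.+1; exists C; split => // t.
by have [/CP //|t1] := lerP `|t| 1; rewrite eta_outer // normr0.
Qed.

(* [dstep e] is the derivative of a smooth step increasing from 0 to 1 on
   [0, e], obtained from the right half of [eta]; its sign plays no role. *)
Definition step (e : R) (j : nat) (t : R) : R :=
  if 0 < t then e^-1 ^+ j * derive1n j eta (t / e) else 0.
Definition dstep (e : R) (j : nat) : R -> R := step e j.+1.

Variable e : R.
Hypothesis e0 : 0 < e.

Lemma is_derive_step j (t : R) : is_derive t (1 : R) (step e j) (step e j.+1 t).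
Proof.
have [t0|t0] := ltrP 0 t.
  have D : is_derive t (1 : R) (fun s => e^-1 ^+ j * derive1n j eta (s / e))
      (e^-1 ^+ j.+1 * derive1n j.+1 eta (t / e)).
    have D1 : is_derive t (1 : R) (fun s => s / e) e^-1.
      have := @is_deriveM _ _ id (cst e^-1) t (1 : R) _ _ (is_derive_id _ _) (is_derive_cst _ _ _).
      by move=> H; apply: is_derive_eq H _; rewrite scaler0 add0r /cst [_ *: _]mulr1.
    have D2 := @is_derive1_comp _ (derive1n j eta) (fun s => s / e) t _ _ (is_derive_eta j (t / e)) D1.
    have D3 := @is_deriveM _ _ (cst (e^-1 ^+ j)) _ t (1 : R) _ _ (is_derive_cst _ _ _) D2.
    apply: is_derive_eq D3 _; rewrite scaler0 addr0.
    rewrite -[LHS]/(e^-1 ^+ j * (derive1n j.+1 eta (t / e) * e^-1)) exprSr.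
    by rewrite [X in _ * X]mulrC mulrA.
  rewrite /step t0; apply: near_eq_is_derive D.
  by near=> s; have -> : 0 < s by near: s; exact: lt_nbhsr.
(* The two branches of [step] fit together at 0 because [eta] and its derivatives vanish on
   [[0, 1/2)]: the function is 0 for arguments below [e / 2]. *)
have -> : step e j.+1 t = 0 by rewrite /step ltNge t0.
have D0 := @is_derive_cst _ R R 0 t 1.
apply: near_eq_is_derive D0.
near=> s; rewrite /step; case: ltrP => // s0.
rewrite eta_lt_half ?mulr0 // gtr0_norm ?divr_gt0 // ltr_pdivrMr //.
near: s; apply: lt_nbhsl; apply: le_lt_trans t0 _.
by rewrite mulr_gt0 // invr_gt0.
Unshelve. all: by end_near. Qed.

Lemma step_le0 j t : t <= 0 -> step e j t = 0.
Proof. by rewrite /step ltNge => ->. Qed.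

Lemma step_gt1 t : e < t -> step e 0 t = 1.
Proof.
move=> et; rewrite /step (lt_trans e0 et) expr0 mul1r /=.
have [_ [_ [e1 _]]] := etaP; apply: e1.
by rewrite gtr0_norm ?divr_gt0 ?(lt_trans e0 et) // ltr_pdivlMr // mul1r.
Qed.

Lemma dstep_supp j t : dstep e j t != 0 -> 0 <= t <= e.
Proof.
rewrite /dstep /step; case: ltrP => [t0|]; last by rewrite eqxx.
apply: contraNT; rewrite (ltW t0) andTb -ltNge => te.
by rewrite eta_outer ?mulr0 // gtr0_norm ?divr_gt0 // ltr_pdivlMr // mul1r.
Qed.

Lemma dstep_continuous j : continuous (dstep e j).
Proof.
move=> t; apply: differentiable_continuous; apply/derivable1_diffP.
exact: (@ex_derive _ _ _ _ _ _ _ (is_derive_step j.+1 t)).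
Qed.

Lemma dstep_bounded (C : R) : (forall t, `|derive1n 1 eta t| <= C) ->
  forall t, `|dstep e 0 t| <= C / e.
Proof.
move=> CP t; have C0 : 0 <= C := le_trans (normr_ge0 _) (CP 0).
rewrite /dstep /step; case: ltrP => t0; last by rewrite normr0 divr_ge0 // ltW.
rewrite expr1 normrM normfV (gtr0_norm e0) mulrC.
by apply: ler_wpM2r; [rewrite invr_ge0 ltW|exact: CP].
Qed.

End CutoffDerivatives.

(** * Integrals over an interval depending on a parameter *)

Section ParametricIntegral.
Context {R : realType} {d : nat} (M : R).
Hypothesis M0 : 0 < M.
Notation T := 'rV[R]_d.+1.
Notation mu := (@lebesgue_measure R).
Notation I := (`[- M, M]%classic : set R).
Implicit Types (f g : R -> R) (G : T -> R -> R).

Let NMM : - M < M. Proof. by rewrite gtrN. Qed.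

Lemma integrable_cont f : continuous f -> mu.-integrable I (EFin \o f).
Proof.
move=> cf; apply: continuous_compact_integrable; first exact: segment_compact.
exact: continuous_subspaceT.
Qed.

Lemma Rintegral_dist f g (e : R) : continuous f -> continuous g ->
  (forall u, I u -> `|f u - g u| <= e) ->
  `|(\int[mu]_(u in I) f u) - \int[mu]_(u in I) g u| <= e * (2 * M).
Proof.
move=> cf cg fg.
have ci : continuous (fun u => f u - g u) by move=> u; exact: (continuousB (cf u) (cg u)).
have mI : measurable I by exact: measurable_itv.
rewrite -RintegralB //; [|exact: integrable_cont..].
apply: le_trans (le_normr_Rintegral _ _) _ => //; first exact: integrable_cont.
have -> : e * (2 * M) = \int[mu]_(u in I) e.
  rewrite Rintegral_cst //; congr (_ * _).
  have -> : 2 * M = fine (2 * M)%:E by [].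
  congr fine; rewrite [RHS]lebesgue_measure_itv /= lte_fin NMM -EFinD opprK.
  by rewrite mulr_natl mulr2n.
apply: le_Rintegral => //.
  by apply: integrable_cont => u; exact: (continuous_comp (ci u) (@norm_continuous _ _ _)).
by apply: integrable_cont => u; exact: cst_continuous.
Qed.

(** Compactness of the interval makes joint continuity uniform in the integration variable. *)
Lemma near_uniform G x (e : R) : continuous (fun z : T * R => G z.1 z.2) -> 0 < e ->
  \forall y \near x, forall u, I u -> `|G y u - G x u| <= e.
Proof.
move=> cG e0.
have cI : compact I by exact: segment_compact.
apply: (iffLR (compact_near_coveringP I) cI T (nbhs x) (fun y u => `|G y u - G x u| <= e)).
move=> u Iu.
have e20 : 0 < e / 2 by rewrite divr_gt0.
have /cvgrPdist_le/(_ _ e20) [[A B] /= [xA uB] AB] := cG (x, u).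
exists (B, A) => //= -[u' y] /= [Bu' Ay].
have H1 := AB (y, u') (conj Ay Bu'); have H2 := AB (x, u') (conj (nbhs_singleton xA) Bu').
rewrite /= in H1 H2; apply: le_trans (ler_distD (G x u) _ _) _.
by rewrite (splitr e) distrC; exact: lerD.
Qed.

Lemma section_continuous G x : continuous (fun z : T * R => G z.1 z.2) -> continuous (G x).
Proof.
move=> cG u; apply: (@continuous_comp _ _ _ (fun u => (x, u)) (fun z : T * R => G z.1 z.2) u).
  move=> A [[A1 A2] /= [h1 h2] H]; apply: filterS h2 => z Az.
  by apply: H; split=> //=; exact: nbhs_singleton h1.
exact: cG.
Qed.

Lemma Rintegral_param_continuous G : continuous (fun z : T * R => G z.1 z.2) ->
  continuous (fun x => \int[mu]_(u in I) G x u).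
Proof.
move=> cG x.
have FF : Filter (nbhs (x : T)) by exact: nbhs_filter.
apply/(@cvgrPdist_le _ _ _ (nbhs (x : T)) FF) => e e0.
have e'0 : 0 < e / (2 * M) by rewrite divr_gt0 // mulr_gt0.
apply: (@filterS T (nbhs (x : T)) _ _ _ _ (near_uniform x cG e'0)) => y H.
rewrite distrC; have -> : e = e / (2 * M) * (2 * M) by rewrite divfK // mulf_neq0 // gt_eqF.
by apply: Rintegral_dist => //; exact: section_continuous.
Qed.

(** By the mean value theorem the difference quotient of [G] is a value of [dG] at a point near [x],
    hence uniformly close to [dG x]. *)
Lemma Rintegral_param_derive G dG (v : T) :
  continuous (fun z : T * R => G z.1 z.2) -> continuous (fun z : T * R => dG z.1 z.2) ->
  (forall x u, is_derive x v (G ^~ u) (dG x u)) ->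
  forall x, is_derive x v (fun y => \int[mu]_(u in I) G y u) (\int[mu]_(u in I) dG x u).
Proof.
move=> cG cdG D x; apply: is_derive_epsP => e e0.
have e'0 : 0 < e / (2 * M) by rewrite divr_gt0 // mulr_gt0.
have [r /= r0 rP] := (iffLR (nbhs_ballP _ _)) (near_uniform x cdG e'0).
have q0 : 0 < r / (1 + `|v|) by rewrite divr_gt0 // ltr_pwDl.
near=> h.
have h0 : h != 0 by near: h; apply: nbhs_dnbhs_neq.
have hr : `|h| < r / (1 + `|v|) by near: h; exact: dnbhs0_lt.
have mI : measurable I by exact: measurable_itv.
have sc y : continuous (G y) by exact: section_continuous.
have cB : continuous (fun u => G (x + h *: v) u - G x u).
  by move=> u; exact: (continuousB (sc _ u) (sc _ u)).
have cq : continuous (fun u => h^-1 * (G (x + h *: v) u - G x u)).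
  by move=> u; apply: (continuousM _ (cB u)); exact: cst_continuous.
rewrite -RintegralB //; [|exact: integrable_cont..].
rewrite -RintegralZl //; last exact: integrable_cont.
have -> : e = e / (2 * M) * (2 * M) by rewrite divfK // mulf_neq0 // gt_eqF.
apply: Rintegral_dist => //; first exact: section_continuous.
move=> u Iu.
have [|t th ->] := @MVT_dir _ _ (G ^~ u) x v h.
  by move=> t _; exact (@ex_derive _ _ _ _ _ _ _ (D (x + t *: v) u)).
rewrite (@derive_val _ _ _ _ _ _ _ (D (x + t *: v) u)) mulKf //.
apply: rP => //; rewrite -ball_normE /= opprD addrA subrr add0r normrN normrZ.
have := le_lt_trans th hr; rewrite ltr_pdivlMr ?ltr_pwDl // mulrDr mulr1.
by apply: le_lt_trans; rewrite lerDr.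
Unshelve. all: by end_near. Qed.

End ParametricIntegral.

Section DeriveScale.
Context {R : realType} {V : normedModType R}.
Implicit Types (f : V -> R) (c : R).

Lemma is_derive_mulr f x v df c : is_derive x v f df ->
  is_derive x v (fun y => f y * c) (df * c).
Proof.
move=> D; have := is_deriveM D (is_derive_cst c x v).
by move=> H; apply: is_derive_eq H _; rewrite scaler0 add0r; exact: mulrC.
Qed.

Lemma is_derive_mull f x v df c : is_derive x v f df ->
  is_derive x v (fun y => c * f y) (c * df).
Proof.
move=> D; have := is_deriveM (is_derive_cst c x v) D.
by move=> H; apply: is_derive_eq H _; rewrite scaler0 addr0.
Qed.

Lemma is_derive_mul f g x v df dg : is_derive x v f df -> is_derive x v g dg ->
  is_derive x v (fun y => f y * g y) (f x * dg + df * g x).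
Proof.
move=> Df Dg; have := is_deriveM Df Dg; move=> H; apply: is_derive_eq H _.
by congr (_ + _); exact: mulrC.
Qed.

End DeriveScale.

(** * Mollification in one coordinate *)

Section Mollifier.
Context {R : realType} {d : nat} (eta : R -> R).
Hypothesis etaP : cutoff_eta eta.
Notation T := 'rV[R]_d.+1.
Notation mu := (@lebesgue_measure R).
Notation e_ := (fun i : 'I_d.+1 => delta_mx 0 i : T).
Implicit Types (h : T -> R) (i j : 'I_d.+1).

Lemma set_coordE (x : T) i u : set_coord x i u = x + (u - x ord0 i) *: e_ i.
Proof.
apply/rowP => j; rewrite !mxE; case: eqVneq => [->|ji]; last by rewrite andbF mulr0 addr0.
by rewrite mulr1 addrC subrK.
Qed.

Lemma set_coord_eq (x : T) i u : set_coord x i u ord0 i = u.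
Proof. by rewrite mxE eqxx. Qed.

Lemma set_coord_neq (x : T) i j u : j != i -> set_coord x i u ord0 j = x ord0 j.
Proof. by rewrite mxE => /negbTE ->. Qed.

Lemma set_coord_shift (x : T) i (s : R) u : set_coord (x + s *: e_ i) i u = set_coord x i u.
Proof.
apply/rowP => j; rewrite !mxE; case: eqVneq => // ji.
by rewrite andbF mulr0 addr0.
Qed.

Lemma set_coord_shift_neq (x : T) i j (s : R) u : j != i ->
  set_coord (x + s *: e_ j) i u = set_coord x i u + s *: e_ j.
Proof.
move=> ji; apply/rowP => k; rewrite !mxE; case: eqVneq => // ->.
by rewrite [i == j]eq_sym (negbTE ji) andbF mulr0 addr0.
Qed.

Lemma set_coord_continuous i : continuous (fun z : T * R => set_coord z.1 i z.2).
Proof.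
move=> z; rewrite (_ : (fun z => _) = (fun z : T * R => z.1 + (z.2 - z.1 ord0 i) *: e_ i)); last first.
  by apply/funext => y; exact: set_coordE.
have c1 : {for z, continuous (fun z : T * R => z.1)} by exact: cvg_fst.
have c2 : {for z, continuous (fun z : T * R => z.2)} by exact: cvg_snd.
have c3 : {for z, continuous (fun z : T * R => z.1 ord0 i)}.
  exact: (continuous_comp c1 (@coord_continuous _ _ _ ord0 i z.1)).
have c4 := continuousB c2 c3.
have c5 : {for z, continuous (fun z : T * R => (z.2 - z.1 ord0 i) *: e_ i)}.
  exact: (continuousZl c4).
exact: (continuousD c1 c5).
Qed.

Section FixedScale.
Variables (M e : R).
Hypotheses (M0 : 0 < M) (e0 : 0 < e).
Notation I := (`[- M, M]%classic : set R).

(** Convolution in coordinate [i] with the derivative of order [n] of the kernel, over the window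
    [[-M, M]]. Keeping [n] as a parameter makes differentiation a mere increment. *)
Definition mol (n : nat) i h : T -> R :=
  fun x => \int[mu]_(u in I) (dstep eta e n (x ord0 i - u) * h (set_coord x i u)).

Let integrand_continuous n i h : continuous h ->
  continuous (fun z : T * R => dstep eta e n (z.1 ord0 i - z.2) * h (set_coord z.1 i z.2)).
Proof.
move=> ch z.
have c1 : {for z, continuous (fun z : T * R => z.1)} by exact: cvg_fst.
have c2 : {for z, continuous (fun z : T * R => z.2)} by exact: cvg_snd.
have c3 : {for z, continuous (fun z : T * R => z.1 ord0 i)}.
  exact: (continuous_comp c1 (@coord_continuous _ _ _ ord0 i z.1)).
have c4 : {for z, continuous (fun z : T * R => dstep eta e n (z.1 ord0 i - z.2))}.
  exact: (continuous_comp (continuousB c3 c2) (@dstep_continuous _ _ etaP e e0 n _)).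
have c5 : {for z, continuous (fun z : T * R => h (set_coord z.1 i z.2))}.
  exact: (continuous_comp (@set_coord_continuous i z) (ch _)).
exact: (continuousM c4 c5).
Qed.

Lemma mol_continuous n i h : continuous h -> continuous (mol n i h).
Proof.
move=> ch; apply: (@Rintegral_param_continuous _ _ _ M0
  (fun x u => dstep eta e n (x ord0 i - u) * h (set_coord x i u))).
exact: integrand_continuous.
Qed.

(** [set_coord] overwrites coordinate [i] in the argument of [h], so this coordinate of [x] occurs
    in the kernel alone, and [h] is never differentiated. *)
Lemma mol_derive n i h : continuous h ->
  forall x, is_derive x (e_ i) (mol n i h) (mol n.+1 i h x).
Proof.
move=> ch; apply: (@Rintegral_param_derive _ _ _ M0
  (fun x u => dstep eta e n (x ord0 i - u) * h (set_coord x i u))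
  (fun x u => dstep eta e n.+1 (x ord0 i - u) * h (set_coord x i u))).
- exact: integrand_continuous.
- exact: integrand_continuous.
move=> x u; apply: is_derive_line0.
have -> : (fun s : R => dstep eta e n ((x + s *: e_ i) ord0 i - u) * h (set_coord (x + s *: e_ i) i u))
  = (fun s : R => dstep eta e n (s + (x ord0 i - u)) * h (set_coord x i u)).
  apply/funext => s; rewrite set_coord_shift; congr (dstep _ _ _ _ * _).
  by rewrite !mxE !eqxx mulr1 [_ + s]addrC addrA.
have D1 : is_derive (0 : R) (1 : R) (fun s : R => s + (x ord0 i - u)) 1.
  have := @is_deriveD _ _ _ id (cst (x ord0 i - u)) (0 : R) (1 : R) _ _ (is_derive_id _ _) (is_derive_cst _ _ _).
  by rewrite addr0.
have D2 := @is_derive1_comp _ (dstep eta e n) (fun s => s + (x ord0 i - u)) 0 _ _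
  (is_derive_step etaP e0 n.+1 _) D1.
rewrite mulr1 add0r in D2; exact: is_derive_mulr D2.
Qed.

Lemma mol_derive_neq n i j h (dh : T -> R) : j != i -> continuous h -> continuous dh ->
  (forall x, is_derive x (e_ j) h (dh x)) ->
  forall x, is_derive x (e_ j) (mol n i h) (mol n i dh x).
Proof.
move=> ji ch cdh D; apply: (@Rintegral_param_derive _ _ _ M0
  (fun x u => dstep eta e n (x ord0 i - u) * h (set_coord x i u))
  (fun x u => dstep eta e n (x ord0 i - u) * dh (set_coord x i u))).
- exact: integrand_continuous.
- exact: integrand_continuous.
move=> x u; apply: is_derive_line0.
have -> : (fun s : R => dstep eta e n ((x + s *: e_ j) ord0 i - u) * h (set_coord (x + s *: e_ j) i u))
  = (fun s : R => dstep eta e n (x ord0 i - u) * h (set_coord x i u + s *: e_ j)).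
  apply/funext => s; rewrite set_coord_shift_neq //; congr (dstep _ _ _ _ * _).
  by rewrite !mxE eqxx [i == j]eq_sym (negbTE ji) mulr0 addr0.
have D2 : is_derive (0 : R) (1 : R) (fun s : R => h (set_coord x i u + s *: e_ j)) (dh (set_coord x i u)).
  by apply: is_derive_line; rewrite scale0r addr0.
exact: is_derive_mull D2.
Qed.

Lemma Rintegral_FTC (F f : R -> R) : (forall u, is_derive u (1 : R) F (f u)) ->
  continuous f -> \int[mu]_(u in I) f u = F M - F (- M).
Proof.
move=> DF cf.
have cF : continuous F.
  move=> u; apply: differentiable_continuous; apply/derivable1_diffP.
  exact: (@ex_derive _ _ _ _ _ _ _ (DF u)).
have H : (\int[mu]_(u in I) (f u)%:E = (F M)%:E - (F (- M))%:E)%E.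
  apply: continuous_FTC2.
  - by rewrite gtrN.
  - exact: continuous_subspaceT.
  - split.
    + by move=> u _; exact (@ex_derive _ _ _ _ _ _ _ (DF u)).
    + exact: cvg_at_right_filter (cF _).
    + exact: cvg_at_left_filter (cF _).
  - by move=> u _; rewrite derive1E (@derive_val _ _ _ _ _ _ _ (DF u)).
by rewrite /Rintegral H.
Qed.

(** The boundary terms vanish since [h] is 0 at the ends of the window. With [mol_derive] this says
    that mollification commutes with the derivative in its own coordinate. *)
Lemma mol_by_parts n i h (dh : T -> R) : continuous h -> continuous dh ->
  (forall x, is_derive x (e_ i) h (dh x)) ->
  (forall x : T, M <= `|x ord0 i| -> h x = 0) ->
  forall x, mol n.+1 i h x = mol n i dh x.
Proof.
move=> ch cdh D hM x.
have sc (G : T -> R -> R) : continuous (fun z : T * R => G z.1 z.2) -> continuous (G x).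
  exact: section_continuous.
have c1 : continuous (fun u : R => dstep eta e n (x ord0 i - u) * dh (set_coord x i u)).
  exact: (sc (fun x u => dstep eta e n (x ord0 i - u) * dh (set_coord x i u)) (@integrand_continuous n i dh cdh)).
have c2 : continuous (fun u : R => dstep eta e n.+1 (x ord0 i - u) * h (set_coord x i u)).
  exact: (sc (fun x u => dstep eta e n.+1 (x ord0 i - u) * h (set_coord x i u)) (@integrand_continuous n.+1 i h ch)).
have mI : measurable I by exact: measurable_itv.
apply/esym/eqP; rewrite -subr_eq0 -RintegralB //; [|exact: integrable_cont..].
pose F u := dstep eta e n (x ord0 i - u) * h (set_coord x i u).
apply/eqP; transitivity (F M - F (- M)); last first.
  by rewrite /F !hM ?mulr0 ?subrr // set_coord_eq ?normrN gtr0_norm.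
apply: Rintegral_FTC.
- move=> u.
  have D1 : is_derive u (1 : R) (fun s : R => x ord0 i - s) (-1).
    have := @is_deriveB _ _ _ (cst (x ord0 i)) id u (1 : R) _ _ (is_derive_cst _ _ _) (is_derive_id _ _).
    by rewrite sub0r.
  have D2 := @is_derive1_comp _ (dstep eta e n) (fun s => x ord0 i - s) u _ _
    (is_derive_step etaP e0 n.+1 _) D1.
  have D3 : is_derive u (1 : R) (fun s : R => h (set_coord x i s)) (dh (set_coord x i u)).
    have -> : (fun s : R => h (set_coord x i s)) = (fun s : R => h (set_coord x i 0 + s *: e_ i)).
      apply/funext => s; congr h; apply/rowP => j; rewrite !mxE.
      by case: eqVneq => [_|ji]; rewrite ?add0r ?andbT ?mulr1 // andbF mulr0 addr0.
    apply: is_derive_line.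
    have -> : set_coord x i 0 + u *: e_ i = set_coord x i u.
      apply/rowP => j; rewrite !mxE.
      by case: eqVneq => [_|ji]; rewrite ?add0r ?andbT ?mulr1 // andbF mulr0 addr0.
    exact: D.
  have D4 := is_derive_mul D2 D3.
  by apply: is_derive_eq D4 _; rewrite mulrN1 mulNr.
- by move=> u; exact: (continuousB (c1 u) (c2 u)).
Qed.

Lemma mol_vanish n i j h : j != i -> (forall x : T, M <= `|x ord0 j| -> h x = 0) ->
  forall x : T, M <= `|x ord0 j| -> mol n i h x = 0.
Proof.
move=> ji hM x xM; have mI : measurable I by exact: measurable_itv.
rewrite /mol (_ : (fun u => _) = cst 0) ?Rintegral_cst ?mul0r //.
by apply/funext => u; rewrite hM ?mulr0 // set_coord_neq.
Qed.

Lemma mol_average i h (c r C : R) (x : T) : continuous h -> 0 <= r ->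
  (forall t, `|derive1n 1 eta t| <= C) ->
  (c != 0 -> `|x ord0 i| + e < M) ->
  (forall u, x ord0 i - e <= u <= x ord0 i -> `|h (set_coord x i u) - c| <= r) ->
  `|mol 0 i h x - c| <= C * r.
Proof.
move=> ch r0 CP cM hr.
have C0 : 0 <= C := le_trans (normr_ge0 _) (CP 0).
have mI : measurable I by exact: measurable_itv.
have ck : continuous (fun u : R => dstep eta e 0 (x ord0 i - u)).
  move=> u; apply: (@continuous_comp _ _ _ (fun u => x ord0 i - u) (dstep eta e 0)).
    by apply: continuousB; [exact: cst_continuous|exact: cvg_id].
  exact: dstep_continuous.
have ckc : continuous (fun u : R => dstep eta e 0 (x ord0 i - u) * c).
  by move=> u; apply: continuousM (ck u) _; exact: cst_continuous.
have ckh : continuous (fun u : R => dstep eta e 0 (x ord0 i - u) * h (set_coord x i u)).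
  exact: (@section_continuous _ _ (fun x u => dstep eta e 0 (x ord0 i - u) * h (set_coord x i u)) x (@integrand_continuous 0 i h ch)).
have cD : continuous (fun u : R => dstep eta e 0 (x ord0 i - u) * (h (set_coord x i u) - c)).
  move=> u; rewrite (_ : (fun u => _) = (fun u : R => dstep eta e 0 (x ord0 i - u) * h (set_coord x i u)
    - dstep eta e 0 (x ord0 i - u) * c)); first exact: (continuousB (ckh u) (ckc u)).
  by apply/funext => u'; rewrite mulrBr.
have Ec : c = \int[mu]_(u in I) (dstep eta e 0 (x ord0 i - u) * c).
  have [->|c0] := eqVneq c 0.
    rewrite (_ : (fun u => _) = cst 0) ?Rintegral_cst ?mul0r //.
    by apply/funext => u; rewrite mulr0.
  (* An antiderivative of the kernel times [c]: the step is 0 at [x ord0 i - M < 0] and 1 at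
     [x ord0 i + M > e]. *)
  pose F u := - (step eta e 0 (x ord0 i - u) * c).
  apply/esym; transitivity (F M - F (- M)); last first.
    rewrite /F.
    have := cM c0; have := ler_norm (x ord0 i); have := ler_norm (- x ord0 i).
    rewrite normrN => H1 H2 H3.
    move: (e0) => e0'.
    rewrite step_le0; last by lra.
    rewrite (step_gt1 etaP e0); first by rewrite mul0r mul1r oppr0 sub0r opprK.
    by rewrite opprK; lra.
  apply: Rintegral_FTC => // u.
  have D1 : is_derive u (1 : R) (fun s : R => x ord0 i - s) (-1).
    have := @is_deriveB _ _ _ (cst (x ord0 i)) id u (1 : R) _ _ (is_derive_cst _ _ _) (is_derive_id _ _).
    by rewrite sub0r.
  have D2 := @is_derive1_comp _ (step eta e 0) (fun s => x ord0 i - s) u _ _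
    (is_derive_step etaP e0 0 _) D1.
  have D3 := is_deriveN (is_derive_mulr c D2).
  by apply: is_derive_eq D3 _; rewrite mulrN1 mulNr opprK.
rewrite {1}Ec -RintegralB //; [|exact: integrable_cont..].
rewrite (_ : (fun u => _) = (fun u : R => dstep eta e 0 (x ord0 i - u) * (h (set_coord x i u) - c))); last first.
  by apply/funext => u; rewrite mulrBr.
apply: le_trans (le_normr_Rintegral _ _) _ => //; first exact: integrable_cont.
pose J : set R := `[x ord0 i - e, x ord0 i]%classic.
have mJ : measurable J by exact: measurable_itv.
have B u : I u -> (`|dstep eta e 0 (x ord0 i - u) * (h (set_coord x i u) - c)|%:E <=
   (C / e * r)%:E * (\1_J u)%:E)%E.
  move=> _; rewrite -EFinM lee_fin indicE.
  have [k0|k0] := eqVneq (dstep eta e 0 (x ord0 i - u)) 0.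
    rewrite k0 mul0r normr0; apply: mulr_ge0; last exact: ler0n.
    by rewrite mulr_ge0 // divr_ge0 // ltW.
  have /andP[h1 h2] := dstep_supp etaP e0 k0.
  have Ju : x ord0 i - e <= u <= x ord0 i by apply/andP; split; lra.
  rewrite mem_set ?mulr1; last by rewrite /J /= in_itv.
  rewrite normrM; apply: ler_pM => //; first exact: dstep_bounded.
  exact: hr.
have L : (\int[mu]_(u in I) `|dstep eta e 0 (x ord0 i - u) * (h (set_coord x i u) - c)|%:E
   <= (C * r)%:E)%E.
  apply: (@le_trans _ _ (\int[mu]_(u in I) ((C / e * r)%:E * (\1_J u)%:E))%E).
    apply: ge0_le_integral => //.
    - apply/measurable_EFinP; apply: measurableT_comp => //.
      by have /measurable_int/measurable_EFinP := integrable_cont M cD.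
    - by apply: measurable_funeM; apply/measurable_EFinP; exact: measurable_indic.
  rewrite ge0_integralZl //; last first.
  - by rewrite lee_fin mulr_ge0 // divr_ge0 // ltW.
  - by apply/measurable_EFinP; exact: measurable_indic.
  rewrite integral_indic //.
  apply: (@le_trans _ _ ((C / e * r)%:E * e%:E)%E).
    apply: lee_wpmul2l.
    by rewrite lee_fin mulr_ge0 // divr_ge0 // ltW.
    apply: (@le_trans _ _ (mu J)).
      by apply: le_measure; rewrite ?inE //; exact: measurableI.
    rewrite [X in (X <= _)%E]lebesgue_measure_itv /= lte_fin.
    case: ifP => _; last by rewrite lee_fin ltW.
    by rewrite -?EFinD lee_fin opprB addrC subrK.
  by rewrite -EFinM lee_fin mulrAC divfK // gt_eqF.
rewrite /Rintegral -[leRHS]/(fine (C * r)%:E); apply: fine_le => //.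
rewrite ge0_fin_numE; first by apply: le_lt_trans L _; rewrite ltry.
by apply: integral_ge0 => u _; rewrite lee_fin.
Qed.

End FixedScale.
End Mollifier.

(** * Mollification in all coordinates *)

Section Mollify.
Context {R : realType} {d : nat} (eta : R -> R).
Hypothesis etaP : cutoff_eta eta.
Notation T := 'rV[R]_d.+1.
Notation e_ := (fun i : 'I_d.+1 => delta_mx 0 i : T).
Implicit Types (h : T -> R) (i j : 'I_d.+1) (k : mindex d.+1) (l : seq 'I_d.+1).

Section FixedScale.
Variables (M e : R).
Hypotheses (M0 : 0 < M) (e0 : 0 < e).

Definition mols k l h : T -> R := foldr (fun i g => mol eta M e (k i) i g) h l.

Local Opaque mol.

Lemma mols_cons k j l h : mols k (j :: l) h = mol eta M e (k j) j (mols k l h).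
Proof. by []. Qed.

Lemma mols_continuous k l h : continuous h -> continuous (mols k l h).
Proof. by move=> ch; elim: l => [//|i l IH]; rewrite mols_cons; exact: mol_continuous. Qed.

Arguments mols_continuous : clear implicits.

Lemma mols_madd1_notin k l i h : i \notin l -> mols (madd1 k i) l h = mols k l h.
Proof.
elim: l => [//|j l IH]; rewrite inE negb_or => /andP[ij il].
have E : madd1 k i j = k j by rewrite /madd1 eq_sym (negbTE ij) addn0.
by rewrite !mols_cons (IH il) E.
Qed.

Lemma mols_derive k l i h : continuous h -> uniq l -> i \in l ->
  forall x, is_derive x (e_ i) (mols k l h) (mols (madd1 k i) l h x).
Proof.
move=> ch; elim: l => [//|j l IH] /andP[jl ul]; rewrite inE => il; rewrite !mols_cons.
have [ji|ji] := eqVneq j i.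
  rewrite ji in jl *; rewrite (mols_madd1_notin _ _ jl).
  have -> : madd1 k i i = (k i).+1 by rewrite /madd1 eqxx addn1.
  exact: (mol_derive etaP M0 e0 _ _ (mols_continuous k l h ch)).
have {}il : i \in l by move: il; rewrite eq_sym (negbTE ji).
have -> : madd1 k i j = k j by rewrite /madd1 (negbTE ji) addn0.
move=> x.
apply: (mol_derive_neq etaP M0 e0); first by rewrite eq_sym.
- exact: mols_continuous.
- exact: mols_continuous.
- exact: IH.
Qed.

(** Differentiating [mols k] gives [mols (madd1 k i)], so the induction on the order runs over all
    [k] at once. *)
Lemma mols_smooth h : continuous h -> smooth (mols (@Defs.mzero d.+1) (enum 'I_d.+1) h).
Proof.
move=> ch n; apply: (@ckb_Ck _ _ setT set0).
elim: n {1}(@Defs.mzero d.+1) => [|n IH] k; (split; first by move=> x _; exact: mols_continuous).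
- by exists 0.
- by [].
- by exists 0.
have D i x := @mols_derive k (enum 'I_d.+1) i h ch (enum_uniq _) (mem_enum _ _) x.
move=> i; split; first by move=> x _; exact (@ex_derive _ _ _ _ _ _ _ (D i x)).
apply: eq_ckb (IH (madd1 k i)) => //; first exact: openT.
by move=> x _; rewrite /dpartial (@derive_val _ _ _ _ _ _ _ (D i x)).
Qed.

Lemma mols_vanish k l i h : i \notin l -> (forall x : T, M <= `|x ord0 i| -> h x = 0) ->
  forall x : T, M <= `|x ord0 i| -> mols k l h x = 0.
Proof.
move=> + hM; elim: l => [//|j l IH]; rewrite inE negb_or mols_cons => /andP[ij il].
by apply: mol_vanish => //; exact: IH.
Qed.

(** For the coordinate being mollified, the derivative is put on the kernel and moved to [h] by
    parts; for the others it passes under the integral. *)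
Lemma mols_dpartial l h : uniq l -> ckb setT set0 1 h ->
  (forall i (x : T), M <= `|x ord0 i| -> h x = 0) ->
  forall i x, is_derive x (e_ i) (mols (@Defs.mzero _) l h) (mols (@Defs.mzero _) l (dpartial i h) x).
Proof.
move=> + ch hM; elim: l => [|j l IH].
  by move=> _ i x; apply: DeriveDef (ckb_derivable ch Logic.I) erefl.
move=> /andP[jl ul] i x; rewrite !mols_cons; have {}IH := IH ul.
have cc : continuous h by move=> y; exact: (ckb_continuous ch Logic.I).
have cd i' : continuous (dpartial i' h).
  by move=> y; exact: (ckb_continuous (ckb_dpartial i' ch) Logic.I).
have [->|ij] := eqVneq i j; last first.
  apply: (mol_derive_neq etaP M0 e0) => //; first exact: mols_continuous.
  exact: mols_continuous.
rewrite -(mol_by_parts etaP M0 e0 0 (mols_continuous _ l h cc) (mols_continuous _ l _ (cd j))) //.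
  exact: (mol_derive etaP M0 e0 _ _ (mols_continuous _ l h cc)).
by apply: mols_vanish => //; exact: hM.
Qed.

(** Each coordinate costs a factor [C]. The kernels are one-sided, so only the box extending by [e]
    below [x] matters. *)
Lemma mols_average l h (c r C : R) (x : T) : uniq l -> continuous h -> 0 <= r ->
  (forall t, `|derive1n 1 eta t| <= C) ->
  (c != 0 -> {in l, forall i, `|x ord0 i| + e < M}) ->
  (forall y : T, (forall i, x ord0 i - (if i \in l then e else 0) <= y ord0 i <= x ord0 i) ->
     `|h y - c| <= r) ->
  `|mols (@Defs.mzero _) l h x - c| <= C ^+ size l * r.
Proof.
move=> + ch r0 CP cM; have C0 : 0 <= C := le_trans (normr_ge0 _) (CP 0).
elim: l x cM => [|j l IH] x cM.
  by move=> _ H; rewrite mul1r; apply: H => i; rewrite subr0 lexx.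
move=> /andP[jl ul] H; rewrite mols_cons [size _]/= exprS -mulrA.
apply: (mol_average etaP M0 e0) => //; first exact: mols_continuous.
- by rewrite mulr_ge0 // exprn_ge0.
- by move=> c0; apply: cM => //; rewrite mem_head.
move=> u xu; apply: IH => //.
  move=> c0 i il; rewrite set_coord_neq; first by apply: cM => //; rewrite inE il orbT.
  by apply: contraNneq jl => <-.
move=> y Hy; apply: H => i; have := Hy i; rewrite inE.
have [->|ij] := eqVneq i j; last by rewrite set_coord_neq.
rewrite (negbTE jl) set_coord_eq subr0 /= => /andP[h1 h2]; case/andP: xu => h3 h4.
by rewrite (le_trans h3 h1) (le_trans h2 h4).
Qed.

Lemma dpartial_vanish (K : set T) h i : closed K -> (forall x, ~ K x -> h x = 0) ->
  forall x, ~ K x -> dpartial i h x = 0.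
Proof.
move=> cK hK x Kx; rewrite (@eq_dpartial _ _ (~` K) h (fun=> 0)) //.
- by rewrite /dpartial derive_cst.
- exact: closed_openC.
Qed.

Lemma dpartialn_vanish (K : set T) h k : closed K -> (forall x, ~ K x -> h x = 0) ->
  forall x, ~ K x -> dpartialn k h x = 0.
Proof.
move=> cK; rewrite /dpartialn; elim: (enum _) => // i l IH hK /=.
elim: (k i) => [|n IHn] /=; first exact: IH.
exact: dpartial_vanish.
Qed.

Lemma dpartialn_mols k (K : set T) h : closed K ->
  (forall x, K x -> forall i, `|x ord0 i| < M) -> (forall x, ~ K x -> h x = 0) ->
  ckb setT set0 (mabs k) h ->
  dpartialn k (mols (@Defs.mzero _) (enum 'I_d.+1) h) =
  mols (@Defs.mzero _) (enum 'I_d.+1) (dpartialn k h).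
Proof.
move=> cK KM; elim/(@mindex_ind d.+1): k h => [|k i IH] h hK; first by rewrite !dpartialn0.
rewrite mabs_madd1 => ch.
have cc : continuous h by move=> y; exact: (ckb_continuous ch Logic.I).
have hM i' (x : T) : M <= `|x ord0 i'| -> h x = 0.
  by move=> Mx; apply: hK => /KM/(_ i'); rewrite ltNge Mx.
have D := mols_dpartial (enum_uniq 'I_d.+1) (ckb_le (ltn0Sn (mabs k)) ch) hM.
have E1 : dpartial i (mols (@Defs.mzero _) (enum 'I_d.+1) h) =
   mols (@Defs.mzero _) (enum 'I_d.+1) (dpartial i h).
  by apply/funext => x; case: (D i x) => _ <-.
have -> : dpartialn (madd1 k i) h = dpartialn k (dpartial i h).
  by apply/funext => x; apply: (@dpartialn_madd1r _ _ setT set0) => //; exact: openT.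
rewrite -IH; last 2 first.
- exact: dpartial_vanish.
- exact: ckb_dpartial.
rewrite -E1; apply/funext => x.
apply: (@dpartialn_madd1r _ _ setT set0) => //; first exact: openT.
by apply: Ck_ckb0; [exact: openT|exact: mols_smooth].
Qed.

End FixedScale.

(** Uniform bounds and pointwise convergence on a common compact support are what dominated
    convergence will ask for. Support, bounds and convergence all come from [mols_average], with
    different constants [c] and [r]. *)
Lemma smooth_approx (O K : set T) h n : open O -> compact K -> K `<=` O ->
  (forall x, ~ K x -> h x = 0) -> ckb setT set0 n h ->
  exists K', [/\ compact K', K' `<=` O, K `<=` K' &
    exists hh : nat -> T -> R, [/\ forall N, smooth (hh N),
      forall N x, ~ K' x -> hh N x = 0 &
      forall k, (mabs k <= n)%N ->
        (exists B : R, forall N x, `|dpartialn k (hh N) x| <= B) /\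
        forall x, dpartialn k (hh N) x @[N --> \oo] --> dpartialn k h x]].
Proof.
move=> oO cK KO hK ch.
have [r r0 [K' [cK' K'O KK']]] := compact_thicken oO cK KO.
have [L [L0 KL]] := compact_sub_rbox cK.
exists K'; split => // [x Kx|]; first by apply: (KK' x x) => //; rewrite subrr normr0 ltW.
(* The scale is at most [r], which keeps the support in [K'], and at most 1, so that
   [|x ord0 i| + e N < M] on [K]. *)
pose M := L + 2; pose e (N : nat) := Num.min r 1 / N.+1%:R.
have M0 : 0 < M by rewrite addr_gt0.
have m0 : 0 < Num.min r 1 by rewrite lt_min r0 ltr01.
have e0 N : 0 < e N by rewrite divr_gt0.
have em N : e N <= Num.min r 1 by rewrite ler_pdivrMr // ler_peMr ?ler1n // ltW.
have er N : e N <= r by apply: le_trans (em N) _; rewrite ge_min lexx.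
have e1 N : e N <= 1 by apply: le_trans (em N) _; rewrite ge_min lexx orbT.
have clK : closed K by exact: compact_closedrV.
have KM x : K x -> forall i, `|x ord0 i| < M.
  by move=> Kx i; apply: lt_trans (KL x Kx i) _; rewrite ltrDl.
have [C [C0 CP]] := eta_derivative_bounded etaP 0.
have cc : continuous h by move=> y; exact: (ckb_continuous ch Logic.I).
exists (fun N => mols M (e N) (@Defs.mzero _) (enum 'I_d.+1) h); split.
- by move=> N; exact: mols_smooth.
- move=> N x nK'x; apply/eqP; rewrite -normr_le0.
  (* Off [K'] the box below [x] misses [K], so [h] is within 0 of the constant 0 there. *)
  have := @mols_average M (e N) M0 (e0 N) (enum 'I_d.+1) h 0 0 C x (enum_uniq _) cc (lexx 0) CP.
  rewrite mulr0 subr0; apply; first by rewrite eqxx.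
  move=> y yx; rewrite subr0 hK ?normr0 // => Ky; apply: nK'x.
  apply: (KK' y x Ky); apply: rV_norm_le; first exact: ltW.
  move=> i; apply: le_trans _ (er N); have := yx i; rewrite mem_enum inE => /andP[h1 h2].
  by rewrite !mxE ger0_norm; lra.
move=> k kn.
have ck : ckb setT set0 (mabs k) h by exact: ckb_le ch.
have cpsi : continuous (dpartialn k h).
  move=> y; apply: (@ckb_continuous _ _ setT set0 0) => //.
  by apply: ckb_dpartialn; rewrite addn0.
have psiK := dpartialn_vanish k clK hK.
have [B [B0 BP]] := continuous_bounded cK (fun x _ => cpsi x).
split.
  exists (C ^+ size (enum 'I_d.+1) * B) => N x.
  rewrite (dpartialn_mols M0 (e0 N) clK) // -[X in `|X|]subr0.
  apply: (@mols_average M (e N) M0 (e0 N)) => //; first exact: enum_uniq.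
    by rewrite eqxx.
  move=> y _; rewrite subr0; have [Ky|nKy] := pselect (K y); first exact: BP.
  by rewrite psiK // normr0.
move=> x; apply/cvgrPdist_le => q q0.
set D := C ^+ size (enum 'I_d.+1).
have D0 : 0 <= D by rewrite exprn_ge0.
(* Division by [D + 1], since [D] is only known to be nonnegative. *)
have s0 : 0 < q / (D + 1) by rewrite divr_gt0 // ltr_wpDl.
have FF : Filter (nbhs (x : T)) by exact: nbhs_filter.
have /(@cvgrPdist_le _ _ _ (nbhs (x : T)) FF) /(_ _ s0) H := cpsi x.
have [t /= t0 tP] := (iffLR (nbhs_ballP _ _)) H.
have eN : \forall N \near \oo, e N < t.
  near=> N; rewrite /e ltr_pdivrMr // mulrC -ltr_pdivrMr //.
  apply: (@lt_trans _ _ N%:R); last by rewrite ltr_nat.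
  by near: N; exact: nbhs_infty_gtr.
apply: filterS eN => N eNt.
rewrite distrC (dpartialn_mols M0 (e0 N) clK) //.
apply: (@le_trans _ _ (D * (q / (D + 1)))); last first.
  rewrite mulrCA; apply: ler_piMr; first exact: ltW.
  by rewrite ler_pdivrMr ?ltr_wpDl // mul1r lerDl.
apply: (@mols_average M (e N) M0 (e0 N)) => //; [exact: enum_uniq|exact: ltW| |].
  move=> psi0 i _; have Kx : K x.
    by apply: contrapT => /psiK E; rewrite E eqxx in psi0.
  by have := KL x Kx i; have := e1 N; rewrite /M; lra.
move=> y yx; rewrite distrC; apply: tP; rewrite -ball_normE /=.
apply: le_lt_trans eNt; apply: rV_norm_le; first exact: ltW.
move=> i; have := yx i; rewrite mem_enum inE => /andP[h1 h2].
by rewrite !mxE ger0_norm; lra.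
Unshelve. all: by end_near. Qed.

End Mollify.

(** * Limits and bounds of binomial sums *)

Section LsumLimits.
Context {R : realType} {d : nat}.
Implicit Types (a : mindex d).

Lemma sum_continuous (X : topologicalType) (I : Type) (s : seq I) (F : I -> X -> R) x :
  (forall i, {for x, continuous (F i)}) ->
  {for x, continuous (fun y => \sum_(i <- s) F i y)}.
Proof.
move=> cF; elim: s => [|i s IH].
  rewrite (_ : (fun y => _) = (fun=> 0)); last by apply/funext => y; rewrite big_nil.
  exact: cst_continuous.
rewrite (_ : (fun y => _) = (fun y => F i y + \sum_(j <- s) F j y)); last first.
  by apply/funext => y; rewrite big_cons.
exact: continuousD (cF i) IH.
Qed.

Lemma lsum_continuous (X : topologicalType) N a (F : mindex d -> X -> R) x :
  (forall c, {for x, continuous (F c)}) ->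
  {for x, continuous (fun y => lsum N a (fun c => F c y))}.
Proof.
move=> cF; apply: sum_continuous => b.
by apply: continuousM (cF _); exact: cst_continuous.
Qed.

Lemma lsum_cvg N a (F : nat -> mindex d -> R) (G : mindex d -> R) :
  (forall c, F n c @[n --> \oo] --> G c) ->
  lsum N a (F n) @[n --> \oo] --> lsum N a G.
Proof.
move=> FG; rewrite /lsum; elim: (index_enum _) => [|b s IH].
  under eq_fun do rewrite big_nil; rewrite big_nil; exact: cvg_cst.
under eq_fun do rewrite big_cons; rewrite big_cons; apply: cvgD => //.
by apply: cvgMr; exact: FG.
Qed.

Lemma lsum_bounded (X : Type) N a (F : mindex d -> X -> R) (P : set X) :
  (forall c, exists B : R, forall x, P x -> `|F c x| <= B) ->
  exists B : R, 0 <= B /\ forall x, P x -> `|lsum N a (fun c => F c x)| <= B.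
Proof.
move=> /boolp.choice [B BP].
exists (\sum_(b : {ffun 'I_d -> 'I_N.+1})
   (mbinom a (fun i => val (b i)))%:R * `|B (fun i => val (b i))|); split.
  by apply: sumr_ge0 => b _; rewrite mulr_ge0.
move=> x Px; apply: le_trans (ler_norm_sum _ _ _) _; apply: ler_sum => b _.
rewrite normrM normr_nat; apply: ler_wpM2l => //.
by apply: le_trans (BP _ _ Px) (ler_norm _).
Qed.

Lemma mabs_msub_le a b : (mabs (msub a b) <= mabs a)%N.
Proof. by apply: leq_sum => i _; exact: leq_subr. Qed.

End LsumLimits.

Section PowerDerivatives.
Context {R : realType} {d : nat}.
Implicit Types (O : set 'rV[R]_d) (v h : 'rV[R]_d -> R).

Lemma dpartialX O v i p : open O -> ckb O set0 1 v -> forall x, O x ->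
  dpartial i (fun y => v y ^+ p.+1) x = p.+1%:R * v x ^+ p * dpartial i v x.
Proof.
move=> oO cv; have s0 := @sub0set _ O; elim: p => [|p IH] x Ox.
  by rewrite (@eq_dpartial _ _ O _ v) // expr0 !mul1r.
rewrite (@eq_dpartial _ _ O _ (fun y => v y * v y ^+ p.+1)) //.
rewrite dpartialM; [|exact (ckb_derivable cv Ox)|exact (ckb_derivable (ckbX p.+1 oO s0 cv) Ox)].
by rewrite IH // [in RHS]exprS -[p.+2%:R]natr1 [in X in X + _]exprS; ring.
Qed.

(* Differentiating [v ^+ n] fewer than [n] times leaves a factor [v]; this is
   what makes [f] integrable against these derivatives when only [f * v] is
   known to be locally integrable. *)
Lemma dpartialn_pow O v h r n a : open O -> ckb O set0 r v -> ckb O set0 r h ->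
  (mabs a <= r)%N -> (mabs a <= n)%N ->
  exists2 h', ckb O set0 (r - mabs a) h' &
    forall x, O x -> dpartialn a (fun y => v y ^+ n * h y) x = v x ^+ (n - mabs a) * h' x.
Proof.
move=> oO cv ch; have s0 := @sub0set _ O; elim/(@mindex_ind d): a => [|a i IH].
  by rewrite /mabs big1 // !subn0 => _ _; exists h => // x _; rewrite dpartialn0.
rewrite mabs_madd1 => ar an; have [h' ch' E] := IH (ltnW ar) (ltnW an).
set p := (n - (mabs a).+1)%N.
have pE : (n - mabs a)%N = p.+1 by rewrite /p subnSK.
have rE : (r - mabs a)%N = (r - (mabs a).+1).+1 by rewrite subnSK.
rewrite rE in ch'.
have cv1 : ckb O set0 (r - (mabs a).+1).+1 v by apply: ckb_le cv; rewrite subnSK // leq_subr.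
exists (fun x => p.+1%:R * dpartial i v x * h' x + v x * dpartial i h' x).
  apply: ckbD => //; apply: ckbM => //.
  - by apply: ckbM => //; [exact: ckb_cst|exact: ckb_dpartial].
  - exact: ckb_le (leqnSn _) ch'.
  - exact: ckb_le (leqnSn _) cv1.
  - exact: ckb_dpartial.
move=> x Ox.
rewrite (@dpartialn_madd1l _ _ O set0) //; last first.
  by apply: ckb_le ar _; apply: ckbM => //; exact: ckbX.
rewrite (@eq_dpartial _ _ O _ (fun y => v y ^+ p.+1 * h' y)) //; last first.
  by move=> y Oy; rewrite E // pE.
have cv' : ckb O set0 1 v by apply: ckb_le cv1.
rewrite dpartialM.
- by rewrite (dpartialX i p oO cv') // exprS; ring.
- exact (ckb_derivable (ckbX p.+1 oO s0 cv') Ox).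
- exact (ckb_derivable ch' Ox).
Qed.

End PowerDerivatives.

(** * Dominated convergence on a compact support *)

Section DominatedLimit.
Context {R : realType} {d : nat}.
Notation T := 'rV[R]_d.+1.
Implicit Types (O K : set T) (w g : T -> R).
Local Open Scope ereal_scope.

Lemma dominated_limit O K w (gn : nat -> T -> R) g (C : R) :
  open O -> compact K -> K `<=` O -> measurable_fun K w ->
  \int[leb]_(x in K) `|w x|%:E < +oo ->
  (forall n, measurable_fun O (gn n)) -> measurable_fun O g -> (0 <= C)%R ->
  (forall n x, K x -> `|gn n x| <= C * `|w x|)%R ->
  (forall n x, O x -> ~ K x -> gn n x = 0%R) ->
  (forall x, O x -> gn n x @[n --> \oo] --> g x) ->
  leb.-integrable O (EFin \o g) /\
  (\int[leb]_(x in O) (gn n x)%:E @[n --> \oo] --> \int[leb]_(x in O) (g x)%:E).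
Proof.
move=> oO cK KO mw iw mgn mg C0 gnK gnN gng.
have mO : measurable O by exact: measurable_openrV.
have mK : measurable K by exact: measurable_compactrV.
pose G := (fun x => C%:E * `|w x|%:E) \_ K.
have iG : leb.-integrable O G.
  apply/integrable_restrict => //; rewrite (_ : O `&` K = K); last first.
    by apply/seteqP; split => [x []//|x Kx]; split => //; exact: KO.
  apply: integrableZl => //; apply/integrableP; split.
    by apply/measurable_EFinP; exact: measurableT_comp.
  by under eq_integral do rewrite /= normr_id.
have [|||||i1 _ i2] := @dominated_convergence _ _ _ (@leb R d.+1) O mO
  (fun n x => (gn n x)%:E) (fun x => (g x)%:E) G.
- by move=> n; exact/measurable_EFinP.
- exact/measurable_EFinP.
- by apply: aeW => x Ox; apply: cvg_EFin; [exact: nearW|exact: gng].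
- exact: iG.
- apply: aeW => x n Ox; rewrite /G /patch; case: ifPn => xK.
    by rewrite /= lee_fin; apply: gnK; rewrite inE in xK.
  by rewrite gnN ?abse0 // => Kx; rewrite mem_set in xK.
- by split.
Qed.

Lemma integrable_supported O K w g (C : R) :
  open O -> compact K -> K `<=` O -> measurable_fun K w ->
  \int[leb]_(x in K) `|w x|%:E < +oo -> measurable_fun O g -> (0 <= C)%R ->
  (forall x, K x -> `|g x| <= C * `|w x|)%R ->
  (forall x, O x -> ~ K x -> g x = 0%R) -> leb.-integrable O (EFin \o g).
Proof.
move=> oO cK KO mw iw mg C0 gK gN.
by have [] := @dominated_limit O K w (fun=> g) g C oO cK KO mw iw (fun=> mg) mg C0
  (fun=> gK) (fun=> gN) (fun x _ => cvg_cst _).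
Qed.

Lemma inL1loc_measurable O w f : open O -> inL1loc O w f ->
  measurable_fun O (fun x => f x * w x)%R.
Proof.
by move=> oO fw; apply: measurable_fun_local => // K cK KO; have [] := fw K cK KO.
Qed.

End DominatedLimit.

(** * The weak identity for test functions of finite order *)

Section Extension.
Context {R : realType} {d : nat} (eta : R -> R).
Hypothesis etaP : cutoff_eta eta.
Notation T := 'rV[R]_d.+1.
Implicit Types (O K : set T) (v f g h : T -> R) (b : mindex d.+1).

Lemma test_fun_supported O K h : compact K -> K `<=` O -> smooth h ->
  (forall x, ~ K x -> h x = 0) -> test_fun O h.
Proof.
move=> cK KO sh hK.
have S : closure [set x | h x != 0] `<=` K.
  have := compact_closedrV cK; rewrite closureE => clK x; apply; split => //.
  by move=> y /=; apply: contraNP => /hK ->.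
split => //; split; last exact: subset_trans S KO.
by apply: subclosed_compact cK S; exact: closed_closure.
Qed.

(** A single factor [v] is pulled out of all terms: a derivative of index [c] below [b] leaves a
    power of [v] of exponent at least 1. The continuous coefficients [H] do not depend on [h], so
    one bound on a compact set serves a whole approximating sequence. *)
Lemma weighted_leibniz O v b : open O -> ckb O set0 (mabs b) v ->
  exists2 H : mindex d.+1 -> T -> R,
    forall c x, O x -> {for x, continuous (H c)} &
    forall h, ckb O set0 (mabs b) h -> forall x, O x ->
      dpartialn b (fun y => v y ^+ (mabs b).+1 * h y) x =
      v x * lsum (mabs b) b (fun c => H c x * dpartialn (msub b c) h x).
Proof.
move=> oO cv; have s0 := @sub0set _ O.
have c1 : ckb O set0 (mabs b) (fun=> 1 : R) by exact: ckb_cst.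
have cX : ckb O set0 (mabs b) (fun y => v y ^+ (mabs b).+1) by exact: ckbX.
have /boolp.choice [H HP] : forall c, exists h : T -> R,
    (forall x, O x -> {for x, continuous h}) /\
    (mle c b -> forall x, O x -> dpartialn c (fun y => v y ^+ (mabs b).+1) x = v x * h x).
  move=> c; have [cb|ncb] := pselect (mle c b); last first.
    by exists (fun=> 0); split => // x _; exact: cst_continuous.
  have cbm := mle_mabs cb.
  have [h ch E] := @dpartialn_pow _ _ O v _ _ (mabs b).+1 c oO cv c1 cbm (leqW cbm).
  exists (fun x => v x ^+ (mabs b - mabs c) * h x); split.
    move=> x Ox; have cc := ckbM oO s0 (ckbX (mabs b - mabs c) oO s0 (ckb_le (leq0n _) cv)) (ckb_le (leq0n _) ch).
    exact: (ckb_continuous cc Ox).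
  move=> _ x Ox; rewrite mulrA -exprS -subSn // -E //; apply: eq_dpartialn Ox => //.
  by move=> y _; rewrite mulr1.
exists H; first by move=> c x Ox; have [+ _] := HP c; exact.
move=> h ch x Ox; rewrite (@dpartialnM _ _ O (mabs b)) //.
rewrite /lsum mulr_sumr; apply: eq_bigr => c _; set c' := (fun i => _).
have [cb|ncb] := pselect (mle c' b); last by rewrite mbinom_eq0 // !mul0r mulr0.
by have [_ ->] := HP c' => //; ring.
Qed.

(** Integrability is part of the conclusion: later sums and differences of such identities are
    formed under the integral sign. *)
Lemma weak_vderiv_ext O K v b f g h : open O -> ckb O set0 (mabs b) v ->
  inL1loc O v f -> is_weak_vderiv O v b f g ->
  compact K -> K `<=` O -> (forall x, ~ K x -> h x = 0) -> ckb setT set0 (mabs b) h ->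
  [/\ leb.-integrable O (EFin \o (fun x => f x * dpartialn b (fun y => v y ^+ (mabs b).+1 * h y) x)),
    leb.-integrable O (EFin \o (fun x => v x ^+ (mabs b).+1 * h x * g x)) &
    (\int[leb]_(x in O) (f x * dpartialn b (fun y => v y ^+ (mabs b).+1 * h y) x)%:E
    = ((-1) ^+ mabs b)%:E * \int[leb]_(x in O) (v x ^+ (mabs b).+1 * h x * g x)%:E)%E].
Proof.
move=> oO cv fL [gL gW] cK KO hK ch.
have mO : measurable O by exact: measurable_openrV.
have [K' [cK' K'O KK' [hn [hns hnK hnP]]]] := smooth_approx etaP oO cK KO hK ch.
have [H cH HP] := weighted_leibniz oO cv.
have sO : O `<=` setT by [].
have chO : ckb O set0 (mabs b) h by exact: ckb_sub ch.
have chn n : ckb O set0 (mabs b) (hn n).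
  by apply: (@ckb_sub _ _ setT set0) => //; apply: Ck_ckb0; [exact: openT|exact: hns].
pose q n x := lsum (mabs b) b (fun c => H c x * dpartialn (msub b c) (hn n) x).
pose q0 x := lsum (mabs b) b (fun c => H c x * dpartialn (msub b c) h x).
have cdp (u : T -> R) c : ckb O set0 (mabs b) u -> forall x, O x -> {for x, continuous (dpartialn (msub b c) u)}.
  move=> cu x Ox; apply: (@ckb_continuous _ _ O set0 0) => //; apply: ckb_dpartialn.
  by rewrite addn0; apply: ckb_le cu; exact: mabs_msub_le.
have clK' : closed K' by exact: compact_closedrV.
have [B [B0 BP]] : exists B : R, 0 <= B /\ forall nx : nat * T, K' nx.2 -> `|q nx.1 nx.2| <= B.
  apply: (@lsum_bounded _ _ _ _ _ (fun c (nx : nat * T) => H c nx.2 * dpartialn (msub b c) (hn nx.1) nx.2)).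
  move=> c; have [C [C0 CP]] := continuous_bounded cK' (fun x K'x => cH c x (K'O x K'x)).
  have [[D DP] _] := hnP _ (mabs_msub_le b c).
  exists (C * D) => -[n x] /= K'x; rewrite normrM.
  by apply: ler_pM => //; exact: CP.
have qK n x : ~ K' x -> q n x = 0.
  move=> nK; rewrite /q /lsum big1 // => c _.
  by rewrite (dpartialn_vanish _ clK' (hnK n) nK) !mulr0.
have qq x : O x -> q n x @[n --> \oo] --> q0 x.
  move=> Ox; apply: lsum_cvg => c; apply: cvgMr.
  by have [_] := hnP _ (mabs_msub_le b c); exact.
have cq n : forall x, O x -> {for x, continuous (q n)}.
  by move=> x Ox; apply: lsum_continuous => c; apply: continuousM; [exact: cH|exact: cdp].
have cq0 : forall x, O x -> {for x, continuous q0}.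
  by move=> x Ox; apply: lsum_continuous => c; apply: continuousM; [exact: cH|exact: cdp].
have mfv := inL1loc_measurable oO fL.
have [mfvK ifvK] := fL K' cK' K'O.
have mgv := inL1loc_measurable oO gL.
have [mgvK igvK] := gL K' cK' K'O.
have [||||||iL cL] := @dominated_limit _ _ O K' (fun x => f x * v x)
  (fun n x => f x * v x * q n x) (fun x => f x * v x * q0 x) B oO cK' K'O mfvK ifvK.
- by move=> n; apply: measurable_funM => //; apply: continuous_measurable => //; exact: cq.
- by apply: measurable_funM => //; apply: continuous_measurable => //; exact: cq0.
- exact: B0.
- by move=> n x K'x; rewrite normrM mulrC; apply: ler_wpM2r => //; exact: (BP (n, x)).
- by move=> n x Ox nK; rewrite qK // mulr0.
- by move=> x Ox; apply: cvgMr; exact: qq.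
have [D [D0 DP]] : exists D : R, 0 <= D /\ forall n x, `|hn n x| <= D.
  have [|[D DP] _] := hnP (@Defs.mzero _); first by rewrite /mabs big1.
  exists D; split; first by exact: le_trans (normr_ge0 _) (DP 0%N 0).
  by move=> n x; have := DP n x; rewrite dpartialn0.
have chc : forall x, O x -> {for x, continuous h} by move=> x Ox; exact: (ckb_continuous chO).
have chnc n : forall x, O x -> {for x, continuous (hn n)} by move=> x Ox; exact: (ckb_continuous (chn n)).
have [||||||iR cR] := @dominated_limit _ _ O K' (fun x => g x * v x ^+ (mabs b).+1)
  (fun n x => g x * v x ^+ (mabs b).+1 * hn n x) (fun x => g x * v x ^+ (mabs b).+1 * h x) D oO cK' K'O mgvK igvK.
- by move=> n; apply: measurable_funM => //; apply: continuous_measurable => //; exact: chnc.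
- by apply: measurable_funM => //; apply: continuous_measurable => //; exact: chc.
- exact: D0.
- by move=> n x K'x; rewrite normrM mulrC; apply: ler_wpM2r.
- by move=> n x Ox nK; rewrite hnK // mulr0.
- move=> x Ox; apply: cvgMr.
  have [|_ /(_ x)] := hnP (@Defs.mzero _); first by rewrite /mabs big1.
  by rewrite dpartialn0; apply: cvg_trans; apply: near_eq_cvg; apply: nearW => n; rewrite dpartialn0.
have EL (u : T -> R) x : ckb O set0 (mabs b) u -> O x ->
    f x * dpartialn b (fun y => v y ^+ (mabs b).+1 * u y) x =
    f x * v x * lsum (mabs b) b (fun c => H c x * dpartialn (msub b c) u x).
  by move=> cu Ox; rewrite HP // mulrA.
have ER (u : T -> R) x : v x ^+ (mabs b).+1 * u x * g x = g x * v x ^+ (mabs b).+1 * u x by ring.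
split.
- by apply: eq_integrable iL => // x; rewrite inE => Ox /=; rewrite EL.
- by apply: eq_integrable iR => // x; rewrite inE => Ox /=; rewrite ER.
have -> : (\int[leb]_(x in O) (f x * dpartialn b (fun y => v y ^+ (mabs b).+1 * h y) x)%:E =
   \int[leb]_(x in O) (f x * v x * q0 x)%:E)%E.
  by apply: eq_integral => x; rewrite inE => Ox; rewrite EL.
have -> : (\int[leb]_(x in O) (v x ^+ (mabs b).+1 * h x * g x)%:E =
   \int[leb]_(x in O) (g x * v x ^+ (mabs b).+1 * h x)%:E)%E.
  by apply: eq_integral => x _; rewrite ER.
(* Both sides are limits of the same sequence, as the identity holds for each smooth [hn n]. *)
apply: cvg_unique cL _ => //.
have -> : (fun n => \int[leb]_(x in O) (f x * v x * q n x)%:E)%E =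
  (fun n => ((-1) ^+ mabs b)%:E * \int[leb]_(x in O) (g x * v x ^+ (mabs b).+1 * hn n x)%:E)%E.
  apply/funext => n.
  have -> : (\int[leb]_(x in O) (f x * v x * q n x)%:E =
      \int[leb]_(x in O) (f x * dpartialn b (fun y => v y ^+ (mabs b).+1 * hn n y) x)%:E)%E.
    by apply: eq_integral => x; rewrite inE => Ox; rewrite (EL (hn n) x (chn n) Ox).
  rewrite gW; last exact: (test_fun_supported cK' K'O (hns n) (hnK n)).
  by congr (_ * _)%E; apply: eq_integral => x _; rewrite ER.
by apply: cvgeZl.
Qed.

End Extension.

(** * Weak derivatives *)

Section DuBoisReymond.
Context {R : realType} {d : nat} (eta : R -> R).
Hypothesis etaP : cutoff_eta eta.
Notation T := 'rV[R]_d.+1.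
Implicit Types (O K : set T) (g h : T -> R).

Definition oboxes : set (set T) := [set A | exists p q, A = obox p q].

Definition row_max (p q : T) : T := \row_i Num.max (p ord0 i) (q ord0 i).
Definition row_min (p q : T) : T := \row_i Num.min (p ord0 i) (q ord0 i).

Lemma obox_setI (p q p' q' : T) :
  obox p q `&` obox p' q' = obox (row_max p p') (row_min q q').
Proof.
apply/seteqP; split => x.
  move=> [h1 h2] i; rewrite !mxE gt_max lt_min.
  by have /andP[-> ->] := h1 i; have /andP[-> ->] := h2 i.
move=> H; split=> i; have := H i; rewrite !mxE gt_max lt_min => /andP[/andP[h1 h2] /andP[h3 h4]].
  by rewrite h1 h3.
by rewrite h2 h4.
Qed.

Lemma oboxes_setI : setI_closed oboxes.
Proof.
move=> _ _ [p [q ->]] [p' [q' ->]].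
by exists (row_max p p'), (row_min q q'); exact: obox_setI.
Qed.

Lemma rbox_row_max (p q p' q' : T) : rbox (row_max p p') (row_min q q') `<=` rbox p' q'.
Proof.
by move=> x H i; have := H i; rewrite !mxE ge_max le_min => /andP[/andP[_ ->] /andP[_ ->]].
Qed.

Lemma measurable_obox (p q : T) : measurable (obox p q).
Proof.
rewrite (_ : obox p q = \bigcap_(i in [set: 'I_d.+1])
    ((fun x : T => x ord0 i) @^-1` `]p ord0 i, q ord0 i[)); last first.
  apply/seteqP; split => [x xab i _|x xab i]; first by rewrite /= in_itv; exact: xab.
  by have := xab i Logic.I; rewrite /= in_itv.
apply: fin_bigcap_measurable => // i _.
by rewrite -[X in measurable X]setTI; exact (measurable_coord i measurableT (measurable_itv _)).
Qed.

Lemma measurable_oboxes : @measurable _ T = <<s oboxes >>.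
Proof.
apply/seteqP; split => A; last first.
  move: A; apply: smallest_sub; first exact: sigma_algebra_measurable.
  by move=> _ [p [q ->]]; exact: measurable_obox.
move=> /measurable_gen_coord; rewrite /g_sigma_preimage; move: A.
apply: smallest_sub; first exact: smallest_sigma_algebra.
rewrite -bigcup_mkord_ord => B [i _ [C mC <-]].
have mf : measurable_fun (setT : set (g_sigma_algebraType oboxes))
    (fun x : T => x ord0 (inord i)).
  apply: (measurability _ (RGenOInfty.measurableE R)) => _ [_ [c ->]] <-.
  (* A half-space is exhausted by boxes whose remaining bounds tend to infinity. *)
  rewrite setTI (_ : _ @^-1` _ = \bigcup_N obox
     (\row_j if j == inord i then c else - N%:R) (const_mx N%:R)); last first.
    apply/seteqP; split => x /=.
      rewrite in_itv /= andbT => cx.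
      exists (Num.truncn `|x|).+1 => // j; rewrite !mxE.
      have xN : `|x ord0 j| < (Num.truncn `|x|).+1%:R.
        exact: le_lt_trans (rV_coord_le x j) (truncnS_gt _).
      move: xN; rewrite ltr_norml => /andP[h1 ->]; rewrite andbT.
      by case: eqP => [->|].
    move=> [N _ /(_ (inord i))]; rewrite !mxE eqxx => /andP[h1 _].
    by rewrite in_itv /= h1.
  by apply: bigcupT_measurable => N; apply: sub_sigma_algebra; exists (\row_j if j == inord i then c else - N%:R), (const_mx N%:R).
exact: mf.
Qed.

Section LocallyIntegrable.
Variables (O : set T) (h : T -> R).
Hypotheses (oO : open O)
  (mh : measurable_fun O h)
  (ih : forall K, compact K -> K `<=` O -> (\int[leb]_(x in K) `|h x|%:E < +oo)%E)
  (h0 : forall phi, test_fun O phi -> (\int[leb]_(x in O) (phi x * h x)%:E = 0)%E).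

Let mO : measurable O. Proof. exact: measurable_openrV. Qed.

Let mhK K : compact K -> K `<=` O -> measurable_fun K h.
Proof. by move=> _ KO; exact: measurable_funS mh. Qed.

(** The approximation at order 0 carries the vanishing of integrals from smooth to continuous
    functions. *)
Lemma integral_continuous0 K (phi : T -> R) : compact K -> K `<=` O ->
  continuous phi -> (forall x, ~ K x -> phi x = 0) ->
  (\int[leb]_(x in O) (phi x * h x)%:E = 0)%E.
Proof.
move=> cK KO cp pK.
have c0 : ckb setT set0 0 phi by split=> //; [move=> x _; exact: cp|exists 0].
have [K' [cK' K'O KK' [hn [hns hnK hnP]]]] := smooth_approx etaP oO cK KO pK c0.
have [|[B BP] hcv] := hnP (@Defs.mzero _); first by rewrite /mabs big1.
rewrite dpartialn0 in hcv.
have cn n : continuous (hn n).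
  by move=> x; have [_ /(_ (@Defs.mzero _))] := hns n 0; rewrite dpartialn0; apply; rewrite /mabs ?big1.
have B0 : 0 <= B by exact: le_trans (normr_ge0 _) (BP 0 0).
have [||||||_ cL] := @dominated_limit _ _ O K' h (fun n x => hn n x * h x)
  (fun x => phi x * h x) B oO cK' K'O (mhK cK' K'O) (ih cK' K'O).
- by move=> n; apply: measurable_funM => //; apply: continuous_measurable => // x _; exact: cn.
- by apply: measurable_funM => //; apply: continuous_measurable => // x _; exact: cp.
- exact: B0.
- move=> n x K'x; rewrite normrM; apply: ler_wpM2r => //.
  by have := BP n x; rewrite dpartialn0.
- by move=> n x Ox nK; rewrite hnK // mul0r.
- move=> x Ox; apply: cvgMl; have := hcv x.
  by apply: cvg_trans; apply: near_eq_cvg; apply: nearW => n; rewrite dpartialn0.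
apply: cvg_unique cL _ => //.
have -> : (fun n => \int[leb]_(x in O) (hn n x * h x)%:E)%E = (fun=> 0%E).
  by apply/funext => n; exact: h0 (test_fun_supported cK' K'O (hns n) (hnK n)).
exact: cvg_cst.
Qed.

(** [psi] is continuous and positive exactly on the open box, so [min 1 (n * psi)] tends to its
    indicator. *)
Lemma integral_obox0 (p q : T) : rbox p q `<=` O ->
  leb.-integrable (obox p q) (EFin \o h) /\ (\int[leb]_(x in obox p q) (h x)%:E = 0)%E.
Proof.
move=> pqO; have cK : compact (rbox p q) by exact: compact_rbox.
pose psi (x : T) := \prod_(i <- enum 'I_d.+1)
  (Num.max 0 (x ord0 i - p ord0 i) * Num.max 0 (q ord0 i - x ord0 i)).
pose phi (n : nat) (x : T) := Num.min 1 (n%:R * psi x).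
have psi_in x : obox p q x -> 0 < psi x.
  move=> xpq; rewrite /psi; apply: prodr_gt0 => i _; have /andP[h1 h2] := xpq i.
  by rewrite mulr_gt0 // lt_max subr_gt0 ?h1 ?h2 orbT.
have psi_out x : ~ obox p q x -> psi x = 0.
  move=> /existsNP [i /negP]; rewrite negb_and -!leNgt => hi.
  rewrite /psi (big_rem i) ?mem_enum //=.
  case/orP: hi => hi.
    by rewrite [Num.max 0 (x ord0 i - p ord0 i)]max_l ?subr_le0 // !mul0r.
  by rewrite [Num.max 0 (q ord0 i - x ord0 i)]max_l ?subr_le0 // mulr0 mul0r.
have psi_ge0 x : 0 <= psi x.
  by rewrite /psi; apply: prodr_ge0 => i _; rewrite mulr_ge0 // le_max lexx.
have psi_c : continuous psi.
  move=> x; rewrite /psi; elim: (enum _) => [|i s IH].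
    under eq_fun do rewrite big_nil; exact: cst_continuous.
  under eq_fun do rewrite big_cons.
  have cx : {for x, continuous (fun y : T => y ord0 i)} by exact: coord_continuous.
  have c1 : {for x, continuous (fun y : T => Num.max 0 (y ord0 i - p ord0 i))}.
    have cp : {for x, continuous (fun y : T => y ord0 i - p ord0 i)}.
      exact: (continuousB cx (@cst_continuous _ _ (p ord0 i) x)).
    exact: (continuous_max (@cst_continuous T R 0 x) cp).
  have c2 : {for x, continuous (fun y : T => Num.max 0 (q ord0 i - y ord0 i))}.
    have cq : {for x, continuous (fun y : T => q ord0 i - y ord0 i)}.
      exact: (continuousB (@cst_continuous _ _ (q ord0 i) x) cx).
    exact: (continuous_max (@cst_continuous T R 0 x) cq).
  exact: (continuousM (continuousM c1 c2) IH).
have phi_c n : continuous (phi n).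
  move=> x; have cM : {for x, continuous (fun y : T => n%:R * psi y)}.
    exact: (continuousM (@cst_continuous T R n%:R x) (psi_c x)).
  exact: (continuous_min (@cst_continuous T R 1 x) cM).
have phi_b n x : 0 <= phi n x <= 1.
  by rewrite /phi ge_min lexx le_min ler01 mulr_ge0.
have phi_out n x : ~ obox p q x -> phi n x = 0.
  by move=> /psi_out E; rewrite /phi E mulr0 min_r.
have phi_cvg x : phi n x @[n --> \oo] --> (\1_(obox p q) x : R).
  rewrite indicE; have [xpq|nxpq] := pselect (obox p q x); last first.
    rewrite memNset //=; apply: cvg_near_cst; apply: nearW => n; exact: phi_out.
  rewrite mem_set //=; apply: cvg_near_cst; near=> n.
  rewrite /phi min_l // -ler_pdivrMr ?psi_in //.
  by near: n; exact: nbhs_infty_ger.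
have pN n x : ~ rbox p q x -> phi n x = 0.
  by move=> nx; apply: phi_out => /obox_rbox.
have [||||||iL cL] := @dominated_limit _ _ O (rbox p q) h (fun n x => phi n x * h x)
  (fun x => \1_(obox p q) x * h x) 1 oO cK pqO (mhK cK pqO) (ih cK pqO).
- by move=> n; apply: measurable_funM => //; apply: continuous_measurable => // x _; exact: phi_c.
- by apply: measurable_funM => //; apply: measurable_indic; exact: measurable_obox.
- exact: ler01.
- move=> n x _; rewrite normrM; apply: ler_wpM2r => //.
  by have /andP[h1 h2] := phi_b n x; rewrite ger0_norm.
- by move=> n x Ox nK; rewrite pN // mul0r.
- by move=> x Ox; apply: cvgMl; exact: phi_cvg.
have opqO : O `&` obox p q = obox p q.
  by apply/seteqP; split => [x []//|x xpq]; split => //; apply: pqO; exact: obox_rbox.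
have E : {in O, (EFin \o (fun x => \1_(obox p q) x * h x)) =1 ((EFin \o h) \_ (obox p q))}.
  move=> x _; rewrite /= /patch indicE; case: (x \in _); first by rewrite mul1r.
  by rewrite mul0r.
have mpq := measurable_obox p q.
split.
  rewrite -opqO; apply/integrable_restrict => //.
  exact: eq_integrable iL.
rewrite -opqO integral_mkcondr -(eq_integral _ _ E).
apply: cvg_unique cL _ => //.
have -> : (fun n => \int[leb]_(x in O) (phi n x * h x)%:E)%E = (fun=> 0%E).
  by apply/funext => n; exact: integral_continuous0 cK pqO (phi_c n) (pN n).
exact: cvg_cst.
Unshelve. all: by end_near. Qed.

(** Open boxes are stable under intersection and generate the Borel sets, so a Dynkin argument
    extends vanishing integrals from boxes to all measurable subsets of the box. *)
Lemma ae_obox0 (a b : T) : rbox a b `<=` O ->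
  {ae leb, forall x : T, obox a b x -> h x = 0}.
Proof.
move=> abO; have [iU U0] := integral_obox0 abO.
set U := obox a b in iU U0 *.
have mU : measurable U by exact: measurable_obox.
have P A : measurable A -> (\int[leb]_(x in A `&` U) (h x)%:E = 0)%E.
  rewrite measurable_oboxes; move: A; apply: (dynkin_induction measurable_oboxes).
  - exact: oboxes_setI.
  - by rewrite setTI.
  - move=> _ [p [q ->]].
    rewrite obox_setI; apply: (integral_obox0 _).2.
    exact: subset_trans (rbox_row_max (q' := b)) abO.
  - move=> A mA A0.
    have mAU : measurable (A `&` U) by exact: measurableI.
    have mCU : measurable (~` A `&` U) by apply: measurableI => //; exact: measurableC.
    have := U0; rewrite {1}(_ : U = (A `&` U) `|` (~` A `&` U)); last first.
      by rewrite -setIUl setUCr setTI.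
    rewrite integral_setU //.
    + by rewrite A0 add0e.
    + by rewrite -setIUl setUCr setTI; exact: measurable_int iU.
    + by rewrite disj_set2E setIACA setICr set0I.
  - move=> F mF tF F0; rewrite setI_bigcupl integral_bigcup.
    + by rewrite eseries0.
    + by apply: trivIset_setIr.
    + by move=> k; exact: measurableI.
    + rewrite -setI_bigcupl; apply: integrableS iU => //.
      by apply: measurableI => //; exact: bigcupT_measurable.
have H : ae_eq leb U (EFin \o h) (cst 0%E).
  apply: integral_ae_eq => // A AU mA.
  rewrite integral0 -(P A mA); congr (integral _ _ _).
  by apply/seteqP; split => [x Ax|x []//]; split => //; exact: AU.
by apply: filterS H => x /= H /H [].
Qed.

Lemma du_bois_reymond : {ae leb, forall x : T, O x -> h x = 0}.
Proof.
have [a [b [OE abO]]] := open_oboxes oO.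
have N : leb.-negligible (\bigcup_k (~` [set x : T | obox (a k) (b k) x -> h x = 0])).
  by apply: negligible_bigcup => k; exact: ae_obox0 (abO k).
apply: negligibleS N => x /= /not_implyP [].
rewrite [X in X x -> _]OE => -[k _ xk] hx; exists k => //=.
by apply/not_implyP.
Qed.

End LocallyIntegrable.

End DuBoisReymond.

(** * Uniqueness and linearity of weak derivatives *)

Section WeakDerivatives.
Context {R : realType} {d : nat}.
Notation T := 'rV[R]_d.+1.
Implicit Types (O K : set T) (f g v : T -> R) (a b : mindex d.+1).
Local Open Scope ereal_scope.

Lemma inL1loc_integrable O w f K : inL1loc O w f -> compact K -> K `<=` O ->
  leb.-integrable K (EFin \o (fun x => f x * w x)%R).
Proof.
move=> fL cK KO; have [mf If] := fL K cK KO.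
by apply/integrableP; split; first exact/measurable_EFinP.
Qed.

Lemma integrable_inL1loc O w f : (forall K, compact K -> K `<=` O ->
  leb.-integrable K (EFin \o (fun x => f x * w x)%R)) -> inL1loc O w f.
Proof.
move=> fI K cK KO; have /integrableP [mf If] := fI K cK KO.
by split; first exact/measurable_EFinP.
Qed.

Lemma inL1locB O w f g : inL1loc O w f -> inL1loc O w g ->
  inL1loc O w (fun x => f x - g x)%R.
Proof.
move=> fL gL; apply: integrable_inL1loc => K cK KO.
have mK := measurable_compactrV cK.
apply: eq_integrable (integrableB mK (inL1loc_integrable fL cK KO) (inL1loc_integrable gL cK KO)) => //.
by move=> x _ /=; rewrite -EFinB mulrBl.
Qed.

(** [Dv] sets order 0 apart by convention; this brings it under the general definition, so sums over
    all [b] below [a] are treated uniformly. *)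
Lemma is_weak_vderiv0 O v f : inL1loc O v f -> is_weak_vderiv O v (@Defs.mzero _) f f.
Proof.
have m0 : mabs (@Defs.mzero d.+1) = 0%N by rewrite /mabs big1.
move=> fL; rewrite /is_weak_vderiv m0; split.
  by move=> K cK KO; have [? ?] := fL K cK KO; split.
move=> phi _; rewrite mul1e; apply: eq_integral => x _.
by rewrite dpartialn0 mulrC.
Qed.

Lemma weak_deriv_ae_unique (eta : R -> R) O a f g1 g2 : cutoff_eta eta -> open O ->
  is_weak_vderiv O rv_one a f g1 -> is_weak_vderiv O rv_one a f g2 ->
  {ae leb, forall x : T, O x -> g1 x = g2 x}.
Proof.
move=> etaP oO [L1 W1] [L2 W2].
have one_ x k : (rv_one x ^+ k = 1 :> R)%R by rewrite /rv_one expr1n.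
have LB := inL1locB L1 L2.
have mO : measurable O by exact: measurable_openrV.
suff H : {ae leb, forall x : T, O x -> (g1 x - g2 x)%R = 0%R}.
  by apply: filterS H => x /= H Ox; apply/eqP; rewrite -subr_eq0; apply/eqP; exact: H.
apply: (du_bois_reymond etaP oO).
- have := inL1loc_measurable oO LB; apply: eq_measurable_fun => x _.
  by rewrite one_ mulr1.
- move=> K cK KO; have [_] := LB K cK KO; congr (_ < _); apply: eq_integral => x _.
  by rewrite one_ mulr1.
move=> phi tphi; have [sphi [cK KO]] := tphi.
set K := closure _ in cK KO.
have phiK x : ~ K x -> phi x = 0%R.
  move=> nK; apply: contrapT => /eqP p0; apply: nK; exact: subset_closure.
have cphi : continuous phi.
  move=> x; have [_ /(_ (@Defs.mzero _))] := sphi 0%N.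
  by rewrite dpartialn0; apply => //; rewrite /mabs big1.
have [C [C0 CP]] := continuous_bounded cK (fun x _ => cphi x).
have mphi : measurable_fun O phi by apply: continuous_measurable => // x _; exact: cphi.
have I g : inL1loc O (fun x => rv_one x ^+ (mabs a).+1)%R g ->
    leb.-integrable O (EFin \o (fun x => g x * phi x)%R).
  move=> gL; have [mg Ig] := gL K cK KO; have mgO := inL1loc_measurable oO gL.
  apply: (@integrable_supported _ _ O K (fun x => g x * rv_one x ^+ (mabs a).+1)%R _ C) => //.
  - apply: measurable_funM => //; apply: eq_measurable_fun mgO => x _.
    by rewrite one_ mulr1.
  - by move=> x Kx; rewrite normrM one_ mulr1 mulrC ler_wpM2r // CP.
  - by move=> x Ox nK; rewrite phiK // mulr0.
have E : \int[leb]_(x in O) (phi x * (g1 x - g2 x))%:E =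
    \int[leb]_(x in O) (g1 x * phi x)%:E - \int[leb]_(x in O) (g2 x * phi x)%:E.
  rewrite -(integralB mO (I _ L1) (I _ L2)); apply: eq_integral => x _ /=.
  by rewrite -EFinB -mulrBl mulrC.
have := W1 phi tphi; rewrite W2 // => /esym F.
have F' : \int[leb]_(x in O) (rv_one x ^+ (mabs a).+1 * phi x * g1 x)%:E =
    \int[leb]_(x in O) (rv_one x ^+ (mabs a).+1 * phi x * g2 x)%:E.
  have s1 : ((-1) ^+ mabs a * (-1) ^+ mabs a = 1 :> R)%R by rewrite -expr2 sqrr_sign.
  have := congr1 (fun z => ((-1) ^+ mabs a)%:E * z) F.
  by rewrite !muleA -!EFinM s1 !mul1e.
have N g : \int[leb]_(x in O) (rv_one x ^+ (mabs a).+1 * phi x * g x)%:E =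
    \int[leb]_(x in O) (g x * phi x)%:E.
  by apply: eq_integral => x _; rewrite one_ mul1r mulrC.
rewrite E -!N F' subee // N.
by apply: integrable_fin_num => //; exact: I.
Qed.

(** An equality of extended integrals does not by itself split over differences; [weak_vderiv_ext]
    supplies the integrability of both sides. *)
Lemma is_weak_vderivB (eta : R -> R) O v b f1 f2 g1 g2 : cutoff_eta eta -> open O ->
  ckb O set0 (mabs b) v -> inL1loc O v f1 -> inL1loc O v f2 ->
  is_weak_vderiv O v b f1 g1 -> is_weak_vderiv O v b f2 g2 ->
  is_weak_vderiv O v b (fun x => f1 x - f2 x)%R (fun x => g1 x - g2 x)%R.
Proof.
move=> etaP oO cv L1 L2 W1 W2.
have mO : measurable O by exact: measurable_openrV.
split; first exact: inL1locB W1.1 W2.1.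
move=> phi tphi; have [sphi [cK KO]] := tphi.
set K := closure _ in cK KO.
have phiK x : ~ K x -> phi x = 0%R.
  move=> nK; apply: contrapT => /eqP p0; apply: nK; exact: subset_closure.
have cphi : ckb setT set0 (mabs b) phi by apply: Ck_ckb0; [exact: openT|exact: sphi].
have [i1 j1 e1] := weak_vderiv_ext etaP oO cv L1 W1 cK KO phiK cphi.
have [i2 j2 e2] := weak_vderiv_ext etaP oO cv L2 W2 cK KO phiK cphi.
under eq_integral do rewrite mulrBl EFinB.
rewrite (integralB mO i1 i2) e1 e2.
under [in RHS]eq_integral do rewrite mulrBr EFinB.
rewrite (integralB mO j1 j2); apply/esym/muleBr => //.
by apply: fin_num_adde_defl; rewrite fin_numN; exact: integrable_fin_num.
Qed.

End WeakDerivatives.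

(** * Derivatives of the cut-off and of its product with f *)

Section Cutoff.
Context {R : realType} {d : nat} (eta : R -> R) (O : set 'rV[R]_d.+1)
  (v : 'rV[R]_d.+1 -> R) (m n : nat).
Notation T := 'rV[R]_d.+1.
Hypotheses (etaP : cutoff_eta eta) (oO : open O) (cv : Ck O m v) (n1 : (1 <= n)%N).
Hypothesis bv : forall a : mindex d.+1, (0 < mabs a <= m)%N ->
  exists C : R, 0 < C /\ forall x, (Mset O v n `\` Mset O v (2 * n)) x ->
    `|dpartialn a v x| <= C.
Implicit Types (a b : mindex d.+1).

Let A := Mset O v n `\` Mset O v (2 * n).
Let AO : A `<=` O. Proof. by move=> x [[]]. Qed.
Let s0 := @sub0set _ O.
Let n0 : (0 : R) < n%:R. Proof. by rewrite ltr0n. Qed.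

Let cvA : ckb O A m v.
Proof.
apply: Ck_ckb => // a am; have [/mabs_eq0 ->|a0] := posnP (mabs a).
  (* The hypothesis starts at order 1; at order 0 the definition of [Mset O v n] gives the bound. *)
  by exists n%:R^-1 => x [[]]; rewrite dpartialn0.
by have [|C [_ CP]] := bv (a := a); [rewrite a0|exists C].
Qed.

Let cv0 : ckb O set0 m v. Proof. exact: ckb_sub cvA. Qed.

(** On [O], [A] is the set where [1/2 < |n v| <= 1]; off it all derivatives of [eta] of positive
    order vanish at [n v], so the bounds on [A] suffice. *)
Lemma chi_bounded : ckb O O m (chi eta v n).
Proof.
have cu : ckb O A m (fun x => n%:R * v x) by apply: ckbM => //; exact: ckb_cst.
apply: (@ckb_comp_bounded _ _ (fun j => derive1n j eta) _ O A m) => //.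
- by move=> j t; exact: is_derive_eta.
- move=> l; have [C [_ CP]] := eta_bounded etaP l; exists C => x [[_ h] _].
  by apply: CP; rewrite normrM normr_nat mulrC -ler_pdivlMr // mul1r.
- move=> l x Ox nA; have [h|h] := ltrP n%:R^-1 `|v x|.
    by apply: eta_outer => //; rewrite normrM normr_nat mulrC -ltr_pdivrMr // mul1r.
  apply: eta_inner => //; apply: contrapT => /negP; rewrite -ltNge => h'; apply: nA.
  split; first by split.
  move=> [_]; apply/negP; rewrite -ltNge natrM invfM mulrC.
  by rewrite ltr_pdivrMl // -[n%:R](@normr_nat R) -normrM.
- exists 1 => x _; have [_ [e1 _]] := etaP.
  by have /andP[h1 h2] := e1 (n%:R * v x); rewrite ger0_norm.
Qed.

Let cchi : ckb O set0 m (chi eta v n). Proof. exact: ckb_sub chi_bounded. Qed.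

(** [Oin] and [Oout] are open and cover [O]: on the first [chi] is 0, on the second division by [v]
    is regular. *)
Let Oin := O `&` v @^-1` [set t | `|t| < (2 * n)%:R^-1].
Let Oout := O `&` v @^-1` [set t | t != 0].

Lemma open_preimage (B : set R) : open B -> open (O `&` v @^-1` B).
Proof.
move=> oB; rewrite openE => x [Ox Bx]; apply: filterI; first exact: open_nbhs_nbhs.
have vx := ckb_continuous cv0 Ox.
have : nbhs (v x) B by exact: open_nbhs_nbhs.
by move=> /vx.
Qed.

Let oOin : open Oin.
Proof.
apply: open_preimage.
apply: (@open_comp _ _ (Num.norm : R -> R) [set s | s < (2 * n)%:R^-1]); last exact: open_lt.
by move=> s _; exact: norm_continuous.
Qed.

Let oOout : open Oout. Proof. by apply: open_preimage; exact: open_neq. Qed.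

Let OinOout : Oin `|` Oout = O.
Proof.
apply/seteqP; split => [x [[]//|[]//]|x Ox].
have [v0|v0] := eqVneq (v x) 0; last by right.
left; split => //=; rewrite v0 normr0 invr_gt0 ltr0n.
by rewrite muln_gt0 n1.
Qed.

Lemma chi_vanish a x : Oin x -> dpartialn a (chi eta v n) x = 0.
Proof.
move=> Ox; rewrite (@eq_dpartialn _ _ Oin a _ (fun=> 0)) //.
  have [/mabs_eq0 ->|a0] := posnP (mabs a); first by rewrite dpartialn0.
  exact: (dpartialn_cst (O := Oin)).
move=> y [Oy /= vy]; rewrite /chi; have [_ [_ [_ e2]]] := etaP; apply: e2.
rewrite normrM normr_nat mulrC -ler_pdivlMr //; apply: ltW.
by move: vy; rewrite natrM invfM.
Qed.

Let inv_v k j : (j <= m)%N -> ckb Oout set0 j (fun x => (v x)^-1 ^+ k).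
Proof.
move=> jm; have s := @sub0set _ Oout.
have co : ckb Oout set0 j v by apply: ckb_sub (ckb_le jm cv0) => // x [].
by apply: ckbX => //; apply: ckbV => // x [].
Qed.

(* Division by powers of [v] is harmless next to derivatives of [chi], which
   vanish where [v] is small. *)
Lemma ckb_quotient a k j : (mabs a + j <= m)%N ->
  ckb O set0 j (fun x => (v x)^-1 ^+ k * dpartialn a (chi eta v n) x).
Proof.
move=> aj; rewrite -[X in ckb X]OinOout; apply: ckbU.
  apply: eq_ckb (ckb_cst j 0 oOin _) => // x Ox.
  by rewrite chi_vanish // mulr0.
have c1 : ckb Oout set0 j (dpartialn a (chi eta v n)).
  apply: ckb_sub (ckb_dpartialn (k := j) (ckb_le aj cchi)) => // x [] //.
by apply: ckbM => //; apply: inv_v; apply: leq_trans aj; rewrite leq_addl.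
Qed.

(** True also at the zeros of [v], where the derivative of [chi] vanishes. *)
Lemma quotientK a k x : O x ->
  v x ^+ k.+1 * ((v x)^-1 ^+ k.+1 * dpartialn a (chi eta v n) x) = dpartialn a (chi eta v n) x.
Proof.
rewrite -[in X in X -> _]OinOout => -[Ox|[Ox /= vx]]; first by rewrite chi_vanish // !mulr0.
by rewrite mulrA -exprMn mulfV // expr1n mul1r.
Qed.

Lemma chi_weight_bound a (t : R) : (mabs a <= m)%N -> 0 <= t -> exists C : R, 0 <= C /\
  forall x, O x -> `|dpartialn a (chi eta v n) x| <= C * `|v x| `^ t.
Proof.
move=> am t0.
have [B BP] : exists B : R, forall x, O x -> `|dpartialn a (chi eta v n) x| <= B.
  apply: (@ckb_bounded _ _ O O 0); apply: ckb_dpartialn; rewrite addn0.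
  exact: ckb_le chi_bounded.
pose r : R := (2 * n)%:R^-1.
have r0 : 0 < r by rewrite invr_gt0 ltr0n muln_gt0.
have rt : 0 < r `^ t by exact: powR_gt0.
exists (`|B| / r `^ t); split; first by rewrite divr_ge0 // ltW.
move=> x Ox; have [h|h] := ltrP `|v x| r.
  by rewrite chi_vanish // normr0 mulr_ge0 ?powR_ge0 // divr_ge0 // ltW.
apply: le_trans (BP x Ox) _; apply: le_trans (ler_norm B) _.
rewrite mulrAC ler_pdivlMr // ler_wpM2l //.
by apply: ge0_ler_powR; rewrite ?nnegrE // ltW.
Qed.

Section CutoffDerivative.
Variables (f : T -> R) (G : mindex d.+1 -> T -> R) (a : mindex d.+1).
Hypotheses (am : (mabs a <= m)%N) (fL : inL1loc O v f)
  (GW : forall b, mle b a -> is_weak_vderiv O v b f (G b)).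

(** [G] is any family of weak derivatives, since two different choices will be used: those in the
    weighted spaces and those selected by [Dv]. *)
Let ga x := lsum (mabs a) a (fun b => G b x * dpartialn (msub a b) (chi eta v n) x).

Lemma inL1loc_cutoff b : mle b a ->
  inL1loc O (fun x => v x ^+ (mabs b).+1) (G b).
Proof. by move=> /GW []. Qed.

(** Only [G b] times a power of [v] is locally integrable; the power is borrowed from the quotient
    of the derivative of [chi], which is continuous and hence bounded on [K]. *)
Let term_integrable b K : mle b a -> compact K -> K `<=` O ->
  leb.-integrable K (EFin \o (fun x => G b x * dpartialn (msub a b) (chi eta v n) x)).
Proof.
move=> ba cK KO; have mK := measurable_compactrV cK.
have cq : ckb O set0 0 (fun x => (v x)^-1 ^+ (mabs b).+1 * dpartialn (msub a b) (chi eta v n) x).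
  by apply: ckb_quotient; rewrite addn0; apply: leq_trans am; exact: mle_msub.
have [C [C0 CP]] := continuous_bounded cK (fun x Kx => ckb_continuous cq (KO x Kx)).
have gI := inL1loc_integrable (inL1loc_cutoff ba) cK KO.
have E x : O x -> G b x * dpartialn (msub a b) (chi eta v n) x = (G b x * v x ^+ (mabs b).+1) *
    ((v x)^-1 ^+ (mabs b).+1 * dpartialn (msub a b) (chi eta v n) x).
  by move=> Ox; rewrite -[in LHS](quotientK (msub a b) (mabs b) Ox) mulrA.
apply: (le_integrable mK) (integrableZl mK C gI).
  apply/measurable_EFinP.
  have := measurable_funM (inL1loc_measurable oO (inL1loc_cutoff ba))
    (continuous_measurable oO (fun x Ox => ckb_continuous cq Ox)).
  move=> mm; apply: (measurable_funS (measurable_openrV oO) KO).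
  by apply: eq_measurable_fun mm => x; rewrite inE => Ox; rewrite E.
move=> x Kx /=; rewrite lee_fin E; last exact: KO.
rewrite [X in _ <= X]normrM (ger0_norm C0) [X in X <= _]normrM [X in X <= _]mulrC.
by rewrite ler_wpM2r // CP.
Qed.

Lemma inL1loc_cutoff_derivative (k : nat) : inL1loc O (fun x => rv_one x ^+ k) ga.
Proof.
apply: integrable_inL1loc => K cK KO; have mK := measurable_compactrV cK.
have iS : leb.-integrable K (fun x => (\sum_(b : {ffun 'I_d.+1 -> 'I_(mabs a).+1})
    ((mbinom a (fun i => val (b i)))%:R *
     (G (fun i => val (b i)) x * dpartialn (msub a (fun i => val (b i))) (chi eta v n) x))%:E)%E).
  apply: integrable_sum => // b _.
  set b' : mindex d.+1 := (fun i : 'I_d.+1 => val (b i)).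
  have [ba|nba] := pselect (mle b' a).
    by have := integrableZl mK (mbinom a b')%:R (term_integrable ba cK KO).
  rewrite mbinom_eq0 //; under eq_fun do rewrite mul0r; exact: integrable0.
apply: eq_integrable iS => // x _ /=.
by rewrite /rv_one expr1n mulr1 /ga /lsum sumEFin.
Qed.

Lemma is_weak_vderiv_cutoff : is_weak_vderiv O rv_one a (fun x => chi eta v n x * f x) ga.
Proof.
split; first exact: inL1loc_cutoff_derivative.
have mO : measurable O by exact: measurable_openrV.
move=> phi tphi; have [sphi [cK KO]] := tphi.
set K := closure _ in cK KO.
have phiK x : ~ K x -> phi x = 0.
  move=> nK; apply: contrapT => /eqP p0; apply: nK; exact: subset_closure.
have cphi k : ckb setT set0 k phi by apply: Ck_ckb0; [exact: openT|exact: sphi].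
have cphiO k : ckb O set0 k phi by exact: ckb_sub (cphi k).
have clK : closed K by exact: closed_closure.
pose psi b x := (v x)^-1 ^+ (mabs b).+1 * dpartialn (msub a b) (chi eta v n) x * phi x.
have psiK b x : ~ K x -> psi b x = 0 by move=> nK; rewrite /psi phiK // mulr0.
(* Regularity on the whole space: [O] and the complement of [K] cover it, and [psi b] is 0 off
   [K]. *)
have cpsi b : mle b a -> ckb setT set0 (mabs b) (psi b).
  move=> ba; rewrite (_ : setT = O `|` ~` K); last first.
    apply/seteqP; split => // x _; have [Kx|nKx] := pselect (K x); [left; exact: KO|by right].
  apply: ckbU.
    by apply: ckbM => //; apply: ckb_quotient; rewrite mabs_msub.
  have oK : open (~` K) by exact: closed_openC.
  by apply: eq_ckb (ckb_cst (mabs b) 0 oK _) => // x nK; rewrite psiK.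
have psiE b x : O x -> v x ^+ (mabs b).+1 * psi b x = phi x * dpartialn (msub a b) (chi eta v n) x.
  by move=> Ox; rewrite /psi mulrA quotientK // mulrC.
have P b : mle b a -> [/\ leb.-integrable O (EFin \o (fun x => f x * dpartialn b
      (fun y => phi y * dpartialn (msub a b) (chi eta v n) y) x)),
    leb.-integrable O (EFin \o (fun x => phi x * (G b x * dpartialn (msub a b) (chi eta v n) x))) &
    (\int[leb]_(x in O) (f x * dpartialn b (fun y => phi y * dpartialn (msub a b) (chi eta v n) y) x)%:E
    = ((-1) ^+ mabs b)%:E * \int[leb]_(x in O) (phi x * (G b x * dpartialn (msub a b) (chi eta v n) x))%:E)%E].
  move=> ba; have bm : (mabs b <= m)%N by apply: leq_trans am; exact: mle_mabs.
  have [i1 i2 e] := weak_vderiv_ext etaP oO (ckb_le bm cv0) fL (GW ba) cK KO (psiK b) (cpsi b ba).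
  have E1 x : O x -> f x * dpartialn b (fun y => v y ^+ (mabs b).+1 * psi b y) x =
     f x * dpartialn b (fun y => phi y * dpartialn (msub a b) (chi eta v n) y) x.
    by move=> Ox; congr (_ * _); apply: eq_dpartialn Ox => // y Oy; rewrite psiE.
  have E2 x : O x -> v x ^+ (mabs b).+1 * psi b x * G b x =
     phi x * (G b x * dpartialn (msub a b) (chi eta v n) x).
    by move=> Ox; rewrite psiE //; ring.
  split.
  - by apply: eq_integrable i1 => // x; rewrite inE => Ox /=; rewrite E1.
  - by apply: eq_integrable i2 => // x; rewrite inE => Ox /=; rewrite E2.
  - have <- : (\int[leb]_(x in O) (f x * dpartialn b (fun y => v y ^+ (mabs b).+1 * psi b y) x)%:E =
      \int[leb]_(x in O) (f x * dpartialn b (fun y => phi y * dpartialn (msub a b) (chi eta v n) y) x)%:E)%E.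
      by apply: eq_integral => x; rewrite inE => Ox; rewrite E1.
    rewrite e; congr (_ * _)%E.
    by apply: eq_integral => x; rewrite inE => Ox; rewrite E2.
pose I := {ffun 'I_d.+1 -> 'I_(mabs a).+1}.
pose c (b : I) : mindex d.+1 := fun i => val (b i).
pose tl (b : I) x := (mbinom a (c b))%:R * ((-1) ^+ mabs (msub a (c b)) *
  (f x * dpartialn (c b) (fun y => phi y * dpartialn (msub a (c b)) (chi eta v n) y) x)).
pose tr (b : I) x := (mbinom a (c b))%:R * (phi x * (G (c b) x * dpartialn (msub a (c b)) (chi eta v n) x)).
(* If [b] is not below [a], the binomial kills both terms; otherwise the signs combine through
   [|a - b| + |b| = |a|]. *)
have Q (b : I) : [/\ leb.-integrable O (EFin \o tl b), leb.-integrable O (EFin \o tr b) &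
   (\int[leb]_(x in O) (tl b x)%:E = ((-1) ^+ mabs a)%:E * \int[leb]_(x in O) (tr b x)%:E)%E].
  rewrite /tl /tr; have [ba|nba] := pselect (mle (c b) a); last first.
    rewrite mbinom_eq0 //.
    have Z (F : T -> R) : leb.-integrable O (EFin \o (fun x => 0%:R * F x)).
      rewrite (_ : EFin \o _ = cst 0%E); first exact: integrable0.
      by apply/funext => x /=; rewrite mul0r.
    split; [exact: Z|exact: Z|].
    by rewrite !integral0_eq ?mule0 // => x _; rewrite mul0r.
  have [i1 i2 e] := P _ ba.
  split.
  - by have := integrableZl mO (mbinom a (c b))%:R (integrableZl mO ((-1) ^+ mabs (msub a (c b))) i1).
  - by have := integrableZl mO (mbinom a (c b))%:R i2.
  - rewrite (integralZl mO (integrableZl mO ((-1) ^+ mabs (msub a (c b))) i1)).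
    rewrite (integralZl mO i1) (integralZl mO i2) [X in (_ * (_ * X))%E]e.
    by rewrite !muleA -!EFinM -mulrA -exprD mabs_msub // [_%:R * _]mulrC.
have EL : (\int[leb]_(x in O) (chi eta v n x * f x *
     dpartialn a (fun y => rv_one y ^+ (mabs a).+1 * phi y) x)%:E =
   \int[leb]_(x in O) (\sum_(b <- index_enum I) (tl b x)%:E))%E.
  apply: eq_integral => x; rewrite inE => Ox.
  rewrite (_ : (fun y => _) = phi); last first.
    by apply/funext => y; rewrite /rv_one expr1n mul1r.
  rewrite sumEFin mulrAC (@mul_dpartialn _ _ O (mabs a)) //; last exact: ckb_le cchi.
  rewrite /lsum mulr_suml; congr EFin; apply: eq_bigr => b _.
  by rewrite /tl; ring.
rewrite EL integral_sum //; last by move=> b; have [] := Q b.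
have ER : (((-1) ^+ mabs a)%:E * \int[leb]_(x in O) (rv_one x ^+ (mabs a).+1 * phi x * ga x)%:E =
   \int[leb]_(x in O) (\sum_(b <- index_enum I) (((-1) ^+ mabs a)%:E * (tr b x)%:E)))%E.
  rewrite -integralZl //; last first.
    have iS : leb.-integrable O (fun x => (\sum_(b : I) (tr b x)%:E)%E).
      by apply: integrable_sum => // b _; have [] := Q b.
    apply: eq_integrable iS => //.
    move=> x _ /=; rewrite sumEFin /rv_one expr1n mul1r /ga /lsum mulr_sumr.
    by congr EFin; apply: eq_bigr => b _; rewrite /tr; ring.
  apply: eq_integral => x _.
  under [in RHS]eq_bigr do rewrite -EFinM; rewrite sumEFin -EFinM; congr EFin.
  rewrite -mulr_sumr; congr (_ * _).
  rewrite /rv_one expr1n mul1r /ga /lsum mulr_sumr.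
  by apply: eq_bigr => b _; rewrite /tr; ring.
rewrite ER integral_sum //; last by move=> b; apply: integrableZl => //; have [] := Q b.
by apply: eq_bigr => b _; have [i1 i2 ->] := Q b; rewrite integralZl.
Qed.

End CutoffDerivative.
End Cutoff.

(** * Powers of sums and the case of dimension 0 *)

Section PowerSums.
Context {R : realType}.

(** Each term is at most the largest one, and the power of the largest is one of the terms on the
    right. *)
Lemma sum_powR (I : finType) (z : I -> R) (p : R) : 1 <= p -> (forall i, 0 <= z i) ->
  (\sum_i z i) `^ p <= #|I|%:R `^ p * \sum_i z i `^ p.
Proof.
move=> p1 z0; have p0 : 0 <= p by exact: le_trans p1.
have [/eqP I0|] := posnP #|I|.
  rewrite !big_pred0 ?mulr0 ?powR0 ?(gt_eqF (lt_le_trans ltr01 p1)) // => i;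
  by have := fintype0 i; rewrite (eqP I0).
move=> /card_gt0P [i0 _].
have [j _ jmax] := @arg_maxP _ _ _ i0 xpredT z isT.
have H : \sum_i z i <= #|I|%:R * z j.
  apply: (@le_trans _ _ (\sum_(i : I) z j)); first by apply: ler_sum => i _; exact: jmax.
  by rewrite sumr_const mulr_natl.
have s0 : 0 <= \sum_i z i by apply: sumr_ge0.
apply: (@le_trans _ _ ((#|I|%:R * z j) `^ p)).
  by apply: ge0_ler_powR; rewrite ?nnegrE // mulr_ge0.
rewrite powRM // ler_wpM2l ?powR_ge0 // (bigD1 j) //= lerDl.
by apply: sumr_ge0 => i _; exact: powR_ge0.
Qed.

Lemma leb_dim0 (A : set 'rV[R]_0) : leb A != 0%E.
Proof.
apply/eqP => A0; have : (1 <= leb A)%E; last by rewrite A0 leNgt lte01.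
apply: le_ereal_inf_tmp => r [a [b [_ ->]]].
have r1 k : rvol (a k) (b k) = 1 by rewrite /rvol big_ord0.
have r0 k : xpredT k -> (0 <= (rvol (a k) (b k))%:E)%E by rewrite r1 lee_fin ler01.
by have := @nneseries_lim_ge R _ xpredT 0 1 (fun k _ => @r0 k); rewrite big_nat1 r1.
Qed.

End PowerSums.

(** * Measurability and local integrability with weights *)

Section Estimates.
Context {R : realType} {d : nat} (O : set 'rV[R]_d.+1).
Notation T := 'rV[R]_d.+1.
Hypothesis oO : open O.
Implicit Types (v f g : T -> R).

(** A weak derivative is known to be measurable only after multiplication by a power of [v]. The
    power is corrected by the exponent [t - (k + 1)]; at zeros of [v] both sides are 0 because
    [t > 0]. *)
Lemma measurable_weighted v g k (t : R) : 0 < t -> measurable_fun O v ->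
  measurable_fun O (fun x => g x * v x ^+ k.+1) ->
  measurable_fun O (fun x => `|g x * `|v x| `^ t|).
Proof.
move=> t0 mv mg.
have : measurable_fun O (fun x => `|g x * v x ^+ k.+1| * `|v x| `^ (t - k.+1%:R)).
  apply: measurable_funM; first exact: measurableT_comp.
  by apply: (measurableT_comp (measurable_powR _)); exact: measurableT_comp.
apply: eq_measurable_fun => x _.
have [v0|v0] := eqVneq (v x) 0.
  by rewrite v0 expr0n /= mulr0 normr0 mul0r powR0 ?mulr0 ?normr0 // gt_eqF.
rewrite !normrM normrX (ger0_norm (powR_ge0 _ _)) -mulrA; congr (_ * _).
rewrite -powR_mulrn // -powRD; first by rewrite addrC subrK.
by rewrite normr_eq0 v0 implybT.
Qed.

(** A nonnegative number is at most 1 plus its power [p], and compact sets have finite measure. *)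
Lemma inLp_inL1loc v f (p : R) : 1 <= p -> (forall x, O x -> {for x, continuous v}) ->
  inLp O p (fun x => `|v x|) f -> inL1loc O v f.
Proof.
move=> p1 cv [mf If] K cK KO.
have mO : measurable O by exact: measurable_openrV.
have mK : measurable K by exact: measurable_compactrV.
have mv := continuous_measurable oO cv.
(* The sign of [v] is restored by the measurable factor [sg v]. *)
have mfv : measurable_fun O (fun x => f x * v x).
  apply: eq_measurable_fun (measurable_funM mf (measurable_sg mv)) => x _.
  by rewrite /= -mulrA [`|_| * _]mulrC -numEsg.
split; first exact: measurable_funS mfv.
have mfp : measurable_fun O (fun x => `|f x * `|v x| | `^ p).
  by apply: (measurableT_comp (measurable_powR _)); exact: measurableT_comp.
apply: (@le_lt_trans _ _ (\int[leb]_(x in K) (1 + (`|f x * `|v x| | `^ p)%:E))%E).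
  apply: ge0_le_integral => //.
  - by apply/measurable_EFinP; apply: measurableT_comp => //; exact: measurable_funS mfv.
  - apply: emeasurable_funD; first exact: measurable_cst.
    by apply/measurable_EFinP; exact: measurable_funS mfp.
  - move=> x _; rewrite -EFinD lee_fin.
    have -> : `|f x * v x| = `|f x * `|v x| | by rewrite !normrM normr_id.
    have [h|h] := lerP `|f x * `|v x| | 1.
      by apply: le_trans h _; rewrite lerDl powR_ge0.
    apply: (@le_trans _ _ (`|f x * `|v x| | `^ p)); last by rewrite lerDr.
    by rewrite -[X in X <= _]powRr1 // ler_powR // ltW.
have mfpK : measurable_fun K (fun x => (`|f x * `|v x| | `^ p)%:E).
  by apply/measurable_EFinP; exact: measurable_funS mfp.
have fp0 x : K x -> (0 <= (`|f x * `|v x| | `^ p)%:E)%E by move=> _; rewrite lee_fin powR_ge0.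
rewrite ge0_integralD //.
apply: lte_add_pinfty.
  by rewrite integral_cst // mul1e; exact: leb_compact_fin.
apply: le_lt_trans If; apply: ge0_subset_integral => //.
exact/measurable_EFinP.
Qed.

End Estimates.

(** * The multiplication by the cut-off *)

Section CutoffEstimate.
Context {R : realType} {d : nat} (eta : R -> R) (O : set 'rV[R]_d.+1) (p : R)
  (v : 'rV[R]_d.+1 -> R) (s : mindex d.+1 -> R) (m n : nat).
Notation T := 'rV[R]_d.+1.
Hypotheses (p1 : 1 <= p) (etaP : cutoff_eta eta) (oO : open O) (cv : Ck O m v) (n1 : (1 <= n)%N).
Hypothesis sP : admissible m s.
Hypothesis bv : forall a : mindex d.+1, (0 < mabs a <= m)%N ->
  exists C : R, 0 < C /\ forall x, (Mset O v n `\` Mset O v (2 * n)) x ->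
    `|dpartialn a v x| <= C.

Let p0 : 0 < p. Proof. exact: lt_le_trans ltr01 p1. Qed.
Let mO : measurable O. Proof. exact: measurable_openrV. Qed.

Definition cutoff_derivative (G : mindex d.+1 -> T -> R) (a : mindex d.+1) (x : T) : R :=
  lsum (mabs a) a (fun b => G b x * dpartialn (msub a b) (chi eta v n) x).

Lemma cutoff_pointwise (a : mindex d.+1) : (mabs a <= m)%N ->
  exists2 D : R, 0 <= D & forall (G : mindex d.+1 -> T -> R) x, O x ->
    `|cutoff_derivative G a x| `^ p <= D *
    \sum_(b : {ffun 'I_d.+1 -> 'I_(mabs a).+1} | `[< mle (fun i => val (b i)) a >])
       `|G (fun i => val (b i)) x * sweights s v (fun i => val (b i)) x| `^ p.
Proof.
move=> am.
have /boolp.choice [C CP] : forall b : mindex d.+1, exists C : R, 0 <= C /\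
    (mle b a -> forall x, O x ->
      `|dpartialn (msub a b) (chi eta v n) x| <= C * sweights s v b x).
  move=> b; have [ba|nba] := pselect (mle b a); last by exists 0.
  have bm : (mabs b <= m)%N by apply: leq_trans am; exact: mle_mabs.
  have [s0 _] := sP bm.
  have abm : (mabs (msub a b) <= m)%N by apply: leq_trans am; exact: mle_msub.
  have [|C [C0 CP]] := @chi_weight_bound _ _ _ _ _ _ _ etaP oO cv n1 bv (msub a b) (s b + 1) abm.
    by rewrite addr_ge0.
  by exists C; split.
pose I := {ffun 'I_d.+1 -> 'I_(mabs a).+1}.
pose c (b : I) : mindex d.+1 := fun i => val (b i).
pose k (b : I) : R := (mbinom a (c b))%:R * C (c b).
have k0 b : 0 <= k b by rewrite /k mulr_ge0 //; have [] := CP (c b).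
pose D : R := \sum_b k b.
have D0 : 0 <= D by apply: sumr_ge0.
exists (#|{: I}|%:R `^ p * D `^ p) => [|G x Ox]; first by rewrite mulr_ge0 // powR_ge0.
(* The sum [D] of all constants replaces each of them, so that one factor can be pulled out of the
   sum. *)
pose z (b : I) : R := if `[< mle (c b) a >] then D * `|G (c b) x * sweights s v (c b) x| else 0.
have z0 b : 0 <= z b by rewrite /z; case: asboolP => // _; rewrite mulr_ge0.
apply: (@le_trans _ _ ((\sum_b z b) `^ p)).
  apply: ge0_ler_powR; rewrite ?nnegrE //; [exact: ltW|exact: sumr_ge0|].
  apply: le_trans (ler_norm_sum _ _ _) _; apply: ler_sum => b _; rewrite -/(c b) /z.
  case: asboolP => [ba|nba]; last by rewrite mbinom_eq0 // mul0r normr0.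
  rewrite !normrM normr_nat.
  have [C0 /(_ ba x Ox) H] := CP (c b).
  have w0 : 0 <= sweights s v (c b) x by exact: powR_ge0.
  rewrite (ger0_norm w0).
  apply: (@le_trans _ _ (k b * (`|G (c b) x| * sweights s v (c b) x))).
    rewrite /k -mulrA; apply: ler_wpM2l => //.
    by rewrite mulrCA; apply: ler_wpM2l.
  apply: ler_wpM2r; first by rewrite mulr_ge0.
  by rewrite /D (bigD1 b) //= lerDl; apply: sumr_ge0.
apply: le_trans (sum_powR p1 z0) _; rewrite -mulrA; apply: ler_wpM2l; first exact: powR_ge0.
rewrite [X in _ <= _ * X]big_mkcond mulr_sumr; apply: ler_sum => b _; rewrite /z -/(c b).
case: asboolP => _; first by rewrite powRM.
by rewrite mulr0 powR0 // gt_eqF.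
Qed.

Local Open Scope ereal_scope.

Lemma cutoff_integral (a : mindex d.+1) : (mabs a <= m)%N ->
  exists2 D : R, (0 <= D)%R & forall (G : mindex d.+1 -> T -> R),
    (forall b, mle b a -> measurable_fun O (fun x => `|G b x * sweights s v b x|%R)) ->
    measurable_fun O (cutoff_derivative G a) ->
    \int[leb]_(x in O) (`|cutoff_derivative G a x| `^ p)%:E <= D%:E *
    \sum_(b : {ffun 'I_d.+1 -> 'I_(mabs a).+1} | `[< mle (fun i => val (b i)) a >])
       \int[leb]_(x in O) (`|G (fun i => val (b i)) x * sweights s v (fun i => val (b i)) x| `^ p)%:E.
Proof.
move=> am; have [D D0 DP] := cutoff_pointwise am; exists D => // G mG mg.
pose I := {ffun 'I_d.+1 -> 'I_(mabs a).+1}.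
pose c (b : I) : mindex d.+1 := fun i => val (b i).
pose F (b : I) (x : T) : \bar R := if `[< mle (c b) a >] then
  (`|G (c b) x * sweights s v (c b) x| `^ p)%:E else 0.
have F0 b x : O x -> 0 <= F b x by move=> _; rewrite /F; case: asboolP => // _; rewrite lee_fin powR_ge0.
have mF b : measurable_fun O (F b).
  rewrite /F; case: asboolP => ba; last exact: measurable_cst.
  by apply/measurable_EFinP; apply: (measurableT_comp (measurable_powR _)); exact: mG.
have -> : \sum_(b : I | `[< mle (c b) a >])
    \int[leb]_(x in O) (`|G (c b) x * sweights s v (c b) x| `^ p)%:E =
    \sum_(b : I) \int[leb]_(x in O) F b x.
  rewrite big_mkcond; apply: eq_bigr => b _; rewrite /F.
  by case: asboolP => // _; rewrite integral0.
rewrite -ge0_integral_sum // -ge0_integralZl //; last 2 first.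
- by apply: emeasurable_sum => b; exact: mF.
- by move=> x Ox; apply: sume_ge0 => b _; exact: F0.
apply: ge0_le_integral => //.
- by apply/measurable_EFinP; apply: (measurableT_comp (measurable_powR _)); exact: measurableT_comp.
- by apply: measurable_funeM; apply: emeasurable_sum => b; exact: mF.
move=> x Ox; have := DP G x Ox; rewrite -lee_fin => /le_trans; apply.
rewrite EFinM; apply: lee_wpmul2l; first by rewrite lee_fin.
rewrite big_mkcond -sumEFin; apply: lee_sum => b _; rewrite /F -/(c b).
by case: asboolP.
Qed.

End CutoffEstimate.

(** * Membership and continuity in the Sobolev norms *)

Section WeightedSobolev.
Context {R : realType} {d : nat} (eta : R -> R) (O : set 'rV[R]_d.+1) (p : R)
  (v : 'rV[R]_d.+1 -> R) (s : mindex d.+1 -> R) (m n : nat).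
Notation T := 'rV[R]_d.+1.
Hypotheses (p1 : 1 <= p) (etaP : cutoff_eta eta) (oO : open O) (cv : Ck O m v) (n1 : (1 <= n)%N).
Hypothesis sP : admissible m s.
Hypothesis bv : forall a : mindex d.+1, (0 < mabs a <= m)%N ->
  exists C : R, 0 < C /\ forall x, (Mset O v n `\` Mset O v (2 * n)) x ->
    `|dpartialn a v x| <= C.
Implicit Types (f g : T -> R) (a b : mindex d.+1).

Let p0 : 0 < p. Proof. exact: lt_le_trans ltr01 p1. Qed.
Let mO : measurable O. Proof. exact: measurable_openrV. Qed.
Let cv0 : ckb O set0 m v. Proof. exact: Ck_ckb0. Qed.
Let vc x : O x -> {for x, continuous v}. Proof. by move=> Ox; exact (ckb_continuous cv0 Ox). Qed.

Lemma mabs_mzero : mabs (@Defs.mzero d.+1) = 0%N.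
Proof. by rewrite /mabs big1. Qed.

(** Admissibility forces [s] to be 0 at the zero index. Hence [f v] is locally integrable for [f] in
    the weighted space. *)
Lemma sweights_mzero : sweights s v (@Defs.mzero d.+1) = (fun x => `|v x|).
Proof.
have [|s0 [s1 _]] := sP (a := @Defs.mzero d.+1); first by rewrite mabs_mzero.
have E : s (@Defs.mzero d.+1) = 0.
  by apply/eqP; rewrite eq_le s0 andbT; move: s1; rewrite mabs_mzero.
by apply/funext => x; rewrite /sweights E add0r powRr1.
Qed.

Lemma inW_inL1loc f : inW O m p (sweights s v) v f -> inL1loc O v f.
Proof. by move=> [+ _]; rewrite sweights_mzero => H; exact (inLp_inL1loc oO p1 (fun x Ox => @vc x Ox) H). Qed.

Lemma Dv_spec f b : inL1loc O v f ->
  ((0 < mabs b)%N -> exists g, is_weak_vderiv O v b f g) ->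
  is_weak_vderiv O v b f (Dv O v b f).
Proof.
move=> fL H; rewrite /Dv; case: eqP => [/mabs_eq0 ->|/eqP b0]; first exact: is_weak_vderiv0.
by apply: epsilon_spec; apply: H; rewrite lt0n.
Qed.

Lemma inW_Dv f b : inW O m p (sweights s v) v f -> (mabs b <= m)%N ->
  is_weak_vderiv O v b f (Dv O v b f).
Proof.
move=> fW bm; apply: Dv_spec; first exact: inW_inL1loc.
move=> b0; have [|g [gW _]] := fW.2 b; first by rewrite b0.
by exists g.
Qed.

Lemma measurable_weak_vderiv b f g : (mabs b <= m)%N -> is_weak_vderiv O v b f g ->
  measurable_fun O (fun x => `|g x * sweights s v b x|).
Proof.
move=> bm [gL _]; apply: (measurable_weighted (k := mabs b)) => //.
- by have [s0 _] := sP bm; rewrite ltr_wpDl.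
- exact: continuous_measurable.
- exact: inL1loc_measurable gL.
Qed.

Lemma rv_oneX k (x : T) : rv_one x ^+ k = 1 :> R.
Proof. by rewrite /rv_one expr1n. Qed.

Lemma measurable_cutoff_derivative f (G : mindex d.+1 -> T -> R) a : (mabs a <= m)%N ->
  inL1loc O v f -> (forall b, mle b a -> is_weak_vderiv O v b f (G b)) ->
  measurable_fun O (cutoff_derivative eta v n G a).
Proof.
move=> am fL GW.
have := inL1loc_measurable oO (@inL1loc_cutoff_derivative _ _ _ _ _ _ _ etaP oO cv n1 bv f G a am GW 1).
by apply: eq_measurable_fun => x _; rewrite rv_oneX mulr1.
Qed.

Lemma cutoff_derivative0 f (G : mindex d.+1 -> T -> R) : G (@Defs.mzero d.+1) = f ->
  cutoff_derivative eta v n G (@Defs.mzero d.+1) = (fun x => chi eta v n x * f x).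
Proof.
move=> Gf; apply/funext => x; rewrite /cutoff_derivative lsum0 Gf mulrC.
by rewrite (_ : msub _ _ = @Defs.mzero d.+1) // dpartialn0.
Qed.

Lemma cutoff_is_weak_vderiv f (G : mindex d.+1 -> T -> R) a : (mabs a <= m)%N ->
  inL1loc O v f -> (forall b, mle b a -> is_weak_vderiv O v b f (G b)) ->
  is_weak_vderiv O rv_one a (fun x => chi eta v n x * f x) (cutoff_derivative eta v n G a).
Proof. by move=> am fL GW; exact: (is_weak_vderiv_cutoff etaP oO cv n1 bv am fL GW). Qed.

Lemma cutoff_inW f : inW O m p (sweights s v) v f ->
  inW O m p rv_one_weights rv_one (fun x => chi eta v n x * f x).
Proof.
move=> fW; have fL := inW_inL1loc fW.
(* The representatives with finite weighted norm are chosen, since [inW] does not state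
   integrability for those selected by [Dv]. *)
have /boolp.choice [G GP] : forall b, exists g, (mabs b = 0%N -> g = f) /\
    ((mabs b <= m)%N -> is_weak_vderiv O v b f g /\ inLp O p (sweights s v b) g).
  move=> b; have [b0|b0] := posnP (mabs b).
    exists f; split => // _; rewrite (mabs_eq0 b0); split; first exact: is_weak_vderiv0.
    exact: fW.1.
  have [bm|bm] := leqP (mabs b) m; last by exists f.
  have [|g gP] := fW.2 b; first by rewrite b0 bm.
  by exists g; split => // b00; rewrite b00 in b0.
have GW a b : (mabs a <= m)%N -> mle b a -> is_weak_vderiv O v b f (G b).
  move=> am ba; have [_] := GP b; case => //.
  by apply: leq_trans am; exact: mle_mabs.
have Lp a : (mabs a <= m)%N -> inLp O p (rv_one_weights a) (cutoff_derivative eta v n G a).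
  move=> am; have mg := measurable_cutoff_derivative am fL (fun b => GW a b am).
  split.
    by apply: eq_measurable_fun mg => x _; rewrite /rv_one_weights mulr1.
  have [D D0 /(_ G) H] := cutoff_integral p1 etaP oO cv n1 sP bv am.
  under eq_integral do rewrite /rv_one_weights mulr1.
  apply: le_lt_trans (H _ mg) _.
    move=> b ba; apply: (measurable_weak_vderiv (f := f)); last exact: GW am ba.
    by apply: leq_trans am; exact: mle_mabs.
  apply: lte_mul_pinfty; rewrite ?lee_fin //.
  apply: lte_sum_pinfty => b /asboolP ba.
  have [_] := GP (fun i => val (b i)); case; first by apply: leq_trans am; exact: mle_mabs.
  by move=> _ [].
split.
  have := Lp (@Defs.mzero d.+1); rewrite (cutoff_derivative0 (f := f)); last first.
    by have [+ _] := GP (@Defs.mzero d.+1); apply; exact: mabs_mzero.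
  by apply; rewrite mabs_mzero.
move=> a /andP[_ am]; exists (cutoff_derivative eta v n G a); split; last exact: Lp.
exact: (cutoff_is_weak_vderiv am fL (fun b => GW a b am)).
Qed.

Local Open Scope ereal_scope.

(** The power [p] of [Wnorm], on which the estimates are additive. *)
Definition Wpow (w : mindex d.+1 -> T -> R) (u f : T -> R) : \bar R :=
  \sum_(a : {ffun 'I_d.+1 -> 'I_m.+1} | (mabs (fun i => nat_of_ord (a i)) <= m)%N)
    \int[leb]_(x in O) ((`|w (fun i => nat_of_ord (a i)) x *
      Dv O u (fun i => nat_of_ord (a i)) f x| `^ p)%R)%:E.

Lemma term_le_Wpow w u f a : (mabs a <= m)%N ->
  \int[leb]_(x in O) ((`|w a x * Dv O u a f x| `^ p)%R)%:E <= Wpow w u f.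
Proof.
move=> am; pose b : {ffun 'I_d.+1 -> 'I_m.+1} := [ffun i => inord (a i)].
have bE : (fun i => nat_of_ord (b i)) = a.
  apply/funext => i; rewrite ffunE inordK // ltnS; apply: leq_trans am.
  exact: leq_mabs.
rewrite /Wpow (bigD1 b) /=; last by rewrite bE.
rewrite bE leeDl //; apply: sume_ge0 => c _; apply: integral_ge0 => x _.
by rewrite lee_fin powR_ge0.
Qed.

(** Formulated with mere existence of weighted derivatives, so that it applies to [g - f]. On the
    right the selected derivatives are used as they are; on the left they are compared with
    [cutoff_derivative] almost everywhere. *)
Lemma cutoff_Wpow : exists2 D : R, (0 <= D)%R & forall f, inL1loc O v f ->
  (forall b, (0 < mabs b <= m)%N -> exists g, is_weak_vderiv O v b f g) ->
  Wpow rv_one_weights rv_one (fun x => chi eta v n x * f x)%R <= D%:E * Wpow (sweights s v) v f.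
Proof.
have /boolp.choice [D DP] : forall a, exists D : R, (0 <= D)%R /\ forall f, inL1loc O v f ->
    (forall b, (0 < mabs b <= m)%N -> exists g, is_weak_vderiv O v b f g) ->
    (mabs a <= m)%N ->
    \int[leb]_(x in O) ((`|rv_one_weights a x *
      Dv O rv_one a (fun x => chi eta v n x * f x) x| `^ p)%R)%:E <=
    D%:E * Wpow (sweights s v) v f.
  move=> a; have [am|am] := leqP (mabs a) m; last by exists 0%R.
  have [D D0 H] := cutoff_integral p1 etaP oO cv n1 sP bv am.
  (* Each integral in the bound is at most all of [Wpow], so the number of indices enters the
     constant. *)
  exists (D * #|{: {ffun 'I_d.+1 -> 'I_(mabs a).+1}}|%:R)%R; split; first by rewrite mulr_ge0.
  move=> f fL fW _; pose G b := Dv O v b f.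
  have GW b : (mabs b <= m)%N -> is_weak_vderiv O v b f (G b).
    by move=> bm; apply: Dv_spec => // b0; apply: fW; rewrite b0.
  have bam b : mle b a -> (mabs b <= m)%N by move=> ba; apply: leq_trans am; exact: mle_mabs.
  have GWa b (ba : mle b a) := GW b (bam b ba).
  have mg := measurable_cutoff_derivative am fL GWa.
  have W := cutoff_is_weak_vderiv am fL GWa.
  have -> : \int[leb]_(x in O) ((`|rv_one_weights a x *
      Dv O rv_one a (fun x => chi eta v n x * f x) x| `^ p)%R)%:E =
      \int[leb]_(x in O) ((`|cutoff_derivative eta v n G a x| `^ p)%R)%:E.
    have [a0|a0] := posnP (mabs a).
      rewrite (mabs_eq0 a0) (cutoff_derivative0 (f := f)) /G /Dv ?mabs_mzero //.
      by apply: eq_integral => x _; rewrite /rv_one_weights mul1r.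
    have W' : is_weak_vderiv O rv_one a (fun x => chi eta v n x * f x)%R
        (Dv O rv_one a (fun x => chi eta v n x * f x)%R).
      rewrite /Dv -(negbK (mabs a == 0%N)) -lt0n a0; apply: epsilon_spec.
      by exists (cutoff_derivative eta v n G a).
    have AE := weak_deriv_ae_unique etaP oO W' W.
    have mD : measurable_fun O (Dv O rv_one a (fun x => chi eta v n x * f x)%R).
      by apply: eq_measurable_fun (inL1loc_measurable oO W'.1) => x _; rewrite rv_oneX mulr1.
    apply: ae_eq_integral => //.
    - apply/measurable_EFinP; apply: (measurableT_comp (measurable_powR _)).
      apply: measurableT_comp => //; apply: eq_measurable_fun mD => x _.
      by rewrite /rv_one_weights mul1r.
    - by apply/measurable_EFinP; apply: (measurableT_comp (measurable_powR _)); exact: measurableT_comp.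
    - by apply: filterS AE => x E Ox; rewrite /rv_one_weights mul1r E.
  apply: le_trans (H G _ mg) _.
    by move=> b ba; apply: (measurable_weak_vderiv (f := f)); [exact: bam|exact: GWa].
  rewrite EFinM -muleA; apply: lee_wpmul2l; first by rewrite lee_fin.
  apply: (@le_trans _ _ (\sum_(b : {ffun 'I_d.+1 -> 'I_(mabs a).+1}) Wpow (sweights s v) v f)).
    have W0 : 0 <= Wpow (sweights s v) v f.
      by apply: sume_ge0 => c _; apply: integral_ge0 => x _; rewrite lee_fin powR_ge0.
    rewrite big_mkcond; apply: lee_sum => b _; case: asboolP => // ba.
    apply: le_trans (term_le_Wpow _ _ _ (bam _ ba)).
    by under eq_integral do rewrite mulrC.
  have -> : (#|{: {ffun 'I_d.+1 -> 'I_(mabs a).+1}}|%:R)%:E =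
      \sum_(b : {ffun 'I_d.+1 -> 'I_(mabs a).+1}) (1 : R)%:E by rewrite sumEFin sumr_const.
  by rewrite ge0_sume_distrl //; apply: lee_sum => b _; rewrite mul1e.
exists (\sum_(a : {ffun 'I_d.+1 -> 'I_m.+1}) D (fun i => nat_of_ord (a i)))%R.
  by apply: sumr_ge0 => a _; have [] := DP (fun i => nat_of_ord (a i)).
move=> f fL fW; rewrite {1}/Wpow -sumEFin ge0_sume_distrl; last first.
  by move=> a _; rewrite lee_fin; have [] := DP (fun i => nat_of_ord (a i)).
rewrite [X in X <= _]big_mkcond; apply: lee_sum => a _; case: ifPn => am.
  by have [_] := DP (fun i => nat_of_ord (a i)); apply.
apply: mule_ge0; first by rewrite lee_fin; have [] := DP (fun i => nat_of_ord (a i)).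
by apply: sume_ge0 => c _; apply: integral_ge0 => x _; rewrite lee_fin powR_ge0.
Qed.

Lemma cutoff_continuous f : inW O m p (sweights s v) v f ->
  forall eps : R, (0 < eps)%R -> exists2 delta : R, (0 < delta)%R &
    forall g, inW O m p (sweights s v) v g ->
      Wnorm O m p (sweights s v) v (fun x => g x - f x)%R < delta%:E ->
      Wnorm O m p rv_one_weights rv_one
        (fun x => chi eta v n x * g x - chi eta v n x * f x)%R < eps%:E.
Proof.
move=> fW eps eps0; have [D D0 H] := cutoff_Wpow.
have e20 : (0 < (eps / 2) `^ p)%R by rewrite powR_gt0 // divr_gt0.
have D10 : (0 < D + 1)%R by rewrite ltr_wpDl.
(* [D + 1] covers the case [D = 0], and [eps / 2] leaves room for the strict inequality at the
   end. *)
pose q : R := ((eps / 2) `^ p / (D + 1))%R.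
have q0 : (0 < q)%R by rewrite divr_gt0.
exists (q `^ p^-1)%R; first exact: powR_gt0.
move=> g gW; set h := (fun x => g x - f x)%R => hlt.
have fL := inW_inL1loc fW; have gL := inW_inL1loc gW.
have hL : inL1loc O v h by exact: inL1locB.
have pv0 : (0 <= p^-1)%R by rewrite invr_ge0 ltW.
have W0 w u k : 0 <= Wpow w u k.
  by apply: sume_ge0 => c _; apply: integral_ge0 => x _; rewrite lee_fin powR_ge0.
have Wq : Wpow (sweights s v) v h <= q%:E.
  rewrite leNgt; apply/negP => qlt; move: hlt; apply/negP; rewrite -leNgt.
  rewrite -poweR_EFin; apply: gt0_ler_poweR => //; last exact: ltW.
  - by rewrite in_itv /= lee_fin ltW // leey.
  - by rewrite in_itv /= W0 leey.
have -> : (fun x => chi eta v n x * g x - chi eta v n x * f x)%R = (fun x => chi eta v n x * h x)%R.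
  by apply/funext => x; rewrite /h mulrBr.
have E : Wpow rv_one_weights rv_one (fun x => chi eta v n x * h x)%R <= ((eps / 2) `^ p)%:E.
  apply: le_trans (H h hL _) _.
    move=> b /andP[b0 bm].
    have [|gf [Wf _]] := fW.2 b; first by rewrite b0.
    have [|gg [Wg _]] := gW.2 b; first by rewrite b0.
    exists (fun x => gg x - gf x)%R.
    exact: (is_weak_vderivB etaP oO (ckb_le bm cv0) gL fL Wg Wf).
  apply: (@le_trans _ _ (D%:E * q%:E)); first by apply: lee_wpmul2l; rewrite ?lee_fin.
  rewrite -EFinM lee_fin /q mulrCA ler_piMr //; first exact: ltW.
  by rewrite ler_pdivrMr // mul1r lerDl.
apply: (@le_lt_trans _ _ (eps / 2)%:E); last by rewrite lte_fin ltr_pdivrMr // ltr_pMr // ltr1n.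
have -> : (eps / 2)%:E = ((eps / 2) `^ p)%:E `^ p^-1.
  rewrite poweR_EFin -powRrM mulfV ?gt_eqF // powRr1 //.
  by rewrite divr_ge0 // ltW.
apply: gt0_ler_poweR => //.
- by rewrite in_itv /= W0 leey.
- by rewrite in_itv /= lee_fin powR_ge0 leey.
Qed.

End WeightedSobolev.

Unset Implicit Arguments.

Theorem theorem6 (R : realType) (d : nat) (O : set 'rV[R]_d) (p : R)
    (m : nat) (v : 'rV[R]_d -> R) (s : mindex d -> R) (n : nat)
    (eta : R -> R) :
  open O -> 1 <= p -> Ckstar O m v -> admissible m s -> (1 <= n)%N ->
  cutoff_eta eta ->
  (forall a : mindex d, (0 < mabs a <= m)%N ->
     exists C : R, 0 < C /\
       forall x, (Mset O v n `\` Mset O v (2 * n)) x ->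
         `|dpartialn a v x| <= C) ->
  (forall f, inW O m p (sweights s v) v f ->
     inW O m p rv_one_weights rv_one (fun x => chi eta v n x * f x) /\
     (forall a : mindex d, (0 < mabs a <= m)%N ->
        is_weak_vderiv O rv_one a (fun x => chi eta v n x * f x)
          (fun x => msum_le a (fun b =>
             (mbinom a b)%:R * Dv O v b f x
             * dpartialn (msub a b) (chi eta v n) x)))) /\
  (forall f, inW O m p (sweights s v) v f ->
     forall eps : R, 0 < eps -> exists2 delta : R, 0 < delta &
       forall g, inW O m p (sweights s v) v g ->
         (Wnorm O m p (sweights s v) v (fun x => g x - f x)%R < delta%:E)%E ->
         (Wnorm O m p rv_one_weights rv_one
            (fun x => chi eta v n x * g x - chi eta v n x * f x)%R
            < eps%:E)%E).
Proof.
(* For d = 0 the null set condition on v fails: [leb] charges even the empty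
   set, as degenerate boxes have volume 1 (an empty product). *)
case: d O v s => [|d] O v s oO p1 [cv leb_v0] sP n1 etaP bv.
  by exfalso; move: leb_v0; apply/eqP; exact: leb_dim0.
split; last exact: (cutoff_continuous p1 etaP oO cv n1 sP bv).
move=> f fW; split; first exact: (cutoff_inW p1 etaP oO cv n1 sP bv fW).
move=> a /andP[_ am].
have -> : (fun x => msum_le a (fun b => (mbinom a b)%:R * Dv O v b f x
    * dpartialn (msub a b) (chi eta v n) x)) =
    cutoff_derivative eta v n (fun b => Dv O v b f) a.
  apply/funext => x; rewrite /cutoff_derivative -msum_leE; congr msum_le.
  by apply/funext => b; rewrite mulrA.
apply: (cutoff_is_weak_vderiv etaP oO cv n1 bv am); first exact: (inW_inL1loc p1 oO cv sP fW).
move=> b ba; apply: (inW_Dv p1 oO cv sP fW).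
by apply: leq_trans am; exact: mle_mabs.
Qed.
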